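(* Let $d\ge 1$ and assume $1<p<\infty$ and $1<s\le1+\frac dp$. Then for any $M>0$, there exist $f,g\in\mathcal S(\mathbb R^d)$ such that $$\|J^sf\|_p+\|g\|_{\mathrm{BMO}}+\|\partial f\|_\infty+\|J^{s-1}g\|_p\le1,$$ but $$\|J^s(fg)-fJ^sg\|_p>M.$$
   Context: $\mathcal S(\mathbb R^d)$ is the space of Schwartz functions, $\|\cdot\|_p$ the $L^p(\mathbb R^d)$ norm. $J^s=(1-\Delta)^{s/2}$ is the Fourier multiplier with symbol $(1+|\xi|^2)^{s/2}$. $\partial=(\partial_1,\dots,\partial_d)$ is the gradient; norms of vector-valued functions are taken componentwise. The BMO norm is $\|u\|_{\mathrm{BMO}}=\sup_Q\frac1{|Q|}\int_Q|u-u_Q|\,dy$ ($u_Q$ the average over $Q$, supremum over all cubes $Q\subset\mathbb R^d$). *)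

(* Defs.v *)
From HB Require Import structures.
From mathcomp Require Import all_boot all_order all_algebra.
From mathcomp Require Import all_classical all_reals all_analysis.
From mathcomp.real_closed Require Import complex.

Set Implicit Arguments.
Unset Strict Implicit.
Unset Printing Implicit Defensive.

Import Order.TTheory GRing.Theory Num.Theory.
Import numFieldNormedType.Exports.

Local Open Scope classical_set_scope.
Local Open Scope complex_scope.
Local Open Scope ring_scope.

(* Row vectors carry the product of the Borel sigma-algebras of the
   coordinates, as [n.-tuple T] does in the library. *)
Section measurable_rV.
Context {R : realType} {n : nat}.

Let coord (i : 'I_n) (x : 'rV[R]_n) : R := x ord0 i.

Let rV_set0 : g_sigma_preimage coord set0.
Proof. exact: sigma_algebra0. Qed.

Let rV_setC A : g_sigma_preimage coord A -> g_sigma_preimage coord (~` A).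
Proof. exact: sigma_algebraC. Qed.

Let rV_bigcup (F : (set 'rV[R]_n)^nat) :
  (forall i, g_sigma_preimage coord (F i)) ->
  g_sigma_preimage coord (\bigcup_i F i).
Proof. exact: sigma_algebra_bigcup. Qed.

HB.instance Definition _ := @isMeasurable.Build default_measure_display
  'rV[R]_n (g_sigma_preimage coord) rV_set0 rV_setC rV_bigcup.

Lemma measurable_coord (i : 'I_n) :
  measurable_fun [set: 'rV[R]_n] (fun x : 'rV[R]_n => x ord0 i : R).
Proof.
move=> _ Y mY; rewrite setTI; apply: sub_sigma_algebra => /=.
rewrite -bigcup_seq/=; exists i => /=; first by rewrite mem_index_enum.
by exists Y => //; rewrite setTI.
Qed.

Lemma measurable_fun_rVP d (T : measurableType d) (f : T -> 'rV[R]_n) :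
  (forall i, measurable_fun [set: T] (fun x => f x ord0 i : R)) ->
  measurable_fun [set: T] f.
Proof.
move=> mf; suff: g_sigma_preimage (fun i => coord i \o f) `<=` measurable.
  by rewrite g_sigma_preimage_comp => prefS _ A mA; apply: prefS; exists A.
apply: smallest_sub; first exact: sigma_algebra_measurable.
rewrite -bigcup_seq/=; apply: bigcup_sub => i _.
by move=> A [B mB <-]; exact: mf.
Qed.

End measurable_rV.

Section lebesgue_rV.
Context {R : realType}.

Definition rV_cons n (z : 'rV[R]_n * measurableTypeR R) : 'rV[R]_n.+1 :=
  \row_i oapp (z.1 ord0) z.2 (unlift ord0 i).

Lemma measurable_rV_cons n : measurable_fun setT (@rV_cons n).
Proof.
apply: measurable_fun_rVP => i; rewrite /rV_cons.
case: (unliftP ord0 i) => [j ->|->].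
  rewrite (_ : (fun z => _) = (fun x : 'rV[R]_n => x ord0 j) \o fst).
    exact: (measurableT_comp (measurable_coord j) measurable_fst).
  by apply/funext => z; rewrite mxE liftK.
rewrite (_ : (fun z => _) = snd); first exact: measurable_snd.
by apply/funext => z; rewrite mxE unlift_none.
Qed.

Section extend.
Context n (mu : {measure set 'rV[R]_n -> \bar R}).

Definition extend_measure : set 'rV[R]_n.+1 -> \bar R :=
  pushforward (mu \x @lebesgue_measure R)%E (@rV_cons n).

Let extend0 : extend_measure set0 = 0%E.
Proof. by rewrite /extend_measure /pushforward preimage_set0 measure0. Qed.

Let extend_ge0 A : (0 <= extend_measure A)%E.
Proof. by rewrite /extend_measure /pushforward measure_ge0. Qed.

Let extend_sigma_additive : semi_sigma_additive extend_measure.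
Proof.
move=> F mF tF mUF; rewrite /extend_measure /pushforward preimage_bigcup.
have mpre A : measurable A -> measurable (@rV_cons n @^-1` A).
  by move=> mA; rewrite -[X in measurable X]setTI; exact: measurable_rV_cons.
apply: measure_semi_sigma_additive.
- by move=> k; exact: mpre.
- apply/trivIsetP => /= i j _ _ ij; rewrite -preimage_setI.
  by move/trivIsetP : tF => /(_ _ _ _ _ ij) ->//; rewrite preimage_set0.
- by rewrite -preimage_bigcup; exact: mpre.
Qed.

HB.instance Definition _ := isMeasure.Build _ _ _
  extend_measure extend0 extend_ge0 extend_sigma_additive.

End extend.

(* Lebesgue measure on R^n: the n-fold product of the one-dimensional one. *)
Fixpoint lebesgue_rV n : {measure set 'rV[R]_n -> \bar R} :=
  match n with
  | 0 => dirac (0 : 'rV[R]_0)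
  | n'.+1 => extend_measure (lebesgue_rV n')
  end.

End lebesgue_rV.
Arguments lebesgue_rV {R} n.

Section function_spaces.
Context {R : realType} {d : nat}.
Local Notation E := 'rV[R]_d.
Local Notation mu := (@lebesgue_rV R d).

Definition dot (x y : E) : R := \sum_(i < d) x ord0 i * y ord0 i.

Definition partial (i : 'I_d) (h : E -> R) : E -> R :=
  fun x => 'D_(delta_mx ord0 i) h x.

Definition partials (l : seq 'I_d) (h : E -> R) : E -> R :=
  foldr partial h l.

Definition smooth (h : E -> R) : Prop :=
  forall l : seq 'I_d, continuous (partials l h) /\
    forall i x, derivable (partials l h) x (delta_mx ord0 i).

Definition rapidly_decreasing (h : E -> R) : Prop :=
  forall k : nat, exists C : R, forall x, (1 + dot x x) ^+ k * `|h x| <= C.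

Definition real_schwartz (h : E -> R) : Prop :=
  smooth h /\ forall l : seq 'I_d, rapidly_decreasing (partials l h).

Definition re (f : E -> R[i]) : E -> R := fun x => complex.Re (f x).
Definition im (f : E -> R[i]) : E -> R := fun x => complex.Im (f x).

Definition schwartz (f : E -> R[i]) : Prop :=
  real_schwartz (re f) /\ real_schwartz (im f).

Definition cpartial (i : 'I_d) (f : E -> R[i]) : E -> R[i] :=
  fun x => partial i (re f) x +i* partial i (im f) x.

Definition cmod (z : R[i]) : R := ComplexField.Normc.normc z.

Definition Lpnorm (p : \bar R) (f : E -> R[i]) : \bar R :=
  'N[mu]_p[(fun x => (cmod (f x))%:E)].

(* The sum over components is the largest of the usual conventions. *)
Definition grad_norm (p : \bar R) (f : E -> R[i]) : \bar R :=
  (\sum_(i < d) Lpnorm p (cpartial i f))%E.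

Definition cintegral (D : set E) (f : E -> R[i]) : R[i] :=
  (\int[mu]_(x in D) (re f x)) +i* (\int[mu]_(x in D) (im f x)).

Definition cube (c : E) (r : R) : set E :=
  [set y | forall i, c ord0 i <= y ord0 i <= c ord0 i + r].

Definition average (Q : set E) (u : E -> R[i]) : R[i] :=
  ((fine (mu Q))^-1)%:C * cintegral Q u.

Definition mean_oscillation (Q : set E) (u : E -> R[i]) : \bar R :=
  (((fine (mu Q))^-1)%:E *
    \int[mu]_(y in Q) (cmod (u y - average Q u))%:E)%E.

Definition bmo_norm (u : E -> R[i]) : \bar R :=
  ereal_sup [set t | exists (c : E) (r : R),
    0 < r /\ t = mean_oscillation (cube c r) u].

Definition expi (t : R) : R[i] := cos t +i* sin t.

(* This normalization is the one for which -Delta has symbol |xi|^2. *)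
Definition fourier (f : E -> R[i]) : E -> R[i] :=
  fun xi => cintegral setT (fun x => expi (- dot x xi) * f x).

Definition inverse_fourier (h : E -> R[i]) : E -> R[i] :=
  fun x => (((2 * pi) ^+ d)^-1)%:C *
    cintegral setT (fun xi => expi (dot x xi) * h xi).

Definition bessel (s : R) (f : E -> R[i]) : E -> R[i] :=
  inverse_fourier (fun xi =>
    ((1 + dot xi xi) `^ (s / 2))%:C * fourier f xi).

End function_spaces.

(* Main.v *)
Require Import Defs.
From HB Require Import structures.
From mathcomp Require Import all_boot all_order all_algebra.
From mathcomp Require Import all_classical all_reals all_analysis.
From mathcomp Require Import measurable_realfun ess_sup_inf.
From mathcomp.real_closed Require Import complex.
From mathcomp Require Import ring lra.

Set Implicit Arguments.
Unset Strict Implicit.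
Unset Printing Implicit Defensive.

Import Order.TTheory GRing.Theory Num.Theory.
Import numFieldNormedType.Exports.

Local Open Scope classical_set_scope.
Local Open Scope ring_scope.

(** The commutator [J^s (f g) - f J^s g] contains the term [g J^s f], over which
    the assumed norms have no control: [f] may oscillate so fast that [f] and
    its gradient are small although [J^s f] has norm one quarter in [L^p], and
    [g] may be large at a point although its BMO norm and the norm of
    [J^(s-1) g] in [L^p] are small. The latter uses [s - 1 <= d / p], the range
    in which the Sobolev embedding into the bounded functions fails.

    The function [f] has a Gaussian symbol of parameter [b], centred at a far
    frequency [c] and divided by [(1 + |xi|^2)^(s/2)]. Hence [J^s f] is a
    modulated Gaussian of explicit modulus ([cmod_ift_gauss]), while [f] and its
    gradient tend to zero as [c] goes to infinity, because [s > 1]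
    ([small_mass]).

    The function [g] is a multiple of a sum of [n] dyadic blocks, Bessel
    potentials of order [sg = s - 1] of Gaussians of width [2^-j]. Their
    transforms are nonnegative ([cosT_bessel_gauss_ge0]) and of order one at the
    origin ([int_block_ge]), so that the sum has size [n] there. Over a cube of
    side [r], the mean oscillation of the block of index [j] is at most of order
    [min(t, 1/t)] with [t = (2^j r)^e] for some [e > 0]
    ([block_oscillation]), so the BMO norm of the sum is bounded independently
    of [n] ([bmo_blocks]). Finally [J^(s-1)] turns the blocks into Gaussians that
    concentrate at different scales, so that the [L^p] norm of their sum is only
    of order [n^(1/p)] ([Lp_blocks]). Division by [n^(1/p)] gives a function of
    small norms and of size [n^(1-1/p)] at the origin ([bad_symbol]).

    It remains to see that [J^s (f g) - g J^s f] and [f J^s g] are small. The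
    second is, since [f] is small and [J^s g] is bounded. The symbol of the
    first is an integral of the difference [(1 + |xi|^2)^(s/2) - (1 + |z|^2)^(s/2)]
    against the symbols of [f] at [z] and of [g] at [xi - z]; this difference
    gains half a power of [1 + |z|^2] over [(1 + |z|^2)^(s/2)] ([jb_powR_diff]),
    so the symbol has small mass when [c] is far ([commutator_symbol]).

    The order of the choices matters: first [g], then [b], such that [g] is still
    large where the Gaussian [|J^s f|] has a fixed share of its norm, and last
    [c]. The share does not depend on [b], because the norm of [J^s f] is
    normalised. *)

(** * Integrals over product spaces *)

Definition itg d (T : measurableType d) (R : realType)
  (mu : {measure set T -> \bar R}) (f : T -> R) : bool :=
  mu.-integrable setT (EFin \o f).

Section sigma_finite_pack.
Context d (T : measurableType d) (R : realType).
Variables (m : {measure set T -> \bar R}) (sfm : sigma_finite setT m).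

(** The product-measure lemmas expect a structure of sigma-finite measures;
    this builds one from a bare proof. *)
Definition sigma_finite_pack of sigma_finite setT m : set T -> \bar R := m.

HB.instance Definition _ := Measure.copy (sigma_finite_pack sfm) m.
HB.instance Definition _ :=
  Measure_isSigmaFinite.Build _ _ _ (sigma_finite_pack sfm) sfm.

End sigma_finite_pack.

Section fubini.
Context d1 d2 (T1 : measurableType d1) (T2 : measurableType d2) (R : realType).
Variables (m1 : {measure set T1 -> \bar R}) (m2 : {measure set T2 -> \bar R}).
Hypotheses (sf1 : sigma_finite setT m1) (sf2 : sigma_finite setT m2).

Let n1 : {sigma_finite_measure set T1 -> \bar R} := sigma_finite_pack sf1.
Let n2 : {sigma_finite_measure set T2 -> \bar R} := sigma_finite_pack sf2.

Lemma measurable_integral2 (f : T1 * T2 -> \bar R) :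
  measurable_fun setT f -> (forall z, 0 <= f z)%E ->
  measurable_fun setT (fun x => \int[m2]_y f (x, y))%E.
Proof. exact: (@measurable_fun_fubini_tonelli_F _ _ _ _ _ n2). Qed.

Section dominated.
Variables (H : T1 * T2 -> R) (a : T1 -> R) (b : T2 -> R).
Hypotheses (mH : measurable_fun setT H)
  (ia : itg m1 a) (ib : itg m2 b)
  (Hab : forall x y, `|H (x, y)| <= a x * b y).

(** Domination by a product of two integrable functions is all that Fubini's
    theorem requires in the sequel. *)
Let integrableH : (n1 \x n2)%E.-integrable setT (EFin \o H).
Proof.
apply/(integrable12ltyP n1 n2); first exact/measurable_EFinP.
apply: (@le_lt_trans _ _ (\int[m1]_x \int[m2]_y (`|(a x)%:E| * `|(b y)%:E|))%E).
  have m12 : measurable_fun setT (fun z : T1 * T2 => `|(H z)%:E|)%E.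
    by apply/measurable_EFinP; apply: measurableT_comp.
  have m12' : measurable_fun setT (fun z : T1 * T2 => (`|(a z.1)%:E| * `|(b z.2)%:E|))%E.
    apply: emeasurable_funM; apply: measurableT_comp => //.
      by move/measurable_int : ia => /= ?; exact: (@measurableT_comp _ _ _ _ _ _ (EFin \o a)).
    by move/measurable_int : ib => /= ?; exact: (@measurableT_comp _ _ _ _ _ _ (EFin \o b)).
  apply: ge0_le_integral => //.
  - by move=> x _; apply: integral_ge0.
  - by apply: (@measurable_integral2 (fun z => `|(H z)%:E|)%E).
  - exact: (@measurable_integral2 (fun z => (`|(a z.1)%:E| * `|(b z.2)%:E|))%E).
  - move=> x _; apply: ge0_le_integral => //.
    + exact: (measurableT_comp m12 (pair1_measurable x)).
    + exact: (measurableT_comp m12' (pair1_measurable x)).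
    + move=> y _; rewrite /= -EFinM lee_fin (le_trans (Hab _ _))// -normrM.
      exact: ler_norm.
under eq_integral => x _.
  rewrite ge0_integralZl//; last first.
    by apply: measurableT_comp => //; exact: measurable_int ib.
  over.
rewrite ge0_integralZr//; last 2 first.
- by apply: measurableT_comp => //; exact: measurable_int ia.
- exact: integral_ge0.
move/integrableP : ia => [_]; move/integrableP: ib => [_] /= hb ha.
by rewrite lte_mul_pinfty// ?integral_ge0// ge0_fin_numE// integral_ge0.
Qed.

Lemma integrable_section1 x : itg m2 (fun y => H (x, y)).
Proof.
apply: (@le_integrable _ _ _ _ _ _ _ (fun y => (a x)%:E * (b y)%:E)%E) => //.
- apply/measurable_EFinP.
  exact: (measurableT_comp mH (pair1_measurable x)).
- move=> y _ /=; rewrite lee_fin (le_trans (Hab _ _))//.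
  exact: ler_norm.
- exact: integrableZl.
Qed.

Lemma integrable_section2 y : itg m1 (fun x => H (x, y)).
Proof.
apply: (@le_integrable _ _ _ _ _ _ _ (fun x => (b y)%:E * (a x)%:E)%E) => //.
- apply/measurable_EFinP.
  exact: (measurableT_comp mH (pair2_measurable y)).
- move=> x _ /=; rewrite lee_fin (le_trans (Hab _ _))// mulrC.
  exact: ler_norm.
- exact: integrableZl.
Qed.

Lemma integrable_integral2 :
  itg m1 (fun x => \int[m2]_y H (x, y)).
Proof.
apply: (eq_integrable _ (fun x => \int[m2]_y (H (x, y))%:E)%E) => //.
  move=> x _; rewrite /= /Rintegral fineK//.
  exact/integrable_fin_num/integrable_section1.
exact: integrable_fubini_F integrableH.
Qed.

Lemma Rintegral_swap :
  \int[m1]_x \int[m2]_y H (x, y) = \int[m2]_y \int[m1]_x H (x, y).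
Proof.
congr fine; transitivity (\int[m1]_x \int[m2]_y (H (x, y))%:E)%E.
  apply: eq_integral => x _; rewrite /Rintegral fineK//.
  exact/integrable_fin_num/integrable_section1.
rewrite (Fubini integrableH); apply: eq_integral => y _; rewrite /Rintegral fineK//.
exact/integrable_fin_num/integrable_section2.
Qed.

End dominated.
End fubini.

(** * Lebesgue measure on row vectors *)

Section lebesgue_rV.
Context {R : realType}.
Local Notation leb := (@lebesgue_measure R).

Lemma rV_cons0 n (x : 'rV[R]_n) (t : R) : rV_cons (x, t) ord0 ord0 = t.
Proof. by rewrite mxE unlift_none. Qed.

Lemma rV_consS n (x : 'rV[R]_n) (t : R) i :
  rV_cons (x, t) ord0 (lift ord0 i) = x ord0 i.
Proof. by rewrite mxE liftK. Qed.

Definition box n (a b : 'I_n -> R) : set 'rV[R]_n :=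
  [set y | forall i, a i <= y ord0 i <= b i].

Lemma measurable_box n (a b : 'I_n -> R) : measurable (box a b).
Proof.
have -> : box a b = \big[setI/setT]_(i < n) ((fun y : 'rV[R]_n => y ord0 i) @^-1` `[a i, b i]).
  rewrite -bigcap_seq; apply/seteqP; split => y /=.
    by move=> h i _ /=; rewrite in_itv /= h.
  by move=> h i; have := h i (mem_index_enum i); rewrite /= in_itv.
apply: bigsetI_measurable => i _; rewrite -[X in measurable X]setTI.
exact: measurable_coord.
Qed.

Lemma lebesgue_rV_box n (a b : 'I_n -> R) : (forall i, a i <= b i) ->
  lebesgue_rV n (box a b) = (\prod_(i < n) (b i - a i))%:E.
Proof.
elim: n a b => [|n IHn] a b ab.
  rewrite big_ord0 /= diracE mem_set//.
  by case.
rewrite /= /extend_measure /pushforward.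
have -> : @rV_cons R n @^-1` box a b =
    box (fun i => a (lift ord0 i)) (fun i => b (lift ord0 i)) `*` `[a ord0, b ord0]%classic.
  apply/seteqP; split => [[x t] /= h|[x t] /= [h1 h2] i].
    split => [i|]; first by have := h (lift ord0 i); rewrite rV_consS.
    by have := h ord0; rewrite rV_cons0 in_itv.
  case: (unliftP ord0 i) => [j ->|->]; first by rewrite rV_consS; exact: h1.
  by rewrite rV_cons0; move: h2; rewrite in_itv.
rewrite product_measure1E//; last exact: measurable_box.
rewrite IHn => [|i]; last exact: ab.
rewrite big_ord_recl mulrC EFinM; congr (_ * _)%E.
rewrite -[LHS]/(leb `[a ord0, b ord0]%classic) lebesgue_measure_itv /= lte_fin.
have := ab ord0; rewrite le_eqVlt => /predU1P[->|->//].
by rewrite ltxx subrr.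
Qed.

Lemma sigma_finite_lebesgue_rV n : sigma_finite setT (@lebesgue_rV R n).
Proof.
exists (fun k => box (fun _ : 'I_n => - k%:R) (fun=> k%:R)).
  apply/esym; rewrite -subTset => x _ /=.
  exists (Num.truncn (\sum_i `|x ord0 i|)).+1 => // i; rewrite -ler_norml.
  apply: le_trans (ltW (truncnS_gt _)).
  by rewrite (bigD1 i)//= lerDl sumr_ge0.
move=> k; split; first exact: measurable_box.
rewrite lebesgue_rV_box ?ltry// => i.
by rewrite (@le_trans _ _ 0)// oppr_le0.
Qed.

Lemma integral_rV0 (f : 'rV[R]_0 -> \bar R) : (forall x, 0 <= f x)%E ->
  (\int[lebesgue_rV 0]_x f x = f 0%R)%E.
Proof.
move=> f0 /=; rewrite integral_dirac ?diracT ?mul1e// => _ Y mY.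
have [f0Y|f0Y] := pselect (Y (f 0)).
  rewrite (_ : _ `&` _ = setT)//; apply/seteqP; split => // x _; split => //.
  by rewrite /= (_ : x = 0)//; apply/rowP; case.
rewrite (_ : _ `&` _ = set0)//; apply/seteqP; split => // x [_ /=].
by rewrite (_ : x = 0)//; apply/rowP; case.
Qed.

Lemma integral_rVS n (f : 'rV[R]_n.+1 -> \bar R) :
  measurable_fun setT f -> (forall x, 0 <= f x)%E ->
  (\int[lebesgue_rV n.+1]_x f x =
   \int[lebesgue_rV n]_x \int[leb]_t f (rV_cons (x, t)))%E.
Proof.
move=> mf f0.
transitivity (\int[pushforward (lebesgue_rV n \x leb)%E (@rV_cons R n)]_x f x)%E => //.
rewrite ge0_integral_pushforward//; last exact: measurable_rV_cons.
rewrite preimage_setT.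
have := @fubini_tonelli1 _ _ _ _ _
  (sigma_finite_pack (@sigma_finite_lebesgue_rV n)) leb (f \o @rV_cons R n).
apply => [|x]; last exact: f0.
exact: (measurableT_comp mf (@measurable_rV_cons R n)).
Qed.

Lemma measurable_add_rV n (c : 'rV[R]_n) :
  measurable_fun setT (fun x : 'rV[R]_n => x + c).
Proof.
apply: measurable_fun_rVP => i.
under eq_fun do rewrite mxE.
exact: measurable_funD (measurable_coord i) (measurable_cst _).
Qed.

(** Translation preserves the length of half-open intervals, and these lengths
    determine the measure. *)
Lemma lebesgue_measure_shift (c : R) (A : set (measurableTypeR R)) :
  measurable A -> pushforward leb (fun x : measurableTypeR R => x + c : measurableTypeR R) A = leb A.
Proof.
have ms : measurable_fun setT (fun x : measurableTypeR R => x + c : measurableTypeR R).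
  exact: (@measurable_funD _ _ R _ (fun x => x) (cst c)).
pose mm := isMeasurableFun.Build _ _ _ _ _ ms.
pose pk : {mfun measurableTypeR R >-> measurableTypeR R} := HB.pack (fun x : measurableTypeR R => x + c : measurableTypeR R) mm.
move=> mA; apply/esym.
rewrite (@lebesgue_measure_unique R (pushforward leb pk))//.
move=> _ [[a b]] _ <-.
have E : (fun x : R => x + c) @^-1` `]a, b] = `]a - c, b - c]%classic.
  by apply/seteqP; split => x /=; rewrite !in_itv /= ltrBlDr lerBrDr.
rewrite /pushforward -[RHS]/(leb ((fun x : R => x + c) @^-1` `]a, b])) E.
rewrite !lebesgue_measure_itv /= !lte_fin ltrD2r -!EFinB.
by rewrite opprB addrA subrK.
Qed.

Lemma ge0_integral_shift (c : R) (f : R -> \bar R) :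
  measurable_fun setT f -> (forall t, 0 <= f t)%E ->
  (\int[leb]_t f (t + c)%R = \int[leb]_t f t)%E.
Proof.
move=> mf f0.
have ms : measurable_fun setT (fun x : measurableTypeR R => x + c : measurableTypeR R).
  exact: (@measurable_funD _ _ R _ (fun x => x) (cst c)).
have := @ge0_integral_pushforward _ _ _ _ _ _ ms leb setT f measurableT mf.
move=> /(_ (fun y _ => f0 y)); rewrite preimage_setT => <-.
by apply: eq_measure_integral => A mA _; exact: lebesgue_measure_shift.
Qed.

(** By induction on the dimension, one coordinate being translated at a time. *)
Lemma ge0_integral_rV_shift n (c : 'rV[R]_n) (f : 'rV[R]_n -> \bar R) :
  measurable_fun setT f -> (forall x, 0 <= f x)%E ->
  (\int[lebesgue_rV n]_x f (x + c)%R = \int[lebesgue_rV n]_x f x)%E.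
Proof.
elim: n c f => [|n IHn] c f mf f0.
  by rewrite !integral_rV0//; congr f; apply/rowP; case.
have mfc := measurableT_comp mf (@measurable_add_rV _ c).
apply: (etrans (integral_rVS mfc (fun x => f0 _))).
apply: (etrans _ (esym (integral_rVS mf f0))).
pose c' : 'rV[R]_n := \row_i c ord0 (lift ord0 i).
have mf2 : measurable_fun setT (fun z : 'rV[R]_n * measurableTypeR R => f (rV_cons z)).
  exact: measurableT_comp mf (@measurable_rV_cons R n).
rewrite -[RHS](IHn c'); first last.
- by move=> x; apply: integral_ge0.
- exact: (@measurable_fun_fubini_tonelli_F _ _ _ _ _ leb (f \o @rV_cons R n) mf2 (fun z => f0 _)).
apply: eq_integral => x _.
rewrite -[RHS](ge0_integral_shift (c ord0 ord0)); first last.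
- by [].
- exact: (measurableT_comp mf2 (pair1_measurable (x + c'))).
apply: eq_integral => t _; congr f; apply/rowP => i.
case: (unliftP ord0 i) => [j ->|->]; first by rewrite mxE !rV_consS !mxE.
by rewrite mxE !rV_cons0.
Qed.

Lemma measurable_prod_coord n (f : 'I_n -> R -> R) :
  (forall i, measurable_fun setT (f i)) ->
  measurable_fun setT (fun x : 'rV[R]_n => \prod_i f i (x ord0 i)).
Proof.
move=> mf; apply: measurable_prod => i _.
exact: measurableT_comp (mf i) (measurable_coord i).
Qed.

Lemma integral_prod_coord n (f : 'I_n -> R -> R) (v : 'I_n -> R) :
  (forall i, measurable_fun setT (f i)) -> (forall i t, 0 <= f i t) ->
  (forall i, \int[leb]_t (f i t)%:E = (v i)%:E)%E ->
  (\int[lebesgue_rV n]_x (\prod_i f i (x ord0 i))%:E = (\prod_i v i)%:E)%E.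
Proof.
elim: n f v => [|n IHn] f v mf f0 fv.
  by rewrite integral_rV0 ?big_ord0// => x; rewrite big_ord0.
rewrite integral_rVS; first last.
- by move=> x; rewrite lee_fin prodr_ge0.
- by apply/measurable_EFinP; exact: measurable_prod_coord.
under eq_integral => x _.
  under eq_integral => t _.
    rewrite big_ord_recl rV_cons0.
    under eq_bigr do rewrite rV_consS.
    rewrite EFinM.
    over.
  rewrite ge0_integralZr//; last 3 first.
  - by apply/measurable_EFinP; exact: mf.
  - by move=> t _; rewrite lee_fin; exact: f0.
  - by rewrite lee_fin prodr_ge0.
  rewrite fv.
  over.
rewrite ge0_integralZl//; last 3 first.
- apply/measurable_EFinP.
  exact: (@measurable_prod_coord n (fun i => f (lift ord0 i))).
- by move=> t _; rewrite lee_fin prodr_ge0.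
- by rewrite -fv; apply: integral_ge0 => t _; rewrite lee_fin.
by rewrite (IHn (fun i => f (lift ord0 i)) (fun i => v (lift ord0 i)))// big_ord_recl.
Qed.

(** An open set is the union of the boxes with rational corners that it
    contains. *)
Lemma open_measurable_rV n (U : set 'rV[R]_n) : open U -> measurable U.
Proof.
move=> oU; pose B (q : 'rV[rat]_n * 'rV[rat]_n) :=
  box (fun i => ratr (q.1 ord0 i)) (fun i => ratr (q.2 ord0 i)) : set 'rV[R]_n.
have -> : U = \bigcup_q (if pselect (B q `<=` U) then B q else set0).
  apply/seteqP; split => [x Ux|x [q _]]; last by case: pselect => //= qU /qU.
  have [e e0 xeU] : exists2 e : R, 0 < e & ball x e `<=` U.
    by move: oU; rewrite openE => /(_ _ Ux) /nbhs_ballP [e ? ?]; exists e.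
  have /choice [l hl] : forall i, exists q : rat, x ord0 i - e < ratr q < x ord0 i.
    move=> i; have /rat_in_itvoo[q] : x ord0 i - e < x ord0 i by rewrite ltrBlDr ltrDl.
    by rewrite in_itv; exists q.
  have /choice [u hu] : forall i, exists q : rat, x ord0 i < ratr q < x ord0 i + e.
    move=> i; have /rat_in_itvoo[q] : x ord0 i < x ord0 i + e by rewrite ltrDl.
    by rewrite in_itv; exists q.
  exists (\row_i l i, \row_i u i) => //; case: pselect => [?|[]] /=.
    move=> i; rewrite /= !mxE; have /andP[_ li] := hl i; have /andP[ui _] := hu i.
    by rewrite !ltW.
  move=> y yB; apply: xeU; split => // i j; rewrite ord1.
  have := yB j; rewrite /= !mxE => /andP[ly yu].
  rewrite /ball /= ltr_norml; have /andP[? ?] := hl j; have /andP[? ?] := hu j.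
  by apply/andP; split; lra.
apply: countable_bigcupT_measurable; first exact: countableP.
by move=> q; case: pselect => //= ?; exact: measurable_box.
Qed.

Lemma continuous_measurable_rV n (h : 'rV[R]_n -> R) :
  continuous h -> measurable_fun setT h.
Proof.
move=> ch; apply: (measurability _ (RGenOpens.measurableE R)).
move=> _ [_ [a [b ->]] <-]; rewrite setTI; apply: open_measurable_rV.
by move/continuousP : ch; apply; exact: interval_open.
Qed.

End lebesgue_rV.

(** * Real integrals, the bracket and Gaussians *)

Section real_integrals.
Context d (T : measurableType d) (R : realType) (mu : {measure set T -> \bar R}).
Implicit Types f g : T -> R.

Lemma integrable_le f g : measurable_fun setT f -> (forall x, `|f x| <= g x) ->
  itg mu g -> itg mu f.
Proof.
move=> mf fg; apply: le_integrable => //; first exact/measurable_EFinP.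
by move=> x _ /=; rewrite lee_fin (le_trans (fg x))// ler_norm.
Qed.

Lemma integrable_measurable f : itg mu f -> measurable_fun setT f.
Proof. by move/measurable_int/measurable_EFinP. Qed.

Lemma Rintegral_norm_le f g : itg mu f ->
  itg mu g -> (forall x, `|f x| <= g x) ->
  `|\int[mu]_x f x| <= \int[mu]_x g x.
Proof.
move=> itf ig fg; apply: le_trans (le_normr_Rintegral _ itf) _ => //.
apply: le_Rintegral => //; exact: integrable_norm.
Qed.

Lemma ge0_integrable f (v : R) : measurable_fun setT f -> (forall x, 0 <= f x) ->
  (\int[mu]_x (f x)%:E <= v%:E)%E -> itg mu f.
Proof.
move=> mf f0 fv; apply/integrableP; split; first exact/measurable_EFinP.
under eq_integral do rewrite /= ger0_norm//.
exact: le_lt_trans fv (ltry _).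
Qed.

Lemma integral_fineE f : itg mu f ->
  (\int[mu]_x (f x)%:E)%E = (\int[mu]_x f x)%:E.
Proof. by move=> itf; rewrite /Rintegral fineK//; exact: integrable_fin_num. Qed.

Lemma integrableEZl c f : itg mu f ->
  itg mu (fun x => c * f x).
Proof. by move=> itf; exact: (integrableZl measurableT c itf). Qed.

Lemma integrableED f g : itg mu f ->
  itg mu g -> itg mu (fun x => f x + g x).
Proof. by move=> itf ig; exact: (integrableD measurableT itf ig). Qed.

Lemma integrableEB f g : itg mu f ->
  itg mu g -> itg mu (fun x => f x - g x).
Proof. by move=> itf ig; exact: (integrableB measurableT itf ig). Qed.

Lemma integrable_bounded_mul (h f : T -> R) (C : R) : measurable_fun setT h ->
  (forall x, `|h x| <= C) -> itg mu f ->
  itg mu (fun x => h x * f x).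
Proof.
move=> mh hC itf; apply: (@integrable_le _ (fun x => C * `|f x|)).
- by apply: measurable_funM => //; exact: integrable_measurable.
- by move=> x; rewrite normrM ler_wpM2r.
- apply: integrableEZl; exact: integrable_norm.
Qed.

End real_integrals.

Section dot.
Context {R : realType} {n : nat}.
Implicit Types x y z : 'rV[R]_n.

Lemma dotC x y : dot x y = dot y x.
Proof. by apply: eq_bigr => i _; rewrite mulrC. Qed.

Lemma dotDr x y z : dot x (y + z) = dot x y + dot x z.
Proof. by rewrite -big_split; apply: eq_bigr => i _; rewrite mxE mulrDr. Qed.

Lemma dotZr (a : R) x y : dot x (a *: y) = a * dot x y.
Proof. by rewrite mulr_sumr; apply: eq_bigr => i _; rewrite mxE mulrCA. Qed.

Lemma dotNr x y : dot x (- y) = - dot x y.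
Proof. by rewrite -scaleN1r dotZr mulN1r. Qed.

Lemma dotBr x y z : dot x (y - z) = dot x y - dot x z.
Proof. by rewrite dotDr dotNr. Qed.

Lemma dotDl x y z : dot (x + y) z = dot x z + dot y z.
Proof. by rewrite dotC dotDr !(dotC z). Qed.

Lemma dotZl (a : R) x y : dot (a *: x) y = a * dot x y.
Proof. by rewrite dotC dotZr (dotC y). Qed.

Lemma dotNl x y : dot (- x) y = - dot x y.
Proof. by rewrite dotC dotNr (dotC y). Qed.

Lemma dotBl x y z : dot (x - y) z = dot x z - dot y z.
Proof. by rewrite dotDl dotNl. Qed.

Lemma dot0l x : dot 0 x = 0.
Proof. by rewrite -(scale0r x) dotZl mul0r. Qed.

Lemma dot_deltal i x : dot (delta_mx ord0 i) x = x ord0 i.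
Proof.
rewrite /dot (bigD1 i)//= mxE !eqxx mul1r big1 ?addr0// => j ji.
by rewrite mxE eqxx (negbTE ji) mul0r.
Qed.

Lemma dotxx x : dot x x = \sum_i x ord0 i ^+ 2.
Proof. by apply: eq_bigr => i _; rewrite expr2. Qed.

Lemma dotxx_ge0 x : 0 <= dot x x.
Proof. by rewrite dotxx sumr_ge0// => i _; rewrite sqr_ge0. Qed.

Lemma sqr_coord_le_dot x i : x ord0 i ^+ 2 <= dot x x.
Proof. by rewrite dotxx (bigD1 i)//= lerDl sumr_ge0// => j _; rewrite sqr_ge0. Qed.

Lemma dotD_le x y : dot (x + y) (x + y) <= 2 * dot x x + 2 * dot y y.
Proof.
rewrite !dotxx !mulr_sumr -big_split; apply: ler_sum => i _ /=.
rewrite mxE -subr_ge0.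
have -> : 2 * x ord0 i ^+ 2 + 2 * y ord0 i ^+ 2 - (x ord0 i + y ord0 i) ^+ 2 =
  (x ord0 i - y ord0 i) ^+ 2 by ring.
exact: sqr_ge0.
Qed.

Lemma norm_dot_le x y : 2 * `|dot x y| <= dot x x + dot y y.
Proof.
have h (u v : 'rV[R]_n) : 2 * dot u v <= dot u u + dot v v.
  by have := dotxx_ge0 (u - v); rewrite dotBl !dotBr (dotC v u); lra.
have := h x y; have := h (- x) y; rewrite dotNl dotNl dotNr opprK.
by case: (ler0P (dot x y)); lra.
Qed.

Lemma measurable_dotr x : measurable_fun setT (dot x).
Proof.
apply: measurable_sum => i; apply: measurable_funM => //.
exact: measurable_coord.
Qed.

Lemma measurable_dot d (T : measurableType d) (f g : T -> 'rV[R]_n) :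
  measurable_fun setT f -> measurable_fun setT g ->
  measurable_fun setT (fun t => dot (f t) (g t)).
Proof.
move=> mf mg; apply: measurable_sum => i.
by apply: measurable_funM; apply: (measurableT_comp (measurable_coord i)).
Qed.

Lemma measurable_add d (T : measurableType d) (f g : T -> 'rV[R]_n) :
  measurable_fun setT f -> measurable_fun setT g ->
  measurable_fun setT (fun t => f t + g t).
Proof.
move=> mf mg; apply: measurable_fun_rVP => i; under eq_fun do rewrite mxE.
by apply: measurable_funD; apply: (measurableT_comp (measurable_coord i)).
Qed.

Lemma measurable_sub d (T : measurableType d) (f g : T -> 'rV[R]_n) :
  measurable_fun setT f -> measurable_fun setT g ->
  measurable_fun setT (fun t => f t - g t).
Proof.
move=> mf mg; apply: measurable_fun_rVP => i; under eq_fun do rewrite !mxE.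
by apply: measurable_funB; apply: (measurableT_comp (measurable_coord i)).
Qed.

(** The Japanese bracket squared. *)
Definition jb x := 1 + dot x x.

Lemma jb_ge1 x : 1 <= jb x. Proof. by rewrite lerDl dotxx_ge0. Qed.

Lemma jb_gt0 x : 0 < jb x. Proof. exact: lt_le_trans (jb_ge1 x). Qed.

(** Peetre's inequality: the weight [jb] changes at most by a factor of order
    [jb y] under a translation by [y]. *)
Lemma jb_peetre x y : jb (x + y) <= 2 * jb x * jb y.
Proof.
rewrite /jb; have := dotD_le x y; have := dotxx_ge0 x; have := dotxx_ge0 y.
move: (dot _ _) (dot x x) (dot y y) => a b c; nra.
Qed.

Lemma jb_peetre_sub x y : jb x <= 2 * jb (x + y) * jb y.
Proof.
have := jb_peetre (x + y) (- y); rewrite addrK.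
by rewrite {3}/jb dotNl dotNr opprK.
Qed.

Lemma norm_coord_le_jb x i : `|x ord0 i| <= jb x.
Proof.
rewrite /jb; have := sqr_coord_le_dot x i; have := sqr_ge0 (`|x ord0 i| - 1).
by rewrite sqrrB1 -[`|_| ^+ 2]real_normK ?num_real// normr_id real_normK ?num_real//; have := sqr_ge0 (x ord0 i); lra.
Qed.

Lemma measurable_jb : measurable_fun setT jb.
Proof. by apply: measurable_funD => //; exact: measurable_dot. Qed.

End dot.

Section basic_integrals.
Context {R : realType}.
Local Notation leb := (@lebesgue_measure R).

Lemma integral_gauss1 (b : R) : 0 < b ->
  (\int[leb]_t (expR (- (b * t ^+ 2 / 2)))%:E)%E = (Num.sqrt (2 * pi / b))%:E.
Proof.
move=> b0; have := @integral_normal_pdf R 0 (Num.sqrt b)^-1.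
have s0 : (Num.sqrt b)^-1 != 0 by rewrite invr_neq0// gt_eqF// sqrtr_gt0.
rewrite normal_pdfE//=; under eq_integral do rewrite EFinM.
have sE : (Num.sqrt b)^-1 ^+ 2 = b^-1 by rewrite exprVn sqr_sqrtr// ltW.
have nE t : normal_fun 0 (Num.sqrt b)^-1 t = expR (- (b * t ^+ 2 / 2)).
  congr expR; rewrite sE subr0 mulNr -mulr_natr invfM invrK; congr (- _).
  by rewrite mulrA [_ * b]mulrC.
rewrite ge0_integralZl//; last 3 first.
- by apply/measurable_EFinP; exact: measurable_normal_fun.
- by move=> t _; rewrite lee_fin normal_fun_ge0.
- by rewrite lee_fin normal_peak_ge0.
under eq_integral do rewrite nE.
rewrite /normal_peak sE (_ : b^-1 * pi *+ 2 = 2 * pi / b); last by rewrite -mulr_natl; ring.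
set r := Num.sqrt _; have r0 : 0 < r.
  by rewrite sqrtr_gt0 divr_gt0// mulr_gt0// pi_gt0.
move/(congr1 (fun z => r%:E * z)%E).
by rewrite muleA -EFinM divff ?lt0r_neq0// mul1e mule1.
Qed.

Lemma integral_inv_oneDsqr :
  (\int[leb]_t ((1 + t ^+ 2)^-1)%:E)%E = pi%:E.
Proof.
rewrite (@ge0_symfun_integralT R (fun t => (oneDsqr t)^-1)).
- rewrite (_ : [set x | _] = `[0%R, +oo[%classic); last by rewrite set_itvE.
  by rewrite integral0y_oneDsqr -EFinM mulrCA divff// mulr1.
- by move=> x; rewrite invr_ge0 (le_trans ler01)// oneDsqr_ge1.
- exact: continuous_oneDsqrV.
- by move=> x /=; rewrite /oneDsqr sqrrN.
Qed.

Context {n : nat}.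
Local Notation mu := (@lebesgue_rV R n).

Definition gauss (b : R) (x : 'rV[R]_n) : R := expR (- (b * dot x x / 2)).

Lemma gauss_gt0 b x : 0 < gauss b x. Proof. exact: expR_gt0. Qed.
Lemma gauss_ge0 b x : 0 <= gauss b x. Proof. exact: expR_ge0. Qed.

Lemma gaussE b x : gauss b x = \prod_i expR (- (b * x ord0 i ^+ 2 / 2)).
Proof.
rewrite /gauss dotxx mulr_sumr mulr_suml -sumrN expR_sum//.
Qed.

Lemma measurable_gauss b : measurable_fun setT (gauss b).
Proof.
apply: measurableT_comp => //; apply: measurableT_comp => //.
apply: measurable_funM => //; apply: measurable_funM => //.
exact: measurable_dot.
Qed.

Lemma integral_gauss b : 0 < b ->
  (\int[mu]_x (gauss b x)%:E)%E = (Num.sqrt (2 * pi / b) ^+ n)%:E.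
Proof.
move=> b0; under eq_integral do rewrite gaussE.
rewrite (@integral_prod_coord _ _ (fun _ t => expR (- (b * t ^+ 2 / 2)))
  (fun=> Num.sqrt (2 * pi / b)))//.
- by rewrite prodr_const card_ord.
- move=> _; do 2 apply: measurableT_comp => //.
  by do 2 apply: measurable_funM => //.
- by move=> _; exact: integral_gauss1.
Qed.

Lemma integrable_gauss b : 0 < b -> itg mu (gauss b).
Proof.
move=> b0; apply: (@ge0_integrable _ _ _ _ _ (Num.sqrt (2 * pi / b) ^+ n)).
- exact: measurable_gauss.
- by move=> x; exact: gauss_ge0.
- by rewrite integral_gauss.
Qed.

Lemma Rintegral_gauss b : 0 < b -> \int[mu]_x gauss b x = Num.sqrt (2 * pi / b) ^+ n.
Proof. by move=> b0; rewrite /Rintegral integral_gauss. Qed.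

(** The [n]-th power of [jb] dominates the product of the [1 + x_i ^ 2]. *)
Lemma integrable_jbXn : itg mu (fun x => (jb x ^+ n)^-1).
Proof.
apply: (@integrable_le _ _ _ _ _ (fun x : 'rV[R]_n => \prod_i (1 + x ord0 i ^+ 2)^-1)).
- rewrite (_ : (fun x => _) = (fun x : 'rV[R]_n => jb x `^ (- n%:R))); last first.
    by apply/funext => x; rewrite powRN powR_mulrn// ltW// jb_gt0.
  exact: (measurableT_comp (measurable_powR _) measurable_jb).
- move=> x; rewrite ger0_norm; last by rewrite invr_ge0 exprn_ge0// ltW// jb_gt0.
  rewrite prodfV lef_pV2 ?posrE; last 2 first.
  + by rewrite exprn_gt0// jb_gt0.
  + by rewrite prodr_gt0// => i _; rewrite ltr_pwDl// sqr_ge0.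
  rewrite -[X in _ <= _ ^+ X]card_ord -prodr_const.
  apply: ler_prod => i _; rewrite addr_ge0 ?sqr_ge0//= lerD2l.
  exact: sqr_coord_le_dot.
- have m1 : measurable_fun setT (fun t : R => (1 + t ^+ 2)^-1).
    by apply: continuous_measurable_fun; exact: continuous_oneDsqrV.
  have p0 (t : R) : 0 <= (1 + t ^+ 2)^-1 by rewrite invr_ge0 addr_ge0 ?sqr_ge0.
  apply: (@ge0_integrable _ _ _ _ _ (pi ^+ n)).
  + exact: (@measurable_prod_coord _ _ (fun _ t => (1 + t ^+ 2)^-1)).
  + by move=> x; rewrite prodr_ge0.
  + rewrite (@integral_prod_coord _ _ (fun _ t => (1 + t ^+ 2)^-1) (fun=> pi))//.
      by rewrite prodr_const card_ord.
    by move=> _; exact: integral_inv_oneDsqr.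
Qed.

Lemma integrable_shift (c : 'rV[R]_n) f : itg mu f ->
  itg mu (fun x => f (x + c)).
Proof.
move=> itf; have mf := integrable_measurable itf.
have mfc := measurableT_comp mf (@measurable_add_rV R n c).
apply/integrableP; split; first exact/measurable_EFinP.
have -> : (\int[mu]_x `|(f (x + c))%:E| = \int[mu]_x `|(f x)%:E|)%E.
  apply: (@ge0_integral_rV_shift _ _ c (fun x => `|(f x)%:E|%E)) => //.
  by apply: measurableT_comp => //; exact/measurable_EFinP.
by case/integrableP : itf.
Qed.

Lemma Rintegral_shift (c : 'rV[R]_n) f : itg mu f ->
  \int[mu]_x f (x + c) = \int[mu]_x f x.
Proof.
move=> itf; have mf := integrable_measurable itf.
congr fine; rewrite integralE [RHS]integralE; congr (_ - _)%E.
- have m : measurable_fun setT ((EFin \o f)^\+)%E.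
    by apply: measurable_funepos; exact/measurable_EFinP.
  rewrite -(ge0_integral_rV_shift c m); last by move=> x; exact: funepos_ge0.
  by apply: eq_integral => x _; rewrite !funeposE.
- have m : measurable_fun setT ((EFin \o f)^\-)%E.
    by apply: measurable_funeneg; exact/measurable_EFinP.
  rewrite -(ge0_integral_rV_shift c m); last by move=> x; exact: funeneg_ge0.
  by apply: eq_integral => x _; rewrite !funenegE.
Qed.

End basic_integrals.

(** * One-variable calculus *)

Section calculus.
Context {R : realType}.

Lemma is_derive1_continuous (f f' : R -> R) :
  (forall u : R, is_derive u (1 : R) f (f' u)) -> continuous f.
Proof.
move=> df u; apply/differentiable_continuous/derivable1_diffP.
exact: ex_derive.
Qed.

Lemma mean_value (f f' : R -> R) (t : R) : (forall u : R, is_derive u (1 : R) f (f' u)) ->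
  exists2 c, `|c| <= `|t| & f t - f 0 = t * f' c.
Proof.
move=> df; have cf := is_derive1_continuous df.
have [t0|t0|<-] := ltgtP 0 t.
- have [c] := MVT t0 (fun x _ => df x) (continuous_subspaceT cf).
  rewrite in_itv /= => /andP[c0 ct] E; exists c.
    by rewrite !gtr0_norm// ltW.
  by rewrite E subr0 mulrC.
- have [c] := MVT t0 (fun x _ => df x) (continuous_subspaceT cf).
  rewrite in_itv /= => /andP[c0 ct] E; exists c.
    by rewrite !ltr0_norm// lerN2 ltW.
  by rewrite -opprB E sub0r mulrN opprK mulrC.
- by exists 0 => //; rewrite subrr mul0r.
Qed.

Lemma taylor2 (f f' f'' : R -> R) (K t : R) :
  (forall u : R, is_derive u (1 : R) f (f' u)) -> (forall u : R, is_derive u (1 : R) f' (f'' u)) ->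
  (forall u, `|u| <= `|t| -> `|f'' u| <= K) ->
  `|f t - f 0 - t * f' 0| <= t ^+ 2 * K.
Proof.
move=> df df' f''K; have [c ct ->] := mean_value t df.
have [e ec E] := mean_value c df'.
rewrite -mulrBr E !normrM -real_normK ?num_real// expr2 -mulrA.
rewrite ler_wpM2l// ler_pM// f''K//; exact: le_trans ct.
Qed.

(** Identities between integrals are read off from expansions of second order
    in a small parameter [t]. *)
Lemma quad0 (a K : R) : (forall t, 0 < t <= 1 -> t * `|a| <= t ^+ 2 * K) -> a = 0.
Proof.
move=> h; apply/eqP; rewrite -normr_le0 leNgt; apply/negP => a0.
have K0 : 0 < K.
  by have := h 1; rewrite ltr01 lexx expr1n !mul1r => /(_ isT); exact: lt_le_trans.
pose t := Num.min 1 (`|a| / (2 * K)).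
have t0 : 0 < t by rewrite lt_min ltr01 divr_gt0// mulr_gt0.
have := h t; rewrite t0 ge_min lexx/= => /(_ isT).
rewrite expr2 -mulrA ler_pM2l// leNgt => /negP; apply.
rewrite (@le_lt_trans _ _ (`|a| / (2 * K) * K))//.
  by rewrite ler_wpM2r ?(ltW K0)// ge_min lexx orbT.
by rewrite invfM mulrA mulfVK ?gt_eqF// ltr_pdivrMr// ltr_pMr// ltr1n.
Qed.

(** A derivative is obtained from an explicit quadratic remainder, which can
    be integrated over a parameter; this replaces differentiation under the
    integral sign. *)
Lemma is_derive_quad (V : normedModType R) (h : V -> R) (x v : V) (D K : R) :
  (forall t, `|t| <= 1 -> `|h (x + t *: v) - h x - t * D| <= t ^+ 2 * K) ->
  is_derive x v h D.
Proof.
move=> hK; have K0 : 0 <= K.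
  by have := hK 1; rewrite normr1 lexx => /(_ isT) /(le_trans (normr_ge0 _)); rewrite expr1n mul1r.
have cv : (fun t => t^-1 *: ((h \o shift x) (t *: v) - h x)) @ 0^' --> D.
  apply/cvgrPdist_le => e e0; near=> t.
  have tn0 : t != 0 by near: t; exact: nbhs_dnbhs_neq.
  have t1 : `|t| <= 1.
    by near: t; apply: nbhs_dnbhs; apply/nbhs_ballP; exists 1 => //= y; rewrite /ball /= sub0r normrN => /ltW.
  have te : `|t| <= e / (K + 1).
    near: t; apply: nbhs_dnbhs; apply/nbhs_ballP; exists (e / (K + 1)) => /=.
      by rewrite divr_gt0// ltr_wpDl.
    by move=> y; rewrite /ball /= sub0r normrN => /ltW.
  rewrite distrC /= /shift /= (addrC _ x).
  have -> : t^-1 *: (h (x + t *: v) - h x) - D = t^-1 * (h (x + t *: v) - h x - t * D).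
    by rewrite [in RHS]mulrBr mulKf.
  rewrite normrM normfV ler_pdivrMl ?normr_gt0//.
  apply: le_trans (hK _ t1) _.
  rewrite -real_normK ?num_real// expr2 -mulrA ler_wpM2l//.
  apply: le_trans (ler_wpM2r K0 te) _.
  rewrite mulrAC ler_pdivrMr ?ltr_wpDl// mulrDr mulr1 lerDl ltW//.
split; first by apply/cvg_ex; exists D.
exact/cvg_lim.
Unshelve. all: by end_near. Qed.

Lemma is_derive_lineP (V : normedModType R) (h : V -> R) (x v : V) (t D : R) :
  is_derive (x + t *: v) v h D <-> is_derive t (1 : R) (fun u : R => h (x + u *: v)) D.
Proof.
have E : (fun u : R => u^-1 *: ((h \o shift (x + t *: v)) (u *: v) - h (x + t *: v))) =
  (fun u : R => u^-1 *: (((fun u : R => h (x + u *: v)) \o shift t) (u *: (1 : R)) - h (x + t *: v))).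
  apply/funext => u; congr (_ *: (_ - _)); rewrite /= /shift /=; congr h.
  by rewrite addrCA scalerDl [u *: 1]mulr1.
split=> -[ex val]; split.
- by move: ex; rewrite /derivable E.
- by move: val; rewrite /derive E.
- by move: ex; rewrite /derivable E.
- by move: val; rewrite /derive E.
Qed.

Lemma is_derive_affine (a h u : R) : is_derive u (1 : R) (fun u : R => a + u * h) h.
Proof.
have := @is_deriveD R R R (cst a) (fun u : R => u * h) u 1 0 h (is_derive_cst _ _ _).
rewrite add0r; apply.
have := @is_deriveM R R id (cst h) u 1 1 0 (is_derive_id _ _) (is_derive_cst _ _ _).
by rewrite scaler0 add0r [cst h u *: 1]mulr1.
Qed.

Lemma cos_quad (a h : R) : `|cos (a + h) - cos a + h * sin a| <= h ^+ 2.
Proof.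
have d1 (u : R) : is_derive u (1 : R) (fun u : R => cos (a + u * h)) (- sin (a + u * h) * h).
  exact: (@is_derive1_comp R cos (fun u => a + u * h) u _ _ (is_derive_cos _) (is_derive_affine _ _ _)).
have d2 (u : R) : is_derive u (1 : R) (fun u : R => - sin (a + u * h) * h) (- cos (a + u * h) * h * h).
  have ds := @is_derive1_comp R sin (fun u => a + u * h) u _ _ (is_derive_sin _) (is_derive_affine _ _ _).
  have := @is_deriveZ R R R _ (- h) u 1 _ ds.
  rewrite (_ : - h *: _ = - cos (a + u * h) * h * h); last by rewrite [LHS]mulrC mulrN !mulNr.
  by congr (is_derive _ _ _ _); apply/funext => w; rewrite /= [LHS]mulrC mulrN mulNr.
have := @taylor2 _ _ _ (h ^+ 2) 1 d1 d2.
rewrite mul0r addr0 !mul1r expr1n mul1r mulNr opprK (mulrC h); apply=> u _.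
by rewrite -mulrA mulNr normrN normrM -expr2 (ger0_norm (sqr_ge0 _)) ler_piMl ?sqr_ge0// cos_max.
Qed.

Lemma sin_quad (a h : R) : `|sin (a + h) - sin a - h * cos a| <= h ^+ 2.
Proof.
have := cos_quad (a - pi / 2) h; by rewrite (addrAC a) !cosBpihalf sinBpihalf mulrN.
Qed.

End calculus.

(** * Schwartz functions *)

Section schwartz_space.
Context {R : realType} {d : nat}.
Local Notation E := 'rV[R]_d.
Local Notation mu := (@lebesgue_rV R d).
Local Notation e_ i := (delta_mx (ord0 : 'I_1) (i : 'I_d) : E).

Lemma is_derive_partial (h h' : E -> R) i :
  (forall x : E, is_derive x (e_ i) h (h' x)) -> partial i h = h'.
Proof. by move=> dh; apply/funext => x; rewrite /partial derive_val. Qed.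

(** The iterated partial derivatives of a function stay in any class that is
    stable under partial derivatives, so the two defining properties need to
    be checked on the class only. *)
Lemma schwartz_class (A : (E -> R) -> Prop) :
  (forall h, A h -> [/\ continuous h, rapidly_decreasing h & forall i,
    exists2 h', A h' & forall x : E, is_derive x (e_ i) h (h' x)]) ->
  forall h, A h -> real_schwartz h.
Proof.
move=> HA h Ah.
have Al l : A (partials l h).
  elim: l => //= i l /HA[_ _ /(_ i)[h' Ah' dh]].
  by rewrite (is_derive_partial dh).
split=> l; last by have [_ ? _] := HA _ (Al l).
have [? _ dl] := HA _ (Al l); split=> // i x.
by have [h' _ /(_ x)[]] := dl i.
Qed.

Lemma continuous_addf (f g : E -> R) : continuous f -> continuous g ->
  continuous (fun x => f x + g x).
Proof. by move=> cf cg x; exact: cvgD (cf x) (cg x). Qed.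

Lemma continuous_mulf (f g : E -> R) : continuous f -> continuous g ->
  continuous (fun x => f x * g x).
Proof. by move=> cf cg x; exact: cvgM (cf x) (cg x). Qed.

Lemma rapid_decay (k : E -> R) m : rapidly_decreasing k ->
  exists2 C, 0 <= C & forall x, `|k x| <= C * (jb x ^+ m)^-1.
Proof.
move=> /(_ m)[C hC]; exists `|C| => // x.
rewrite ler_pdivlMr ?exprn_gt0 ?jb_gt0// mulrC.
exact: le_trans (hC x) (ler_norm _).
Qed.

Lemma rapid_integrable (k : E -> R) : measurable_fun setT k ->
  rapidly_decreasing k -> itg mu k.
Proof.
move=> mk /(rapid_decay d)[C _ hC]; apply: (integrable_le mk hC).
exact: integrableEZl (@integrable_jbXn R d).
Qed.

Section closure.
Variables (k : E -> R) (sk : real_schwartz k).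

Lemma schwartz_continuous : continuous k. Proof. exact: (sk.1 [::]).1. Qed.

Lemma schwartz_rapid : rapidly_decreasing k. Proof. exact: sk.2 [::]. Qed.

Lemma schwartz_is_derive i (x : E) : is_derive x (e_ i) k (partial i k x).
Proof. exact/derivableP/(sk.1 [::]).2. Qed.

Lemma schwartz_partial i : real_schwartz (partial i k).
Proof.
split=> l; have -> : partials l (partial i k) = partials (rcons l i) k.
- by rewrite /partials foldr_rcons.
- exact: sk.1.
- by rewrite /partials foldr_rcons.
- exact: sk.2.
Qed.

Lemma schwartz_measurable : measurable_fun setT k.
Proof. apply: continuous_measurable_rV; exact: schwartz_continuous. Qed.

Lemma schwartz_decay m : exists2 C, 0 <= C & forall x, `|k x| <= C * (jb x ^+ m)^-1.
Proof. exact: rapid_decay schwartz_rapid. Qed.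

Lemma schwartz_integrable : itg mu k.
Proof. exact: rapid_integrable schwartz_measurable schwartz_rapid. Qed.

Lemma schwartz_bounded : exists2 C, 0 <= C & forall x, `|k x| <= C.
Proof.
by have [C C0 hC] := schwartz_decay 0; exists C => // x; rewrite (le_trans (hC x))// expr0 invr1 mulr1.
Qed.

End closure.

Lemma rapidD (f g : E -> R) : rapidly_decreasing f -> rapidly_decreasing g ->
  rapidly_decreasing (fun x => f x + g x).
Proof.
move=> rf rg m; have [C hC] := rf m; have [D hD] := rg m; exists (C + D) => x.
apply: le_trans (lerD (hC x) (hD x)).
by rewrite -mulrDr ler_wpM2l ?ler_normD// exprn_ge0// ltW// jb_gt0.
Qed.

Lemma rapidZ c (f : E -> R) : rapidly_decreasing f ->
  rapidly_decreasing (fun x => c * f x).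
Proof.
move=> rf m; have [C hC] := rf m; exists (`|c| * C) => x.
by rewrite normrM mulrCA ler_wpM2l.
Qed.

Lemma rapid_coord i (f : E -> R) : rapidly_decreasing f ->
  rapidly_decreasing (fun x => x ord0 i * f x).
Proof.
move=> rf m; have [C hC] := rf m.+1; exists C => x.
apply: le_trans (hC x); rewrite normrM mulrA ler_wpM2r//.
by rewrite exprSr ler_wpM2l ?exprn_ge0 ?norm_coord_le_jb// ltW// jb_gt0.
Qed.

Lemma schwartzD (f g : E -> R) : real_schwartz f -> real_schwartz g ->
  real_schwartz (fun x => f x + g x).
Proof.
move=> sf sg.
pose A h := exists f g, [/\ real_schwartz f, real_schwartz g & h = fun x : E => f x + g x].
apply: (@schwartz_class A); last by exists f, g.
move=> _ [{sf sg}f [{}g [sf sg ->]]]; split.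
- by apply: continuous_addf; apply: schwartz_continuous.
- by apply: rapidD; exact: schwartz_rapid.
move=> i; exists (fun x => partial i f x + partial i g x).
  by exists (partial i f), (partial i g); split=> //; exact: schwartz_partial.
by move=> x; apply: is_deriveD; exact: schwartz_is_derive.
Qed.

Lemma schwartzZ c (f : E -> R) : real_schwartz f ->
  real_schwartz (fun x => c * f x).
Proof.
move=> sf.
pose A h := exists2 f, real_schwartz f & h = fun x : E => c * f x.
apply: (@schwartz_class A); last by exists f.
move=> _ [{sf}f sf ->]; split.
- apply: continuous_mulf; last exact: schwartz_continuous.
  exact: cst_continuous.
- by apply: rapidZ; exact: schwartz_rapid.
move=> i; exists (fun x => c * partial i f x).
  by exists (partial i f) => //; exact: schwartz_partial.
by move=> x; exact: (@is_deriveZ _ _ _ _ c _ _ _ (schwartz_is_derive sf i x)).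
Qed.

Lemma is_derive_coord (i j : 'I_d) (x : E) :
  is_derive x (e_ i) (fun x : E => x ord0 j) (i == j)%:R.
Proof.
apply: (@is_derive_quad _ _ _ _ _ _ 0) => t _.
by rewrite !mxE eqxx andTb (eq_sym j i) [_ + _ - x ord0 j]addrAC subrr add0r subrr normr0 mulr0.
Qed.

Lemma schwartz_coord i (f : E -> R) : real_schwartz f ->
  real_schwartz (fun x => x ord0 i * f x).
Proof.
move=> sf.
pose A h := exists f g, [/\ real_schwartz f, real_schwartz g & h = fun x : E => x ord0 i * f x + g x].
have s0 : real_schwartz (fun x => 0 * f x) by exact: schwartzZ.
apply: (@schwartz_class A); last first.
  exists f, (fun x => 0 * f x); split=> //; apply/funext => x.
  by rewrite mul0r addr0.
move=> _ [{s0 sf}f [g [sf sg ->]]]; split.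
- apply: continuous_addf; last exact: schwartz_continuous.
  by apply: continuous_mulf; [exact: coord_continuous|exact: schwartz_continuous].
- by apply: rapidD; [apply: rapid_coord|]; exact: schwartz_rapid.
move=> j; exists (fun x : E => x ord0 i * partial j f x + ((j == i)%:R * f x + partial j g x)).
  exists (partial j f), (fun x => ((j == i)%:R * f x + partial j g x)).
  split=> //; first exact: schwartz_partial.
  by apply: schwartzD; [exact: schwartzZ|exact: schwartz_partial].
move=> x; rewrite addrA; apply: is_deriveD; last exact: schwartz_is_derive.
apply: is_derive_eq.
  exact: (is_deriveM (is_derive_coord j i x) (schwartz_is_derive sf j x)).
by congr (_ + _); exact: mulrC.
Qed.

Lemma schwartz_dot v (f : E -> R) : real_schwartz f ->
  real_schwartz (fun x => dot v x * f x).
Proof.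
move=> sf; rewrite /dot; under eq_fun do rewrite mulr_suml.
elim: (index_enum _) => [|i s IHs].
  rewrite (_ : (fun x => _) = (fun x => 0 * f x)); first exact: schwartzZ.
  by apply/funext => x; rewrite big_nil mul0r.
under eq_fun do rewrite big_cons -mulrA; apply: schwartzD => //.
by apply: schwartzZ; exact: schwartz_coord.
Qed.

(** The remainder is controlled by the second derivative at a point within
    distance one of [x], where its decay is comparable with the decay at [x]. *)
Lemma schwartz_quad (k : E -> R) i : real_schwartz k ->
  exists2 B : E -> R, itg mu B & forall x t, `|t| <= 1 ->
   `|k (x + t *: e_ i) - k x - t * partial i k x| <= t ^+ 2 * B x.
Proof.
move=> sk.
have [C C0 hC] := schwartz_decay (schwartz_partial (schwartz_partial sk i) i) d.
exists (fun x => (C * 4 ^+ d) * (jb x ^+ d)^-1).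
  exact: integrableEZl (@integrable_jbXn R d).
move=> x t t1.
have d1 (u : R) : is_derive u (1 : R) (fun u : R => k (x + u *: e_ i)) (partial i k (x + u *: e_ i)).
  apply/(@is_derive_lineP R _ k x (e_ i)); exact: schwartz_is_derive.
have d2 (u : R) : is_derive u (1 : R) (fun u : R => partial i k (x + u *: e_ i))
    (partial i (partial i k) (x + u *: e_ i)).
  apply/(@is_derive_lineP R _ (partial i k) x (e_ i)).
  by apply: schwartz_is_derive; exact: schwartz_partial.
have := @taylor2 _ _ _ _ (C * 4 ^+ d * (jb x ^+ d)^-1) t d1 d2.
rewrite scale0r addr0; apply => u ut; apply: le_trans (hC _) _.
rewrite -mulrA ler_wpM2l// ler_pdivlMr ?exprn_gt0 ?jb_gt0//.
rewrite mulrC ler_pdivrMr ?exprn_gt0 ?jb_gt0// -exprMn lerXn2r ?nnegrE ?mulr_ge0 ?(ltW (jb_gt0 _))//.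
apply: le_trans (jb_peetre_sub x (u *: e_ i)) _.
rewrite mulrAC ler_wpM2r ?(ltW (jb_gt0 _))//.
have : jb (u *: e_ i) <= 2.
  rewrite /jb dotZl dotZr dot_deltal mxE !eqxx mulr1 -expr2.
  by have := le_trans ut t1; rewrite -[u ^+ 2]real_normK ?num_real//; have := normr_ge0 u; nra.
by lra.
Qed.

End schwartz_space.

(** * Cosine and sine transforms *)

Section Rintegral_linear.
Context d (T : measurableType d) (R : realType) (mu : {measure set T -> \bar R}).
Implicit Types f g : T -> R.

Lemma RintegralDT f g : itg mu f -> itg mu g ->
  \int[mu]_x (f x + g x) = \int[mu]_x f x + \int[mu]_x g x.
Proof. exact: RintegralD. Qed.

Lemma RintegralBT f g : itg mu f -> itg mu g ->
  \int[mu]_x (f x - g x) = \int[mu]_x f x - \int[mu]_x g x.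
Proof. exact: RintegralB. Qed.

Lemma RintegralZT c f : itg mu f -> \int[mu]_x (c * f x) = c * \int[mu]_x f x.
Proof. exact: RintegralZl. Qed.

End Rintegral_linear.

Section fourier_transform.
Context {R : realType} {d : nat}.
Local Notation E := 'rV[R]_d.
Local Notation mu := (@lebesgue_rV R d).
Local Notation e_ i := (delta_mx (ord0 : 'I_1) (i : 'I_d) : E).

Definition cosT (k : E -> R) (x : E) : R := \int[mu]_z (cos (dot x z) * k z).
Definition sinT (k : E -> R) (x : E) : R := \int[mu]_z (sin (dot x z) * k z).

Lemma measurable_cos : measurable_fun setT (@cos R).
Proof. exact: continuous_measurable_fun (@continuous_cos R). Qed.

Lemma measurable_sin : measurable_fun setT (@sin R).
Proof. exact: continuous_measurable_fun (@continuous_sin R). Qed.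

Lemma integrable_cos_mul (k : E -> R) x : itg mu k ->
  itg mu (fun z => cos (dot x z) * k z).
Proof.
apply: (@integrable_bounded_mul _ _ _ _ _ _ 1).
- exact: (measurableT_comp measurable_cos (measurable_dotr x)).
- by move=> z; exact: cos_max.
Qed.

Lemma integrable_sin_mul (k : E -> R) x : itg mu k ->
  itg mu (fun z => sin (dot x z) * k z).
Proof.
apply: (@integrable_bounded_mul _ _ _ _ _ _ 1).
- exact: (measurableT_comp measurable_sin (measurable_dotr x)).
- by move=> z; exact: sin_max.
Qed.

Lemma norm_cosT (k : E -> R) x : itg mu k -> `|cosT k x| <= \int[mu]_z `|k z|.
Proof.
move=> ik; apply: Rintegral_norm_le.
- exact: integrable_cos_mul.
- exact: integrable_norm ik.
- by move=> z; rewrite normrM ler_piMl ?cos_max.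
Qed.

Lemma norm_sinT (k : E -> R) x : itg mu k -> `|sinT k x| <= \int[mu]_z `|k z|.
Proof.
move=> ik; apply: Rintegral_norm_le.
- exact: integrable_sin_mul.
- exact: integrable_norm ik.
- by move=> z; rewrite normrM ler_piMl ?sin_max.
Qed.

Lemma cosTD (f g : E -> R) x : itg mu f -> itg mu g ->
  cosT (fun z => f z + g z) x = cosT f x + cosT g x.
Proof.
move=> itf ig; rewrite /cosT -RintegralDT; try exact: integrable_cos_mul.
by apply: eq_Rintegral => z _; rewrite mulrDr.
Qed.

Lemma sinTD (f g : E -> R) x : itg mu f -> itg mu g ->
  sinT (fun z => f z + g z) x = sinT f x + sinT g x.
Proof.
move=> itf ig; rewrite /sinT -RintegralDT; try exact: integrable_sin_mul.
by apply: eq_Rintegral => z _; rewrite mulrDr.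
Qed.

Lemma cosTZ c (f : E -> R) x : itg mu f ->
  cosT (fun z => c * f z) x = c * cosT f x.
Proof.
move=> itf; rewrite /cosT -RintegralZT; last exact: integrable_cos_mul.
by apply: eq_Rintegral => z _; rewrite mulrCA.
Qed.

Lemma sinTZ c (f : E -> R) x : itg mu f ->
  sinT (fun z => c * f z) x = c * sinT f x.
Proof.
move=> itf; rewrite /sinT -RintegralZT; last exact: integrable_sin_mul.
by apply: eq_Rintegral => z _; rewrite mulrCA.
Qed.

Lemma cosT0 (k : E -> R) : cosT k 0 = \int[mu]_z k z.
Proof. by apply: eq_Rintegral => z _; rewrite dot0l cos0 mul1r. Qed.

Lemma sinT0 (k : E -> R) : sinT k 0 = 0.
Proof.
rewrite /sinT (@eq_Rintegral _ _ _ mu setT (fun=> 0)); first by rewrite /Rintegral integral0.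
by move=> z _; rewrite dot0l sin0 mul0r.
Qed.

Section transform_of_schwartz.
Variables (k : E -> R) (sk : real_schwartz k).
Let ik : itg mu k := schwartz_integrable sk.
Let ivk v : itg mu (fun z => dot v z * k z) := schwartz_integrable (schwartz_dot v sk).

Let ivvk v : itg mu (fun z => dot v z ^+ 2 * `|k z|).
Proof.
have := schwartz_integrable (schwartz_dot v (schwartz_dot v sk)).
move=> /(@integrable_norm _ _ _ mu setT); congr (itg mu _); apply/funext => z /=.
by rewrite mulrA normrM -expr2 ger0_norm// sqr_ge0.
Qed.

(** The quadratic remainder of the cosine, integrated against [k], is bounded
    by the second moment of [k]. *)
Lemma is_derive_cosT (x v : E) :
  is_derive x v (cosT k) (- sinT (fun z => dot v z * k z) x).
Proof.
apply: (@is_derive_quad _ _ _ _ _ _ (\int[mu]_z (dot v z ^+ 2 * `|k z|))) => t _.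
rewrite mulrN opprK -sinTZ// -[t ^+ 2 * _]RintegralZT// /cosT /sinT -RintegralBT; try exact: integrable_cos_mul.
rewrite -RintegralDT; last 2 first.
- by apply: integrableEB; exact: integrable_cos_mul.
- by apply: integrable_sin_mul; exact: integrableEZl.
apply: Rintegral_norm_le.
- apply: integrableED; last by apply: integrable_sin_mul; exact: integrableEZl.
  by apply: integrableEB; exact: integrable_cos_mul.
- exact: integrableEZl.
- move=> z; rewrite dotDl dotZl; set a := dot x z; set b := dot v z.
  rewrite (_ : _ + _ = (cos (a + t * b) - cos a + t * b * sin a) * k z); last by ring.
  by rewrite normrM mulrA -exprMn ler_wpM2r// cos_quad.
Qed.

Lemma is_derive_sinT (x v : E) :
  is_derive x v (sinT k) (cosT (fun z => dot v z * k z) x).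
Proof.
apply: (@is_derive_quad _ _ _ _ _ _ (\int[mu]_z (dot v z ^+ 2 * `|k z|))) => t _.
rewrite -cosTZ// -[t ^+ 2 * _]RintegralZT// /cosT /sinT -RintegralBT; try exact: integrable_sin_mul.
rewrite -RintegralBT; last 2 first.
- by apply: integrableEB; exact: integrable_sin_mul.
- by apply: integrable_cos_mul; exact: integrableEZl.
apply: Rintegral_norm_le.
- apply: integrableEB; last by apply: integrable_cos_mul; exact: integrableEZl.
  by apply: integrableEB; exact: integrable_sin_mul.
- exact: integrableEZl.
- move=> z; rewrite dotDl dotZl; set a := dot x z; set b := dot v z.
  rewrite (_ : _ - _ = (sin (a + t * b) - sin a - t * b * cos a) * k z); last by ring.
  by rewrite normrM mulrA -exprMn ler_wpM2r// sin_quad.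
Qed.

(** Integration by parts, read off from the translation invariance of the
    measure: both sides of [int (k (z + t e) - k z) phi z = int k z (phi (z - t e) - phi z)]
    are expanded to second order in [t]. *)
Lemma transform_partial (i : 'I_d) (phi dphi : R -> R) (x : E) :
  measurable_fun setT phi -> measurable_fun setT dphi ->
  (forall a, `|phi a| <= 1) -> (forall a, `|dphi a| <= 1) ->
  (forall a h, `|phi (a + h) - phi a - h * dphi a| <= h ^+ 2) ->
  \int[mu]_z (phi (dot x z) * partial i k z) =
  - (x ord0 i * \int[mu]_z (dphi (dot x z) * k z)).
Proof.
move=> mphi mdphi phi1 dphi1 quad.
have ip g : itg mu g -> itg mu (fun z => phi (dot x z) * g z).
  apply: (@integrable_bounded_mul _ _ _ _ _ _ 1) => //.
  exact: measurableT_comp mphi (measurable_dotr x).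
have idp g : itg mu g -> itg mu (fun z => dphi (dot x z) * g z).
  apply: (@integrable_bounded_mul _ _ _ _ _ _ 1) => //.
  exact: measurableT_comp mdphi (measurable_dotr x).
have ipk := schwartz_integrable (schwartz_partial sk i).
have [B iB hB] := schwartz_quad i sk.
apply/eqP; rewrite -subr_eq0 opprK; apply/eqP.
apply: (@quad0 _ _ (\int[mu]_z B z + x ord0 i ^+ 2 * \int[mu]_z `|k z|)) => t /andP[t0 t1].
have t1' : `|t| <= 1 by rewrite gtr0_norm.
have ikt : itg mu (fun z => k (z + t *: e_ i)) := integrable_shift (t *: e_ i) ik.
have shiftE : \int[mu]_z (phi (dot x z) * k (z + t *: e_ i)) =
    \int[mu]_z (phi (dot x z - t * x ord0 i) * k z).
  rewrite -[RHS](Rintegral_shift (t *: e_ i)).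
    apply: eq_Rintegral => z _; congr (phi _ * _).
    by rewrite dotDr dotZr (dotC x (e_ i)) dot_deltal addrK.
  apply: (@integrable_bounded_mul _ _ _ _ _ _ 1) => //.
  apply: measurableT_comp mphi _; apply: measurable_funB => //.
  exact: measurable_dotr.
have ipt : itg mu (fun z => phi (dot x z - t * x ord0 i) * k z).
  apply: (@integrable_bounded_mul _ _ _ _ _ _ 1) => //.
  apply: measurableT_comp mphi _; apply: measurable_funB => //.
  exact: measurable_dotr.
have r1 : `|\int[mu]_z (phi (dot x z) * (k (z + t *: e_ i) - k z - t * partial i k z))|
    <= t ^+ 2 * \int[mu]_z B z.
  rewrite -RintegralZT//; apply: Rintegral_norm_le.
  - apply: ip; apply: integrableEB; last exact: integrableEZl.
    exact: integrableEB.
  - exact: integrableEZl.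
  - move=> z; rewrite normrM; apply: le_trans (hB z t t1').
    by rewrite ler_piMl.
have r2 : `|\int[mu]_z ((phi (dot x z - t * x ord0 i) - phi (dot x z) + t * x ord0 i * dphi (dot x z)) * k z)|
    <= t ^+ 2 * (x ord0 i ^+ 2 * \int[mu]_z `|k z|).
  rewrite mulrA -exprMn -RintegralZT; last exact: integrable_norm ik.
  apply: Rintegral_norm_le.
  - rewrite (_ : (fun z => _) = (fun z => phi (dot x z - t * x ord0 i) * k z - phi (dot x z) * k z
      + t * x ord0 i * (dphi (dot x z) * k z))); last by apply/funext => z; ring.
    apply: integrableED; last by apply: integrableEZl; exact: idp.
    by apply: integrableEB => //; exact: ip.
  - by apply: integrableEZl; exact: integrable_norm ik.
  - move=> z; rewrite normrM ler_wpM2r//.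
    by have := quad (dot x z) (- (t * x ord0 i)); rewrite sqrrN mulNr opprK.
have E1 : \int[mu]_z (phi (dot x z) * (k (z + t *: e_ i) - k z - t * partial i k z)) =
    \int[mu]_z (phi (dot x z - t * x ord0 i) * k z) - \int[mu]_z (phi (dot x z) * k z)
    - t * \int[mu]_z (phi (dot x z) * partial i k z).
  rewrite -shiftE -RintegralZT; last exact: ip.
  rewrite -RintegralBT; [|exact: ip..].
  rewrite -RintegralBT; last 2 first.
  - by apply: integrableEB; exact: ip.
  - by apply: integrableEZl; exact: ip.
  by apply: eq_Rintegral => z _; ring.
have E2 : \int[mu]_z ((phi (dot x z - t * x ord0 i) - phi (dot x z) + t * x ord0 i * dphi (dot x z)) * k z)
   = \int[mu]_z (phi (dot x z - t * x ord0 i) * k z) - \int[mu]_z (phi (dot x z) * k z)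
    + t * (x ord0 i * \int[mu]_z (dphi (dot x z) * k z)).
  rewrite mulrA -RintegralZT; last exact: idp.
  rewrite -RintegralBT//; last exact: ip.
  rewrite -RintegralDT; last 2 first.
  - by apply: integrableEB => //; exact: ip.
  - by apply: integrableEZl; exact: idp.
  by apply: eq_Rintegral => z _; ring.
move: r1 r2; rewrite E1 E2; set D := (_ - _ as X in X + _); move=> r1 r2.
rewrite -{1}(gtr0_norm t0) -normrM mulrDr [leRHS]mulrDr addrC.
rewrite (_ : t * _ + t * _ = D + t * (x ord0 i * \int[mu]_z (dphi (dot x z) * k z)) -
  (D - t * \int[mu]_z (phi (dot x z) * partial i k z))); last by ring.
by rewrite [leRHS]addrC (le_trans (ler_normB _ _))// lerD.
Qed.

End transform_of_schwartz.
End fourier_transform.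

(** * Transforms of Schwartz functions *)

Section transform_schwartz.
Context {R : realType} {d : nat}.
Local Notation E := 'rV[R]_d.
Local Notation mu := (@lebesgue_rV R d).
Local Notation e_ i := (delta_mx (ord0 : 'I_1) (i : 'I_d) : E).
Implicit Types k : E -> R.

Lemma cosT_partial k i x : real_schwartz k ->
  cosT (partial i k) x = x ord0 i * sinT k x.
Proof.
move=> sk; rewrite /cosT (@transform_partial _ _ _ sk i (@cos R) (fun a => - sin a)).
- rewrite /sinT -mulrN; congr (_ * _); rewrite -mulN1r -RintegralZT.
    by apply: eq_Rintegral => z _; rewrite mulN1r mulNr opprK.
  rewrite (_ : (fun z => _) = (fun z : E => -1 * (sin (dot x z) * k z))).
    by apply: integrableEZl; exact: integrable_sin_mul (schwartz_integrable sk).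
  by apply/funext => z; rewrite mulN1r mulNr.
- exact: measurable_cos.
- by apply: measurableT_comp => //; exact: measurable_sin.
- exact: cos_max.
- by move=> a; rewrite normrN sin_max.
- by move=> a h; rewrite mulrN opprK cos_quad.
Qed.

Lemma sinT_partial k i x : real_schwartz k ->
  sinT (partial i k) x = - (x ord0 i * cosT k x).
Proof.
move=> sk; rewrite /sinT (@transform_partial _ _ _ sk i (@sin R) (@cos R))//.
- exact: measurable_sin.
- exact: measurable_cos.
- exact: sin_max.
- exact: cos_max.
- exact: sin_quad.
Qed.

Lemma cosT_partial2 k i (x : E) : real_schwartz k ->
  x ord0 i ^+ 2 * cosT k x = - cosT (partial i (partial i k)) x.
Proof.
move=> sk; rewrite cosT_partial; last exact: schwartz_partial.
by rewrite sinT_partial// mulrN opprK mulrA expr2.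
Qed.

Lemma sinT_partial2 k i (x : E) : real_schwartz k ->
  x ord0 i ^+ 2 * sinT k x = - sinT (partial i (partial i k)) x.
Proof.
move=> sk; rewrite sinT_partial; last exact: schwartz_partial.
by rewrite cosT_partial// opprK mulrA expr2.
Qed.

(** Multiplying the transform by [jb] amounts to transforming [k] minus its
    Laplacian, so the boundedness of all transforms implies their rapid
    decrease. *)
Lemma jb_mul_bound (T : (E -> R) -> E -> R) :
  (forall k, real_schwartz k -> exists C, forall x, `|T k x| <= C) ->
  (forall k i (x : E), real_schwartz k ->
    x ord0 i ^+ 2 * T k x = - T (partial i (partial i k)) x) ->
  forall k, real_schwartz k -> rapidly_decreasing (T k).
Proof.
move=> T0 T2 k sk m; elim: m k sk => [|m IHm] k sk.
  by have [C hC] := T0 k sk; exists C => x; rewrite expr0 mul1r.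
have [C hC] := IHm k sk.
have /choice[D hD] i := IHm _ (schwartz_partial (schwartz_partial sk i) i).
exists (C + \sum_i D i) => x.
have JT : jb x * T k x = T k x - \sum_i T (partial i (partial i k)) x.
  rewrite mulrDl mul1r dotxx mulr_suml -sumrN; congr (_ + _).
  by apply: eq_bigr => i _; rewrite T2.
rewrite -/(jb x) exprSr -mulrA -{2}(ger0_norm (ltW (jb_gt0 x))) -normrM JT.
apply: (@le_trans _ _ (jb x ^+ m * (`|T k x| + \sum_i `|T (partial i (partial i k)) x|))).
  rewrite ler_wpM2l ?exprn_ge0 ?(ltW (jb_gt0 x))//.
  by apply: le_trans (ler_normB _ _) _; rewrite lerD2l ler_norm_sum.
rewrite mulrDr mulr_sumr; apply: lerD; first exact: hC.
by apply: ler_sum => i _; exact: hD.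
Qed.

Lemma cosT_rapid k : real_schwartz k -> rapidly_decreasing (cosT k).
Proof.
apply: jb_mul_bound => [{}k sk|{}k i x sk]; last exact: cosT_partial2.
exists (\int[mu]_z `|k z|) => x; exact: norm_cosT (schwartz_integrable sk).
Qed.

Lemma sinT_rapid k : real_schwartz k -> rapidly_decreasing (sinT k).
Proof.
apply: jb_mul_bound => [{}k sk|{}k i x sk]; last exact: sinT_partial2.
exists (\int[mu]_z `|k z|) => x; exact: norm_sinT (schwartz_integrable sk).
Qed.

Lemma continuous_coord_lipschitz (h : E -> R) (L : 'I_d -> R) :
  (forall x y, `|h y - h x| <= \sum_i `|y ord0 i - x ord0 i| * L i) ->
  continuous h.
Proof.
move=> hL x; apply/(@cvgrPdist_lt _ _ _ (nbhs x) (nbhs_filter x)) => e e0.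
pose K := \sum_i `|L i|.
have K0 : 0 <= K by rewrite sumr_ge0.
apply/nbhs_ballP; exists (e / (K + 1)) => /=; first by rewrite divr_gt0// ltr_wpDl.
move=> y [_ xy]; rewrite distrC; apply: le_lt_trans (hL x y) _.
apply: (@le_lt_trans _ _ (e / (K + 1) * K)).
  rewrite mulr_sumr; apply: ler_sum => i _.
  apply: le_trans (ler_wpM2l (normr_ge0 _) (ler_norm _)) _.
  by rewrite ler_wpM2r// distrC ltW//; exact: xy.
by rewrite mulrAC ltr_pdivrMr ?ltr_wpDl// mulrDr mulr1 ltrDl.
Qed.

Lemma line_bound (h : E -> R) (D : E -> E -> R) (x y : E) (C : R) :
  (forall x v : E, is_derive x v h (D v x)) ->
  (forall z, `|D (y - x) z| <= C) -> `|h y - h x| <= C.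
Proof.
move=> dh DC.
have dl (u : R) : is_derive u (1 : R) (fun u : R => h (x + u *: (y - x))) (D (y - x) (x + u *: (y - x))).
  by apply/(@is_derive_lineP R _ h x (y - x)); exact: dh.
have [c _] := mean_value 1 dl; rewrite scale1r scale0r addr0 (addrC x) subrK => ->.
by rewrite mul1r.
Qed.

Lemma int_dot_le k v : real_schwartz k ->
  \int[mu]_z `|dot v z * k z| <= \sum_i `|v ord0 i| * \int[mu]_z `|z ord0 i * k z|.
Proof.
move=> sk; pose I i := itg mu (fun z : E => `|v ord0 i| * `|z ord0 i * k z|).
have iI i : I i.
  apply: integrableEZl; exact: integrable_norm (schwartz_integrable (schwartz_coord i sk)).
apply: (@le_trans _ _ (\int[mu]_z \sum_i (`|v ord0 i| * `|z ord0 i * k z|))).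
  apply: le_Rintegral => //.
  - exact: integrable_norm (schwartz_integrable (schwartz_dot v sk)).
  - rewrite (_ : _ \o _ = (fun z : E => \sum_i (`|v ord0 i| * `|z ord0 i * k z|)%:E)%E).
      by apply: integrable_sum => // i _; exact: iI.
    by apply/funext => z /=; rewrite sumEFin.
  - move=> z _; rewrite /dot mulr_suml; apply: le_trans (ler_norm_sum _ _ _) _.
    by apply: ler_sum => i _; rewrite -mulrA normrM.
rewrite /Rintegral; under eq_integral do rewrite -sumEFin.
rewrite integral_sum//.
rewrite (eq_bigr (fun i => (`|v ord0 i| * \int[mu]_z `|z ord0 i * k z|)%:E)) ?sumEFin//.
move=> i _; rewrite -RintegralZT; first by rewrite -integral_fineE//; exact: iI.
exact: integrable_norm (schwartz_integrable (schwartz_coord i sk)).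
Qed.

Lemma cosT_continuous k : real_schwartz k -> continuous (cosT k).
Proof.
move=> sk; apply: (@continuous_coord_lipschitz _ (fun i => \int[mu]_(z in setT) `|(z : E) ord0 i * k z|)) => x y.
rewrite (eq_bigr (fun i => `|(y - x) ord0 i| * \int[mu]_(z in setT) `|(z : E) ord0 i * k z|)); last by move=> i _; rewrite !mxE.
apply: (line_bound (is_derive_cosT sk)) => z; rewrite normrN.
apply: le_trans _ (int_dot_le _ sk); apply: norm_sinT.
exact: schwartz_integrable (schwartz_dot _ sk).
Qed.

Lemma sinT_continuous k : real_schwartz k -> continuous (sinT k).
Proof.
move=> sk; apply: (@continuous_coord_lipschitz _ (fun i => \int[mu]_(z in setT) `|(z : E) ord0 i * k z|)) => x y.
rewrite (eq_bigr (fun i => `|(y - x) ord0 i| * \int[mu]_(z in setT) `|(z : E) ord0 i * k z|)); last by move=> i _; rewrite !mxE.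
apply: (line_bound (is_derive_sinT sk)) => z.
apply: le_trans _ (int_dot_le _ sk); apply: norm_cosT.
exact: schwartz_integrable (schwartz_dot _ sk).
Qed.

(** Differentiating a transform multiplies [k] by a coordinate, so the
    transforms of Schwartz functions are stable under partial derivatives. *)
Lemma transform_schwartz (h : E -> R) :
  (exists2 k : E -> R, real_schwartz k & h = cosT k \/ h = sinT k) -> real_schwartz h.
Proof.
apply: (@schwartz_class R d (fun h => exists2 k : E -> R, real_schwartz k & h = cosT k \/ h = sinT k)).
move=> {}h [k sk [->|->]]; split.
- exact: cosT_continuous.
- exact: cosT_rapid.
- move=> i; have s1 := schwartz_coord i sk.
  exists (sinT (fun z : E => -1 * (z ord0 i * k z))).
    by exists (fun z : E => -1 * (z ord0 i * k z)); [exact: schwartzZ|right].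
  move=> x; rewrite sinTZ; last exact: schwartz_integrable s1.
  have := is_derive_cosT sk x (e_ i); rewrite mulN1r; congr (is_derive _ _ _ (- sinT _ _)).
  by apply/funext => z; rewrite dot_deltal.
- exact: sinT_continuous.
- exact: sinT_rapid.
- move=> i; exists (cosT (fun z : E => z ord0 i * k z)).
    by exists (fun z : E => z ord0 i * k z); [exact: schwartz_coord|left].
  move=> x; have := is_derive_sinT sk x (e_ i); congr (is_derive _ _ _ (cosT _ _)).
  by apply/funext => z; rewrite dot_deltal.
Qed.

Lemma cosT_schwartz k : real_schwartz k -> real_schwartz (cosT k).
Proof. by move=> sk; apply: transform_schwartz; exists k => //; left. Qed.

Lemma sinT_schwartz k : real_schwartz k -> real_schwartz (sinT k).
Proof. by move=> sk; apply: transform_schwartz; exists k => //; right. Qed.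

End transform_schwartz.

(** * Gaussians with a power weight *)

Section explicit_schwartz.
Context {R : realType} {d : nat}.
Local Notation E := 'rV[R]_d.
Local Notation e_ i := (delta_mx (ord0 : 'I_1) (i : 'I_d) : E).

Lemma is_derive_compR (h : E -> R) (g : R -> R) (x v : E) (D G : R) :
  is_derive x v h D -> is_derive (h x) (1 : R) g G ->
  is_derive x v (fun y => g (h y)) (G * D).
Proof.
move=> dh dg.
have := @is_derive_lineP R _ (fun y => g (h y)) x v 0 (G * D).
rewrite scale0r addr0 => -[_]; apply.
have hl : is_derive (0 : R) (1 : R) (fun u : R => h (x + u *: v)) D.
  by apply/(@is_derive_lineP R _ h x v); rewrite scale0r addr0.
by apply: (@is_derive1_comp R g (fun u => h (x + u *: v))); rewrite scale0r addr0.
Qed.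

Lemma is_derive_jb i (x : E) : is_derive x (e_ i) jb (2 * x ord0 i).
Proof.
apply: (@is_derive_quad _ _ _ _ _ _ 1) => t _.
rewrite /jb dotDl !dotDr !dotZl !dotZr dot_deltal (dotC x) dot_deltal dot_deltal mxE !eqxx mulr1.
by rewrite (_ : _ - _ = t ^+ 2) ?ger0_norm ?sqr_ge0 ?mulr1//; ring.
Qed.

Lemma is_derive_gauss b i (x c : E) :
  is_derive x (e_ i) (fun x => gauss b (x - c)) (- (b * (x - c) ord0 i) * gauss b (x - c)).
Proof.
rewrite mulrC; apply: (@is_derive_compR _ expR _ _ (- (b * (x - c) ord0 i))).
  apply: (@is_derive_quad _ _ _ _ _ _ (`|b| / 2)) => t _.
  rewrite (addrAC x); move: (x - c) => y.
  rewrite dotDl !dotDr !dotZl !dotZr dot_deltal (dotC y) dot_deltal dot_deltal mxE !eqxx mulr1.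
  rewrite (_ : _ - _ = - (t ^+ 2 * (b / 2))); last by field.
  by rewrite normrN normrM ger0_norm ?sqr_ge0// normrM [`|2^-1|]ger0_norm.
Qed.

(** These functions span a space stable under [partial]; the Fourier transforms
    of the witnesses all belong to it. *)
Definition bracket_gauss (a b : R) (c x : E) : R := jb x `^ a * gauss b (x - c).

Lemma is_derive_bracket_gauss a b c i x :
  is_derive x (e_ i) (bracket_gauss a b c)
    (- b * (x ord0 i * bracket_gauss a b c x) + b * c ord0 i * bracket_gauss a b c x
     + 2 * a * (x ord0 i * bracket_gauss (a - 1) b c x)).
Proof.
have d1 := is_derive_compR (is_derive_jb i x) (is_derive1_powR a (jb_gt0 x)).
apply: is_derive_eq (is_deriveM d1 (is_derive_gauss b i x c)) _.
rewrite /bracket_gauss !mxE -![_ *: _]/(_ * _); ring.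
Qed.

Lemma bracket_gauss_ge0 a b c x : 0 <= bracket_gauss a b c x.
Proof. by rewrite mulr_ge0 ?powR_ge0 ?gauss_ge0. Qed.

Lemma continuous_sumf (f : 'I_d -> E -> R) : (forall i, continuous (f i)) ->
  continuous (fun x => \sum_i f i x).
Proof.
move=> cf; elim: (index_enum _) => [|i s IHs].
  by under eq_fun do rewrite big_nil; exact: cst_continuous.
by under eq_fun do rewrite big_cons; exact: continuous_addf.
Qed.

Lemma continuous_sqr_dist (c : E) : continuous (fun x : E => dot (x - c) (x - c)).
Proof.
apply: continuous_sumf => i; under eq_fun do rewrite !mxE.
have cc : continuous (fun x : E => x ord0 i - c ord0 i).
  by apply: continuous_addf; [exact: coord_continuous|exact: cst_continuous].
exact: continuous_mulf.
Qed.

Lemma continuous_jb : continuous (@jb R d).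
Proof.
apply: continuous_addf; first exact: cst_continuous.
have h := @continuous_sqr_dist 0.
by move: h; rewrite (_ : (fun x : E => _) = (fun x => dot x x))//; apply/funext => x; rewrite subr0.
Qed.

Lemma continuous_bracket_gauss a b c : continuous (bracket_gauss a b c).
Proof.
apply: continuous_mulf.
  move=> x; apply: (@continuous_comp _ _ _ jb (fun t => t `^ a) x).
    exact: continuous_jb.
  apply/differentiable_continuous/derivable1_diffP.
  by have := is_derive1_powR a (jb_gt0 x) => -[].
have h : continuous (fun x : E => - (b * dot (x - c) (x - c) / 2)).
  rewrite (_ : (fun x : E => _) = (fun x => - (b / 2) * dot (x - c) (x - c))).
    by apply: continuous_mulf; [exact: cst_continuous|exact: continuous_sqr_dist].
  by apply/funext => x; rewrite mulrAC mulNr.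
move=> x; apply: (@continuous_comp _ _ _ (fun x : E => - (b * dot (x - c) (x - c) / 2)) expR x).
  exact: h.
exact: continuous_expR.
Qed.

(** [expR u >= 1 + u] to the power [m] beats any polynomial. *)
Lemma gauss_decay b m : 0 < b -> exists2 C, 0 <= C & forall y : E, jb y ^+ m * gauss b y <= C.
Proof.
move=> b0; case: m => [|m].
  by exists 1 => // y; rewrite expr0 mul1r -expR0 ler_expR oppr_le0 divr_ge0 ?mulr_ge0 ?dotxx_ge0// ltW.
pose q := b / (2 * m.+1%:R); have q0 : 0 < q by rewrite divr_gt0// mulr_gt0.
pose B := 1 + q^-1; have B0 : 0 <= B by rewrite addr_ge0// invr_ge0 ltW.
exists (B ^+ m.+1); first exact: exprn_ge0.
move=> y; rewrite -ler_pdivlMr ?gauss_gt0// /gauss -expRN opprK.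
have -> : b * dot y y / 2 = m.+1%:R * (q * dot y y).
  have n0 : m.+1%:R != 0 :> R by rewrite pnatr_eq0.
  by rewrite /q; move: m.+1%:R n0 => n n0; field.
rewrite expRM_natl -exprMn lerXn2r ?nnegrE ?mulr_ge0 ?expR_ge0 ?(ltW (jb_gt0 _))//.
apply: le_trans (ler_wpM2l B0 (expR_ge1Dx _)).
rewrite /jb /B; have := dotxx_ge0 y; move: (dot y y) => u u0.
rewrite -subr_ge0 (_ : _ - _ = q * u + q^-1); first by rewrite addr_ge0 ?mulr_ge0 ?invr_ge0// ltW.
by field; rewrite gt_eqF.
Qed.

Lemma jb_powR_le a : exists N, forall x : E, jb x `^ a <= jb x ^+ N.
Proof.
exists (Num.truncn `|a|).+1 => x; rewrite -powR_mulrn ?(ltW (jb_gt0 _))//.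
rewrite ler_powR ?jb_ge1//; apply: le_trans (ler_norm _) _.
exact: ltW (truncnS_gt _).
Qed.

Lemma rapid_bracket_gauss a b c : 0 < b -> rapidly_decreasing (bracket_gauss a b c).
Proof.
move=> b0 m; have [N hN] := jb_powR_le a.
have [C C0 hC] := gauss_decay (m + N) b0.
exists ((2 * jb c) ^+ (m + N) * C) => x.
rewrite ger0_norm ?bracket_gauss_ge0// mulrA.
apply: (@le_trans _ _ (jb x ^+ (m + N) * gauss b (x - c))).
  rewrite ler_wpM2r ?gauss_ge0// exprD ler_wpM2l ?hN//.
  by rewrite exprn_ge0// ltW// jb_gt0.
apply: (@le_trans _ _ ((2 * jb c) ^+ (m + N) * (jb (x - c) ^+ (m + N) * gauss b (x - c)))).
  rewrite mulrA ler_wpM2r ?gauss_ge0// -exprMn lerXn2r ?nnegrE ?mulr_ge0 ?(ltW (jb_gt0 _))//.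
  by have := jb_peetre (x - c) c; rewrite subrK mulrAC.
by rewrite ler_wpM2l ?exprn_ge0 ?mulr_ge0 ?(ltW (jb_gt0 _)).
Qed.

Inductive bracket_gauss_span (b : R) (c : E) : (E -> R) -> Prop :=
| Span_gen a : bracket_gauss_span b c (bracket_gauss a b c)
| Span_coord i h : bracket_gauss_span b c h ->
    bracket_gauss_span b c (fun x => x ord0 i * h x)
| Span_add h h' : bracket_gauss_span b c h -> bracket_gauss_span b c h' ->
    bracket_gauss_span b c (fun x => h x + h' x)
| Span_scale r h : bracket_gauss_span b c h ->
    bracket_gauss_span b c (fun x => r * h x).

Lemma schwartz_bracket_gauss a b c : 0 < b -> real_schwartz (bracket_gauss a b c).
Proof.
move=> b0; apply: (@schwartz_class _ _ (bracket_gauss_span b c)); last exact: Span_gen.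
move=> h; elim=> {h a} [a|i h sh [ch rh dh]|h h' _ [ch rh dh] _ [ch' rh' dh']|r h _ [ch rh dh]]; split.
- exact: continuous_bracket_gauss.
- exact: rapid_bracket_gauss.
- move=> i; eexists; last by move=> x; exact: is_derive_bracket_gauss.
  apply: Span_add; first apply: Span_add.
  + by apply: Span_scale; apply: Span_coord; exact: Span_gen.
  + by apply: Span_scale; exact: Span_gen.
  + by apply: Span_scale; apply: Span_coord; exact: Span_gen.
- by apply: continuous_mulf => //; exact: coord_continuous.
- exact: rapid_coord.
- move=> j; have [h' sh' dh'] := dh j.
  exists (fun x : E => x ord0 i * h' x + (j == i)%:R * h x).
    exact: (Span_add (Span_coord i sh') (Span_scale _ sh)).
  move=> x; apply: is_derive_eq.
    exact: (is_deriveM (is_derive_coord j i x) (dh' x)).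
  by congr (_ + _); exact: mulrC.
- exact: continuous_addf.
- exact: rapidD.
- move=> j; have [h1 sh1 dh1] := dh j; have [h2 sh2 dh2] := dh' j.
  exists (fun x : E => h1 x + h2 x); first exact: Span_add.
  by move=> x; exact: is_deriveD.
- by apply: continuous_mulf => //; exact: cst_continuous.
- exact: rapidZ.
- move=> j; have [h1 sh1 dh1] := dh j.
  exists (fun x : E => r * h1 x); first exact: Span_scale.
  by move=> x; exact: (@is_deriveZ _ _ _ _ r _ _ _ (dh1 x)).
Qed.

End explicit_schwartz.

Section gaussian_transform.
Context {R : realType} {d : nat}.
Local Notation E := 'rV[R]_d.
Local Notation mu := (@lebesgue_rV R d).
Local Notation e_ i := (delta_mx (ord0 : 'I_1) (i : 'I_d) : E).
Variables (b : R) (b0 : 0 < b).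

Lemma schwartz_gauss : real_schwartz (@gauss R d b).
Proof.
have := @schwartz_bracket_gauss R d 0 b 0 b0; congr real_schwartz.
by apply/funext => x; rewrite /bracket_gauss powRr0 mul1r subr0.
Qed.

Lemma partial_gauss i (x : E) : partial i (gauss b) x = - b * (x ord0 i * gauss b x).
Proof.
have := @is_derive_gauss R d b i x 0.
rewrite (_ : (fun x => _) = gauss b); last by apply/funext => y; rewrite subr0.
by rewrite subr0 => h; rewrite /partial derive_val mulrA !mulNr.
Qed.

Let sg := schwartz_gauss.
Let ig := schwartz_integrable sg.

Lemma coord_gauss i : (fun z : E => z ord0 i * gauss b z) = (fun z => - b^-1 * partial i (gauss b) z).
Proof.
by apply/funext => z; rewrite partial_gauss mulrA mulrNN mulVf ?mul1r// gt_eqF.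
Qed.

Lemma transform_dot_gauss (T : (E -> R) -> E -> R) v x :
  (forall f g, itg mu f -> itg mu g -> T (fun z => f z + g z) x = T f x + T g x) ->
  (forall c f, itg mu f -> T (fun z => c * f z) x = c * T f x) ->
  T (fun z => dot v z * gauss b z) x = - b^-1 * \sum_i v ord0 i * T (partial i (gauss b)) x.
Proof.
move=> TD TZ; have ip i := schwartz_integrable (schwartz_partial sg i).
rewrite (_ : (fun z => _) = (fun z => \sum_i (v ord0 i * - b^-1) * partial i (gauss b) z)); last first.
  apply/funext => z; rewrite mulr_suml; apply: eq_bigr => i _.
  by rewrite -!mulrA; congr (_ * _); have := congr1 (fun f => f z) (coord_gauss i).
rewrite mulr_sumr; elim: (index_enum _) => [|i s IHs].
  under eq_fun do rewrite big_nil; rewrite big_nil.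
  rewrite (_ : (fun z => _) = (fun z => 0 * gauss b z)); first by rewrite TZ// mul0r.
  by apply/funext => z; rewrite mul0r.
under eq_fun do rewrite big_cons; rewrite big_cons TD.
- by rewrite IHs; congr (_ + _); rewrite (TZ _ _ (ip i)) mulrA [in LHS](mulrC (v ord0 i)).
- exact: integrableEZl.
- rewrite /itg (_ : _ \o _ = (fun z => \sum_(j <- s) (v ord0 j * - b^-1 * partial j (gauss b) z)%:E)%E).
    by apply: integrable_sum => // j _; exact: integrableEZl.
  by apply/funext => z /=; rewrite sumEFin.
Qed.

(** A coordinate times the Gaussian is a multiple of a partial derivative of
    the Gaussian; integrating it by parts leads back to the transform of the
    Gaussian. *)
Lemma is_derive_cosT_gauss (x v : E) :
  is_derive x v (cosT (gauss b)) (- (dot x v / b) * cosT (gauss b) x).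
Proof.
apply: is_derive_eq (is_derive_cosT sg x v) _.
rewrite (transform_dot_gauss (T := sinT)); last 2 first.
- by move=> *; exact: sinTD.
- by move=> *; exact: sinTZ.
rewrite (_ : \sum_i _ = - (dot x v * cosT (gauss b) x)); first by ring.
rewrite /dot mulr_suml -sumrN; apply: eq_bigr => i _.
by rewrite sinT_partial// mulrN mulrCA mulrA.
Qed.

Lemma is_derive_sinT_gauss (x v : E) :
  is_derive x v (sinT (gauss b)) (- (dot x v / b) * sinT (gauss b) x).
Proof.
apply: is_derive_eq (is_derive_sinT sg x v) _.
rewrite (transform_dot_gauss (T := cosT)); last 2 first.
- by move=> *; exact: cosTD.
- by move=> *; exact: cosTZ.
rewrite (_ : \sum_i _ = dot x v * sinT (gauss b) x); first by ring.
rewrite /dot mulr_suml; apply: eq_bigr => i _.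
by rewrite cosT_partial// mulrCA mulrA.
Qed.

(** Along the ray through [x], the product of [h] with the inverse of the
    Gaussian has derivative zero. *)
Lemma gaussian_ode (h : E -> R) x :
  (forall x v : E, is_derive x v h (- (dot x v / b) * h x)) ->
  h x = h 0 * gauss b^-1 x.
Proof.
move=> dh; pose F (u : R) := h (u *: x) * expR (u ^+ 2 * (dot x x / (2 * b))).
have dF u : is_derive u (1 : R) F 0.
  have d1 : is_derive u (1 : R) (fun u : R => h (u *: x)) (- (u * dot x x / b) * h (u *: x)).
    have := @is_derive_lineP R _ h 0 x u (- (u * dot x x / b) * h (u *: x)).
    rewrite add0r (_ : (fun v : R => _) = (fun v : R => h (v *: x))); last first.
      by apply/funext => v; rewrite add0r.
    move=> [+ _]; apply; apply: is_derive_eq (dh (u *: x) x) _.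
    by rewrite dotZl.
  have d2 : is_derive u (1 : R) (fun u : R => expR (u ^+ 2 * (dot x x / (2 * b))))
      (expR (u ^+ 2 * (dot x x / (2 * b))) * (2 * u * (dot x x / (2 * b)))).
    apply: (@is_derive1_comp R expR (fun u : R => u ^+ 2 * (dot x x / (2 * b)))).
    apply: (@is_derive_quad _ _ _ _ _ _ (dot x x / (2 * b))) => t _.
    rewrite -[t *: 1]/(t * 1) mulr1.
    set q := dot x x / _; have q0 : 0 <= q by rewrite divr_ge0 ?dotxx_ge0// mulr_ge0// ltW.
    rewrite (_ : _ - _ = t ^+ 2 * q); last by ring.
    by rewrite ger0_norm; [exact: lexx|exact: mulr_ge0 (sqr_ge0 t) q0].
  apply: is_derive_eq (is_deriveM d1 d2) _; rewrite -![_ *: _]/(_ * _) /=.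
  by rewrite /GRing.scale /=; field; rewrite gt_eqF.
have := is_derive_0_is_cst 1 0 dF.
rewrite /F scale1r scale0r expr1n expr0n mul1r mul0r expR0 mulr1 => <-.
rewrite -mulrA -expRD (_ : _ + _ = 0) ?expR0 ?mulr1//.
by field; rewrite gt_eqF.
Qed.

Lemma cosT_gauss (x : E) :
  cosT (gauss b) x = Num.sqrt (2 * pi / b) ^+ d * gauss b^-1 x.
Proof.
rewrite (gaussian_ode _ is_derive_cosT_gauss) cosT0 Rintegral_gauss//.
Qed.

Lemma sinT_gauss (x : E) : sinT (gauss b) x = 0.
Proof. by rewrite (gaussian_ode _ is_derive_sinT_gauss) sinT0 mul0r. Qed.

End gaussian_transform.

(** * Fourier inversion *)

Lemma ler_add_small {R : realType} (a c C : R) :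
  (forall e, 0 < e -> a <= c + e * C) -> a <= c.
Proof.
move=> h; apply/ler_addgt0Pr => e e0.
have [C0|C0] := lerP C 0.
  by apply: le_trans (h _ e0) _; rewrite lerD2l (le_trans _ (ltW e0))// mulr_ge0_le0// ltW.
by have := h (e / C) (divr_gt0 e0 C0); rewrite divfK// gt_eqF.
Qed.

Section rV_swap.
Context {R : realType} {m n : nat}.

Lemma rV_swap (H : 'rV[R]_m * 'rV[R]_n -> R) a b :
  measurable_fun setT H -> itg (lebesgue_rV m) a -> itg (lebesgue_rV n) b ->
  (forall x y, `|H (x, y)| <= a x * b y) ->
  \int[lebesgue_rV m]_x \int[lebesgue_rV n]_y H (x, y) =
  \int[lebesgue_rV n]_y \int[lebesgue_rV m]_x H (x, y).
Proof.
exact: (@Rintegral_swap _ _ _ _ _ (lebesgue_rV m) (lebesgue_rV n)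
  (@sigma_finite_lebesgue_rV R m) (@sigma_finite_lebesgue_rV R n)).
Qed.

End rV_swap.

Section inversion.
Context {R : realType} {d : nat}.
Local Notation E := 'rV[R]_d.
Local Notation mu := (@lebesgue_rV R d).

Lemma gauss_le1 b (x : E) : 0 <= b -> gauss b x <= 1.
Proof.
by move=> b0; rewrite -expR0 ler_expR oppr_le0 divr_ge0// mulr_ge0// dotxx_ge0.
Qed.

(** [u exp (-u) <= 1] trades the weight for half of the exponent. *)
Lemma dot_gauss_le b (x : E) : 0 < b -> dot x x * gauss b x <= 4 / b * gauss (b / 2) x.
Proof.
move=> b0; have -> : gauss b x = gauss (b / 2) x * gauss (b / 2) x.
  by rewrite /gauss -expRD; congr expR; field.
rewrite mulrA ler_wpM2r ?gauss_ge0// /gauss expRN ler_pdivrMr ?expR_gt0//.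
set w := b / 2 * dot x x / 2.
have -> : dot x x = 4 / b * w by rewrite /w; field; rewrite gt_eqF.
rewrite ler_wpM2l ?divr_ge0 ?(ltW b0)//.
by have := expR_ge1Dx w; lra.
Qed.

Lemma measurable_comp_sub (h : E -> R) : measurable_fun setT h ->
  measurable_fun setT (fun z : E * E => h (z.1 - z.2)).
Proof. by move=> mh; apply: measurableT_comp mh _; exact: measurable_sub. Qed.

(** Multiplying a Fourier integral by [w] averages the transform of [w] over
    the frequencies of [k]. *)
Lemma fourier_swap (phi : R -> R) (k w : E -> R) (xi : E) :
  measurable_fun setT phi -> (forall a, `|phi a| <= 1) -> itg mu k -> itg mu w ->
  \int[mu]_x ((\int[mu]_z (phi (dot x (z - xi)) * k z)) * w x) =
  \int[mu]_z (\int[mu]_x (phi (dot (z - xi) x) * w x) * k z).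
Proof.
move=> mphi phi1 ik iw.
have mk := integrable_measurable ik; have mw := integrable_measurable iw.
have mph (x : E) : measurable_fun setT (fun z : E => phi (dot x (z - xi))).
  apply: measurableT_comp mphi _; apply: measurable_dot; first exact: measurable_cst.
  exact: measurable_add_rV.
have ip x : itg mu (fun z => phi (dot x (z - xi)) * k z).
  exact: integrable_bounded_mul (mph x) (fun=> phi1 _) ik.
pose H (z : E * E) := phi (dot z.1 (z.2 - xi)) * k z.2 * w z.1.
have -> : \int[mu]_x ((\int[mu]_z (phi (dot x (z - xi)) * k z)) * w x) =
    \int[mu]_x \int[mu]_z H (x, z).
  apply: eq_Rintegral => x _; rewrite mulrC -RintegralZT//.
  by apply: eq_Rintegral => z _; rewrite /H mulrC.
rewrite (@rV_swap _ _ _ H (fun x => `|w x|) (fun z => `|k z|)).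
- apply: eq_Rintegral => z _; rewrite mulrC -RintegralZT.
    by apply: eq_Rintegral => x _; rewrite /H /= dotC; ring.
  apply: integrable_bounded_mul iw; last by move=> x; exact: phi1.
  by apply: measurableT_comp mphi _; exact: measurable_dotr.
- apply: measurable_funM.
    apply: measurable_funM; last exact: measurableT_comp mk measurable_snd.
    apply: measurableT_comp mphi _; apply: measurable_dot; first exact: measurable_fst.
    exact: measurableT_comp (@measurable_add_rV R d (- xi)) measurable_snd.
  exact: measurableT_comp mw measurable_fst.
- exact: integrable_norm iw.
- exact: integrable_norm ik.
- by move=> x z; rewrite /H /= !normrM mulrC ler_wpM2l// ler_piMl.
Qed.

Section modulation.
Variables (k : E -> R) (ik : itg mu k) (xi : E).

Lemma cosT_modulate x :
  cos (dot xi x) * cosT k x + sin (dot xi x) * sinT k x =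
  \int[mu]_z (cos (dot x (z - xi)) * k z).
Proof.
rewrite /cosT /sinT -!RintegralZT ?integrable_cos_mul ?integrable_sin_mul//.
rewrite -RintegralDT; [|by apply: integrableEZl; rewrite ?integrable_cos_mul ?integrable_sin_mul..].
by apply: eq_Rintegral => z _; rewrite dotBr cosB (dotC xi); ring.
Qed.

Lemma sinT_modulate x :
  cos (dot xi x) * sinT k x - sin (dot xi x) * cosT k x =
  \int[mu]_z (sin (dot x (z - xi)) * k z).
Proof.
rewrite /cosT /sinT -!RintegralZT ?integrable_cos_mul ?integrable_sin_mul//.
rewrite -RintegralBT; [|by apply: integrableEZl; rewrite ?integrable_cos_mul ?integrable_sin_mul..].
by apply: eq_Rintegral => z _; rewrite dotBr sinB (dotC xi); ring.
Qed.

End modulation.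

Section schwartz_inversion.
Variables (k : E -> R) (sk : real_schwartz k) (xi : E).
Let ik := schwartz_integrable sk.
Let scT := cosT_schwartz sk.
Let ssT := sinT_schwartz sk.

Let P x := cos (dot xi x) * cosT k x + sin (dot xi x) * sinT k x.
Let Q x := cos (dot xi x) * sinT k x - sin (dot xi x) * cosT k x.

(** Removing the Gaussian regularisation costs [O(dl)], since
    [0 <= 1 - gauss dl x <= dl |x|^2 / 2]. *)
Lemma regularisation_error (F G : E -> R) :
  real_schwartz F -> real_schwartz G ->
  exists C, forall h : E -> R, measurable_fun setT h ->
    (forall x, `|h x| <= `|F x| + `|G x|) ->
    forall dl : R, 0 < dl -> `|\int[mu]_x h x - \int[mu]_x (h x * gauss dl x)| <= dl * C.
Proof.
move=> sF sG.
have i1 S : real_schwartz S -> itg mu (fun x => dot x x * `|S x|).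
  move=> sS; have [C C0 hC] := schwartz_decay sS d.+1.
  apply: (@integrable_le _ _ _ _ _ (fun x : E => C * (jb x ^+ d)^-1)).
  - apply: measurable_funM; first exact: measurable_dot.
    by apply: measurableT_comp => //; exact: schwartz_measurable.
  - move=> x; rewrite ger0_norm ?mulr_ge0 ?dotxx_ge0//.
    apply: (@le_trans _ _ (jb x * `|S x|)); first by rewrite ler_wpM2r// lerDr.
    have := hC x; rewrite !ler_pdivlMr ?exprn_gt0 ?jb_gt0//.
    by rewrite mulrAC -exprS mulrC.
  - exact: integrableEZl (@integrable_jbXn R d).
have iFG : itg mu (fun x => dot x x * `|F x| + dot x x * `|G x|).
  by apply: integrableED; exact: i1.
exists (\int[mu]_x (2^-1 * (dot x x * `|F x| + dot x x * `|G x|))) => h mh hFG dl dl0.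
have ih : itg mu h.
  apply: (integrable_le mh hFG); apply: integrableED.
    exact: integrable_norm (schwartz_integrable sF).
  exact: integrable_norm (schwartz_integrable sG).
have ihg : itg mu (fun x => h x * gauss dl x).
  under [X in itg _ X]eq_fun do rewrite mulrC.
  apply: (@integrable_bounded_mul _ _ _ _ _ _ 1) ih; first exact: measurable_gauss.
  by move=> x; rewrite ger0_norm ?gauss_ge0// gauss_le1// ltW.
rewrite -RintegralBT// -RintegralZT; last exact: integrableEZl.
apply: Rintegral_norm_le.
- exact: integrableEB.
- by apply: integrableEZl; exact: integrableEZl.
- move=> x; rewrite -[X in X - _]mulr1 -mulrBr normrM.
  rewrite (_ : dl * _ = (`|F x| + `|G x|) * (dl * dot x x / 2)); last by field.
  apply: ler_pM => //.
  rewrite ger0_norm ?subr_ge0 ?gauss_le1 ?(ltW dl0)//.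
  have := expR_ge1Dx (- (dl * dot x x / 2)); rewrite -/(gauss dl x); lra.
Qed.

Let sP_bound x : `|P x| <= `|cosT k x| + `|sinT k x|.
Proof.
apply: le_trans (ler_normD _ _) _; rewrite !normrM.
by rewrite lerD// ler_piMl ?cos_max ?sin_max.
Qed.

Let sQ_bound x : `|Q x| <= `|cosT k x| + `|sinT k x|.
Proof.
apply: le_trans (ler_normB _ _) _; rewrite !normrM addrC.
by rewrite lerD// ler_piMl ?cos_max ?sin_max.
Qed.

Let mP : measurable_fun setT P.
Proof.
apply: measurable_funD; apply: measurable_funM; try exact: schwartz_measurable.
  exact: measurableT_comp measurable_cos (measurable_dotr xi).
exact: measurableT_comp measurable_sin (measurable_dotr xi).
Qed.

Let mQ : measurable_fun setT Q.
Proof.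
apply: measurable_funB; apply: measurable_funM; try exact: schwartz_measurable.
  exact: measurableT_comp measurable_cos (measurable_dotr xi).
exact: measurableT_comp measurable_sin (measurable_dotr xi).
Qed.

(** After regularisation the integral becomes one of sine transforms of
    Gaussians, which vanish. *)
Lemma fourier_inversion_sin : cosT (sinT k) xi - sinT (cosT k) xi = 0.
Proof.
rewrite /cosT /sinT -RintegralBT; last 2 first.
- exact: integrable_cos_mul (schwartz_integrable ssT).
- exact: integrable_sin_mul (schwartz_integrable scT).
rewrite -[LHS]/(\int[mu]_x Q x); apply/eqP; rewrite -normr_le0.
have [C hC] := regularisation_error scT ssT.
apply: (@ler_add_small _ _ _ C) => e e0; rewrite add0r.
have := hC _ mQ sQ_bound e e0.
rewrite [X in _ - X](_ : _ = 0) ?subr0//.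
under eq_Rintegral do rewrite /Q (sinT_modulate ik).
rewrite (fourier_swap _ measurable_sin (@sin_max R) ik (integrable_gauss e0)).
rewrite (@eq_Rintegral _ _ _ mu setT (fun=> 0)); first by rewrite /Rintegral integral0.
by move=> z _; rewrite -[X in X * _]/(sinT _ _) sinT_gauss// mul0r.
Qed.

(** The regularised integral is [k] convolved with a Gaussian of width
    [sqrt dl]; continuity of [k] at [xi] controls it near [xi], and the weight
    [|z|^2] far from it. *)
Lemma gauss_approx (eps : R) : 0 < eps -> exists C, forall dl : R, 0 < dl ->
  `|\int[mu]_z (cosT (gauss dl) (z - xi) * k z) - (2 * pi) ^+ d * k xi| <=
  eps * (2 * pi) ^+ d + dl * C.
Proof.
move=> eps0.
have [B B0 hB] := schwartz_bounded sk.
have ck : {for xi, continuous k} by exact: schwartz_continuous.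
have /nbhs_ballP[r /= r0 hr] : \forall y \near xi, `|k xi - k y| < eps.
  by move/cvgrPdist_lt : ck; apply.
have near_far z : `|k (z + xi) - k xi| <= eps + 2 * B / r ^+ 2 * dot z z.
  have [zr|] := pselect (forall i, `|z ord0 i| < r).
    apply: (@le_trans _ _ eps); last first.
      by rewrite lerDl; exact: mulr_ge0 (divr_ge0 (mulr_ge0 (ler0n _ 2) B0) (sqr_ge0 r)) (dotxx_ge0 z).
    rewrite distrC ltW//; apply: hr; split=> // i j.
    by rewrite ord1 /ball /= !mxE opprD addrCA subrr addr0 normrN.
  move=> /existsNP[i /negP]; rewrite -leNgt => zr.
  apply: (@le_trans _ _ (2 * B)).
    apply: le_trans (ler_normB _ _) _; rewrite mulr_natl mulr2n lerD//; exact: hB.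
  apply: ler_wpDl; first exact: ltW.
  rewrite mulrAC ler_pdivlMr ?exprn_gt0// ler_wpM2l ?mulr_ge0//.
  apply: le_trans (sqr_coord_le_dot z i).
  by rewrite -[z ord0 i ^+ 2]real_normK ?num_real// lerXn2r ?nnegrE// ltW.
exists (2 * B / r ^+ 2 * 4 * ((2 * pi) ^+ d * Num.sqrt 2 ^+ d)) => dl dl0.
have dlV0 : 0 < dl^-1 by rewrite invr_gt0.
pose c := Num.sqrt (2 * pi / dl) ^+ d.
have c0 : 0 <= c by rewrite exprn_ge0.
have pi0 := pi_gt0 R.
have cE q : 0 < q -> c * Num.sqrt (2 * pi / (q * dl^-1)) ^+ d = ((2 * pi) / Num.sqrt q) ^+ d.
  move=> q0; rewrite /c -exprMn -sqrtrM ?divr_ge0 ?mulr_ge0 ?ltW//.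
  congr (_ ^+ _); rewrite (_ : _ / dl * _ = (2 * pi) ^+ 2 / q); last first.
    by field; rewrite !gt_eqF.
  by rewrite sqrtrM ?sqr_ge0// sqrtrV ?ltW// sqrtr_sqr ger0_norm// mulr_ge0// ltW.
have ig q : 0 < q -> itg mu (@gauss R d (q * dl^-1)) by move=> q0; apply: integrable_gauss; rewrite mulr_gt0.
have ig1 : itg mu (@gauss R d dl^-1) by rewrite -(mul1r dl^-1); exact: ig.
have ikg : itg mu (fun z => c * (k (z + xi) * gauss dl^-1 z)).
  apply: integrableEZl; apply: (@integrable_bounded_mul _ _ _ _ _ _ B) ig1.
    exact: measurableT_comp (schwartz_measurable sk) (@measurable_add_rV R d xi).
  by move=> z; exact: hB.
have -> : \int[mu]_z (cosT (gauss dl) (z - xi) * k z) = \int[mu]_z (c * (k (z + xi) * gauss dl^-1 z)).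
  rewrite -(@Rintegral_shift _ _ (- xi) (fun z => c * (k (z + xi) * gauss dl^-1 z))) //.
  by apply: eq_Rintegral => z _; rewrite cosT_gauss// subrK -/c; ring.
have -> : (2 * pi) ^+ d * k xi = \int[mu]_z (c * (k xi * gauss dl^-1 z)).
  rewrite !RintegralZT ?Rintegral_gauss ?integrableEZl// mulrCA -[in RHS](mul1r dl^-1) cE//.
  by rewrite sqrtr1 divr1 mulrC.
rewrite -RintegralBT//; last by apply: integrableEZl; exact: integrableEZl.
pose U z := eps * (c * gauss dl^-1 z) + 2 * B / r ^+ 2 * 4 * dl * (c * @gauss R d (2^-1 * dl^-1) z).
have iU : itg mu U.
  by apply: integrableED; apply: integrableEZl; apply: integrableEZl => //; apply: ig.
apply: (@le_trans _ _ (\int[mu]_z U z)).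
  apply: Rintegral_norm_le => //.
    by apply: integrableEB => //; apply: integrableEZl; exact: integrableEZl.
  move=> z; rewrite -mulrBr -mulrBl !normrM (ger0_norm c0) (ger0_norm (gauss_ge0 _ _)).
  rewrite /U [eps * _]mulrCA [_ * dl * _]mulrCA -mulrDr ler_wpM2l//.
  apply: le_trans (ler_wpM2r (gauss_ge0 _ _) (near_far z)) _.
  rewrite mulrDl lerD2l -!mulrA ler_wpM2l// ler_wpM2l// ler_wpM2l ?invr_ge0 ?sqr_ge0//.
  have := dot_gauss_le z dlV0; rewrite invrK -!mulrA.
  by rewrite [2^-1 * _]mulrC.
rewrite RintegralDT; try by apply: integrableEZl; apply: integrableEZl => //; apply: ig.
rewrite !RintegralZT ?Rintegral_gauss ?mulr_gt0//; try by [exact: ig|apply: integrableEZl => //; apply: ig].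
rewrite -{1}[dl^-1]mul1r !cE// sqrtr1 divr1 lerD2l.
rewrite sqrtrV// invrK exprMn; rewrite le_eqVlt; apply/orP; left; apply/eqP; ring.
Qed.

Lemma fourier_inversion_cos : cosT (cosT k) xi + sinT (sinT k) xi = (2 * pi) ^+ d * k xi.
Proof.
rewrite /cosT /sinT -RintegralDT; last 2 first.
- exact: integrable_cos_mul (schwartz_integrable scT).
- exact: integrable_sin_mul (schwartz_integrable ssT).
rewrite -[LHS]/(\int[mu]_x P x); apply/eqP; rewrite -subr_eq0 -normr_le0.
have [C hC] := regularisation_error scT ssT.
apply: (@ler_add_small _ _ _ ((2 * pi) ^+ d)) => eps eps0; rewrite add0r.
have [C' hC'] := gauss_approx eps0.
apply: (@ler_add_small _ _ _ (C + C')) => dl dl0.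
have h1 := hC _ mP sP_bound dl dl0.
have := hC' dl dl0.
have -> : \int[mu]_z (cosT (gauss dl) (z - xi) * k z) = \int[mu]_x (P x * gauss dl x).
  under [in RHS]eq_Rintegral do rewrite /P (cosT_modulate ik).
  by rewrite (fourier_swap _ measurable_cos (@cos_max R) ik (integrable_gauss dl0)).
move=> h2; apply: (@le_trans _ _ (dl * C + (eps * (2 * pi) ^+ d + dl * C'))); last first.
  by rewrite [leRHS](_ : _ = dl * C + (eps * (2 * pi) ^+ d + dl * C'))//; ring.
apply: le_trans _ (lerD h1 h2); apply: le_trans _ (ler_normD _ _).
by rewrite addrA subrK.
Qed.

End schwartz_inversion.
End inversion.

(** * Bessel potentials and norms *)

Local Open Scope complex_scope.

Section complex_layer.
Context {R : realType} {d : nat}.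
Local Notation E := 'rV[R]_d.
Local Notation mu := (@lebesgue_rV R d).
Local Notation e_ i := (delta_mx (ord0 : 'I_1) (i : 'I_d) : E).
Implicit Types k : E -> R.

Definition kap : R := ((2 * pi) ^+ d)^-1.

Lemma kap_gt0 : 0 < kap.
Proof. by rewrite invr_gt0 exprn_gt0// mulr_gt0// pi_gt0. Qed.

(** All symbols below are real, so that the real and imaginary parts of a
    function are a cosine and a sine transform. *)
Definition ift k : E -> R[i] := inverse_fourier (fun xi => (k xi)%:C).

Lemma iftE k x : ift k x = (kap * cosT k x) +i* (kap * sinT k x).
Proof.
rewrite /ift /inverse_fourier /cintegral /cosT /sinT /kap.
have -> : \int[mu]_z re (fun xi => expi (dot x xi) * (k xi)%:C) z = \int[mu]_z (cos (dot x z) * k z).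
  by apply: eq_Rintegral => z _; rewrite /re /= mulr0 subr0.
have -> : \int[mu]_z im (fun xi => expi (dot x xi) * (k xi)%:C) z = \int[mu]_z (sin (dot x z) * k z).
  by apply: eq_Rintegral => z _; rewrite /im /= mulr0 add0r.
by apply/eqP; rewrite eq_complex /= !mul0r subr0 addr0 !eqxx.
Qed.

Lemma re_ift k : re (ift k) = (fun x => kap * cosT k x).
Proof. by apply/funext => x; rewrite /re iftE. Qed.

Lemma im_ift k : im (ift k) = (fun x => kap * sinT k x).
Proof. by apply/funext => x; rewrite /im iftE. Qed.

Lemma schwartz_ift k : real_schwartz k -> schwartz (ift k).
Proof.
move=> sk; split.
- by rewrite re_ift; apply: schwartzZ; exact: cosT_schwartz.
- by rewrite im_ift; apply: schwartzZ; exact: sinT_schwartz.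
Qed.

Lemma cintegral_real (D : set E) (u v : E -> R) :
  cintegral D (fun x => u x +i* v x) = (\int[mu]_(x in D) u x) +i* (\int[mu]_(x in D) v x).
Proof. by []. Qed.

Lemma fourierE (f : E -> R[i]) xi : itg mu (re f) -> itg mu (im f) ->
  fourier f xi = (cosT (re f) xi + sinT (im f) xi) +i* (cosT (im f) xi - sinT (re f) xi).
Proof.
move=> ir ii; rewrite /fourier /cintegral; congr (_ +i* _).
- rewrite /cosT /sinT -RintegralDT; [|exact: integrable_cos_mul|exact: integrable_sin_mul].
  apply: eq_Rintegral => z _; rewrite /re /im (dotC xi).
  by case: (f z) => a b /=; rewrite cosN sinN; ring.
- rewrite /cosT /sinT -RintegralBT; [|exact: integrable_cos_mul|exact: integrable_sin_mul].
  apply: eq_Rintegral => z _; rewrite /re /im (dotC xi).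
  by case: (f z) => a b /=; rewrite cosN sinN; ring.
Qed.

Lemma fourier_ift k : real_schwartz k -> fourier (ift k) = (fun xi => (k xi)%:C).
Proof.
move=> sk; apply/funext => xi.
have ic := schwartz_integrable (cosT_schwartz sk).
have isn := schwartz_integrable (sinT_schwartz sk).
rewrite fourierE; [|by rewrite re_ift integrableEZl|by rewrite im_ift integrableEZl].
have kapK : kap * (2 * pi) ^+ d = 1.
  by rewrite mulVf// gt_eqF// exprn_gt0// mulr_gt0// pi_gt0.
have e1 : cosT (re (ift k)) xi + sinT (im (ift k)) xi = k xi.
  rewrite re_ift im_ift (cosTZ _ _ ic) (sinTZ _ _ isn) -mulrDr fourier_inversion_cos//.
  by rewrite mulrA kapK mul1r.
have e2 : cosT (im (ift k)) xi - sinT (re (ift k)) xi = 0.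
  rewrite re_ift im_ift (cosTZ _ _ isn) (sinTZ _ _ ic) -mulrBr fourier_inversion_sin//.
  by rewrite mulr0.
by rewrite e1 e2.
Qed.

Lemma bessel_ift s k : real_schwartz k ->
  bessel s (ift k) = ift (fun xi => jb xi `^ (s / 2) * k xi).
Proof.
move=> sk; rewrite /bessel fourier_ift// /ift; congr inverse_fourier.
by apply/funext => xi; rewrite rmorphM.
Qed.

Lemma cpartial_ift k i : real_schwartz k ->
  cpartial i (ift k) = (fun x : E => (- (kap * sinT (fun z : E => z ord0 i * k z) x))
     +i* (kap * cosT (fun z : E => z ord0 i * k z) x)).
Proof.
move=> sk; apply/funext => x; rewrite /cpartial re_ift im_ift.
have dE : (fun z : E => dot (e_ i) z * k z) = (fun z => z ord0 i * k z).
  by apply/funext => z; rewrite dot_deltal.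
have dc := is_derive_cosT sk x (e_ i); rewrite dE in dc.
have ds := is_derive_sinT sk x (e_ i); rewrite dE in ds.
congr (_ +i* _); last exact: (@derive_val _ _ _ _ _ _ _ (is_deriveZ kap ds)).
by rewrite -mulrN; exact: (@derive_val _ _ _ _ _ _ _ (is_deriveZ kap dc)).
Qed.

Lemma cmod_le (a b : R) : cmod (a +i* b) <= `|a| + `|b|.
Proof.
rewrite /cmod /= -(ger0_norm (addr_ge0 (normr_ge0 a) (normr_ge0 b))) -sqrtr_sqr.
rewrite ler_sqrt ?sqr_ge0// -[a ^+ 2]real_normK ?num_real// -[b ^+ 2]real_normK ?num_real//.
by have := normr_ge0 a; have := normr_ge0 b; nra.
Qed.

Lemma cmod_real (a : R) : cmod (a%:C) = `|a|.
Proof. by rewrite /cmod /= expr0n /= addr0 sqrtr_sqr. Qed.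

Lemma cmodM (z w : R[i]) : cmod (z * w) = cmod z * cmod w.
Proof. exact: ComplexField.Normc.normcM. Qed.

Lemma cmod_sub (z w : R[i]) : cmod z - cmod w <= cmod (z - w).
Proof.
rewrite lerBlDr -{1}(subrK w z); exact: (@le_normcD R (z - w) w).
Qed.

Lemma cmod_ge0 (z : R[i]) : 0 <= cmod z.
Proof. by case: z => a b; exact: sqrtr_ge0. Qed.

Lemma cmod_ift_le k x : itg mu k -> cmod (ift k x) <= 2 * kap * \int[mu]_z `|k z|.
Proof.
move=> ik; rewrite iftE; apply: le_trans (cmod_le _ _) _.
rewrite !normrM !(gtr0_norm kap_gt0) -mulrDr (mulrC 2) -mulrA ler_wpM2l ?(ltW kap_gt0)//.
by rewrite mulr_natl mulr2n lerD ?norm_cosT ?norm_sinT.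
Qed.

End complex_layer.
Arguments kap {R} d.

Section norms.
Context {R : realType} {d : nat}.
Local Notation E := 'rV[R]_d.
Local Notation mu := (@lebesgue_rV R d).

Lemma lebesgue_rV_setT_gt0 : (0 < mu setT)%E.
Proof.
apply: (@lt_le_trans _ _ (mu (box (fun _ : 'I_d => 0) (fun=> 1)))).
  by rewrite lebesgue_rV_box// lte_fin prodr_gt0// => i _; rewrite subr0.
by apply: le_measure => //; rewrite inE//; exact: measurable_box.
Qed.

Lemma Lpnorm_pinfty_le (f : E -> R[i]) (C : R) : (forall x, cmod (f x) <= C) ->
  (Lpnorm +oo f <= C%:E)%E.
Proof.
move=> fC; rewrite /Lpnorm unlock lebesgue_rV_setT_gt0.
apply/ess_supP; apply: nearW => x /=.
by rewrite lee_fin ger0_norm ?cmod_ge0.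
Qed.

Lemma Lpnorm_le (p : R) (f : E -> R[i]) (C : R) : 0 < p -> 0 <= C ->
  (\int[mu]_x (cmod (f x) `^ p)%:E <= (C `^ p)%:E)%E -> (Lpnorm p%:E f <= C%:E)%E.
Proof.
move=> p0 C0 h; rewrite /Lpnorm unlock.
apply: (@le_trans _ _ (((C `^ p)%:E) `^ p^-1)%E).
  apply: gt0_ler_poweR.
  - by rewrite invr_ge0 ltW.
  - by rewrite in_itv /= leey andbT; apply: integral_ge0 => x _; rewrite lee_fin powR_ge0.
  - by rewrite in_itv /= leey andbT lee_fin powR_ge0.
  - rewrite (eq_integral (fun x => (cmod (f x) `^ p)%:E))//.
    by move=> x _; rewrite /= ger0_norm ?cmod_ge0.
by rewrite poweR_EFin -powRrM divff ?gt_eqF// powRr1.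
Qed.

(** Chebyshev's inequality on a set of known measure. *)
Lemma Lpnorm_ge (p : R) (f : E -> R[i]) (c : R) (A : set E) (m : R) : 0 < p -> 0 <= c -> 0 <= m ->
  measurable A -> mu A = m%:E -> (forall x, A x -> c <= cmod (f x)) ->
  measurable_fun setT (fun x => cmod (f x)) ->
  ((c * m `^ p^-1)%:E <= Lpnorm p%:E f)%E.
Proof.
move=> p0 c0 m0 mA muA cf mf; rewrite /Lpnorm unlock.
apply: (@le_trans _ _ (((c `^ p * m)%:E) `^ p^-1)%E).
  by rewrite poweR_EFin lee_fin powRM ?powR_ge0// -powRrM divff ?gt_eqF// powRr1.
apply: gt0_ler_poweR.
- by rewrite invr_ge0 ltW.
- by rewrite in_itv /= leey andbT lee_fin mulr_ge0// powR_ge0.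
- by rewrite in_itv /= leey andbT; apply: integral_ge0 => x _; rewrite lee_fin powR_ge0.
rewrite (eq_integral (fun x => (cmod (f x) `^ p)%:E)); last first.
  by move=> x _; rewrite /= ger0_norm ?cmod_ge0.
rewrite EFinM -muA -integral_cst//.
have mfp : measurable_fun setT (fun x => (cmod (f x) `^ p)%:E).
  by apply/measurable_EFinP; exact: measurableT_comp (measurable_powR _) mf.
apply: (@le_trans _ _ (\int[mu]_(x in A) (cmod (f x) `^ p)%:E)%E).
  apply: ge0_le_integral => //.
  - by move=> x _; rewrite lee_fin powR_ge0.
  - exact: measurable_funS mfp.
  - move=> x Ax; rewrite lee_fin ge0_ler_powR ?nnegrE ?cmod_ge0 ?(ltW p0)//; exact: cf.
by apply: ge0_subset_integral => // x _; rewrite lee_fin powR_ge0.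
Qed.

End norms.

(** * Gamma integrals *)

Section exponential_integrals.
Context {R : realType}.
Local Notation leb := (@lebesgue_measure R).

Lemma expR_ge_sqr (x : R) : 0 <= x -> 1 + x ^+ 2 / 4 <= expR x.
Proof.
move=> x0; have -> : x = x / 2 + x / 2 by lra.
rewrite expRD; have := expR_ge1Dx (x / 2); move: (expR _) => e he.
have : (1 + x / 2) * (1 + x / 2) <= e * e by apply: ler_pM => //; lra.
nra.
Qed.

Lemma integrable_exp_decay (f : R -> R) (C g : R) : 0 < g ->
  measurable_fun setT f -> (forall v, `|f v| <= C * expR (- (g * `|v|))) -> itg leb f.
Proof.
move=> g0 mf fC.
have C0 : 0 <= C.
  by have := le_trans (normr_ge0 _) (fC 0); rewrite pmulr_lge0 ?expR_gt0.
apply: (@integrable_le _ (measurableTypeR R) R leb _ (fun v : R => C * (1 + 4 / g ^+ 2) * (1 + v ^+ 2)^-1)) => //.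
- move=> v; apply: le_trans (fC v) _; rewrite -mulrA ler_wpM2l// expRN.
  have v2 : 0 < 1 + v ^+ 2 by rewrite ltr_pwDl// sqr_ge0.
  rewrite ler_pdivlMr// mulrC ler_pdivrMr ?expR_gt0//.
  have := expR_ge_sqr (mulr_ge0 (ltW g0) (normr_ge0 v)).
  rewrite exprMn real_normK ?num_real// => h.
  have K0 : 0 <= 1 + 4 / g ^+ 2 by rewrite addr_ge0// divr_ge0// sqr_ge0.
  apply: le_trans (ler_wpM2l K0 h); rewrite -subr_ge0.
  have -> : (1 + 4 / g ^+ 2) * (1 + g ^+ 2 * v ^+ 2 / 4) - (1 + v ^+ 2) =
    4 / g ^+ 2 + g ^+ 2 * v ^+ 2 / 4 by field; rewrite gt_eqF.
  exact: addr_ge0 (divr_ge0 (ler0n _ 4) (sqr_ge0 _)) (divr_ge0 (mulr_ge0 (sqr_ge0 _) (sqr_ge0 _)) (ler0n _ 4)).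
- apply: integrableEZl; apply: (@ge0_integrable _ _ _ _ _ pi).
  + by apply: continuous_measurable_fun; exact: continuous_oneDsqrV.
  + by move=> v; rewrite invr_ge0 addr_ge0 ?sqr_ge0.
  + by rewrite integral_inv_oneDsqr.
Qed.

Lemma Rintegral_shift1 (c : R) (f : R -> R) : (forall v, 0 <= f v) -> measurable_fun setT f ->
  \int[leb]_v f (v + c) = \int[leb]_v f v.
Proof.
move=> f0 mf; congr fine.
apply: (@ge0_integral_shift _ c (fun v => (f v)%:E)); last by move=> v; rewrite lee_fin.
exact/measurable_EFinP.
Qed.

(** The density of [t = exp v] in Euler's integral for [Gamma beta]. *)
Definition gamma_dens (beta v : R) : R := expR (beta * v - expR v).

Lemma gamma_dens_gt0 beta v : 0 < gamma_dens beta v. Proof. exact: expR_gt0. Qed.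

Lemma measurable_gamma_dens beta : measurable_fun setT (gamma_dens beta).
Proof.
by apply: measurableT_comp => //; apply: measurable_funB.
Qed.

Lemma integrable_gamma_dens beta : 0 < beta -> itg leb (gamma_dens beta).
Proof.
move=> b0; apply: (@integrable_exp_decay _ (expR (4 * beta ^+ 2)) beta) => //.
  exact: measurable_gamma_dens.
move=> v; rewrite ger0_norm ?expR_ge0// -expRD ler_expR.
have [v0|v0] := lerP 0 v.
  rewrite (ger0_norm v0); have := expR_ge_sqr v0; have := sqr_ge0 (v - 4 * beta).
  by move: (expR v) => e; nra.
rewrite (ltr0_norm v0); have := expR_ge0 v; have := sqr_ge0 beta.
by move: (expR v) => e; nra.
Qed.

Definition gamma_mass beta : R := \int[leb]_v gamma_dens beta v.

Lemma gamma_mass_gt0 beta : 0 < beta -> 0 < gamma_mass beta.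
Proof.
move=> b0.
have h : (expR (- beta - expR 1)) * 1 <= gamma_mass beta.
  rewrite -lee_fin /gamma_mass -integral_fineE ?integrable_gamma_dens//.
  have -> : (expR (- beta - expR 1) * 1)%:E = (\int[leb]_(v in `[0%R, 1%R]) (expR (- beta - expR 1))%:E)%E.
    by rewrite integral_cst//= lebesgue_measure_itv/= lte01 oppr0 adde0 mule1 mulr1.
  apply: (@le_trans _ _ (\int[leb]_(v in `[0%R, 1%R]) (gamma_dens beta v)%:E)%E).
    apply: ge0_le_integral => //.
    - by apply/measurable_EFinP; apply: measurable_funTS; exact: measurable_gamma_dens.
    - move=> v; rewrite /= in_itv/= => /andP[v0 v1]; rewrite lee_fin ler_expR.
      apply: lerB; last by rewrite ler_expR.
      by rewrite (le_trans _ (mulr_ge0 (ltW b0) v0))// oppr_le0 ltW.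
  apply: ge0_subset_integral => //.
    by apply/measurable_EFinP; exact: measurable_gamma_dens.
  by move=> v _; rewrite lee_fin expR_ge0.
by apply: lt_le_trans h; rewrite mulr1 expR_gt0.
Qed.

(** Euler's integral after the substitution [t = exp v], where the dilation of
    [t] has become a translation of [v]. *)
Lemma subordination beta (a : R) : 0 < beta -> 0 < a ->
  \int[leb]_v (gamma_dens beta v * expR (- (expR v * (a - 1)))) =
  gamma_mass beta * a `^ (- beta).
Proof.
move=> b0 a0.
have -> : gamma_mass beta = \int[leb]_v gamma_dens beta (v + ln a).
  rewrite Rintegral_shift1//; last exact: measurable_gamma_dens.
  by move=> v; exact: ltW (gamma_dens_gt0 _ _).
rewrite [in RHS]mulrC.
have E v : gamma_dens beta (v + ln a) = a `^ beta * (gamma_dens beta v * expR (- (expR v * (a - 1)))).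
  rewrite /gamma_dens -expRD /powR gt_eqF// -expRD; congr expR.
  by rewrite expRD lnK ?posrE//; ring.
have i1 : itg leb (fun v => gamma_dens beta v * expR (- (expR v * (a - 1)))).
  have := integrable_gamma_dens b0; rewrite /itg => /integrableP[_ fin].
  apply: (@ge0_integrable _ _ _ _ _ ((a `^ beta)^-1 * gamma_mass beta)).
  - apply: measurable_funM; first exact: measurable_gamma_dens.
    apply: measurableT_comp => //; apply: measurableT_comp => //.
    exact: measurable_funM.
  - by move=> v; rewrite mulr_ge0 ?expR_ge0// ltW// gamma_dens_gt0.
  - rewrite EFinM /gamma_mass -integral_fineE ?integrable_gamma_dens//.
    rewrite -(@ge0_integral_shift _ (ln a) (EFin \o gamma_dens beta)); last 2 first.
    + by apply/measurable_EFinP; exact: measurable_gamma_dens.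
    + by move=> v; rewrite lee_fin ltW// gamma_dens_gt0.
    under [in leRHS]eq_integral => v _ do rewrite /= E EFinM.
    rewrite ge0_integralZl//; last 3 first.
    + apply/measurable_EFinP; apply: measurable_funM; first exact: measurable_gamma_dens.
      apply: measurableT_comp => //; apply: measurableT_comp => //.
      exact: measurable_funM.
    + by move=> v _; rewrite lee_fin mulr_ge0 ?expR_ge0// ltW// gamma_dens_gt0.
    + by rewrite lee_fin powR_ge0.
    by rewrite muleA -EFinM mulVf ?mul1e// gt_eqF ?powR_gt0.
under [in RHS]eq_Rintegral do rewrite E.
by rewrite RintegralZT// mulrA powRN mulVf ?mul1r// gt_eqF ?powR_gt0.
Qed.

End exponential_integrals.

(** * Bessel potentials of Gaussians *)

Section bessel_gauss.
Context {R : realType} {d : nat}.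
Local Notation E := 'rV[R]_d.
Local Notation mu := (@lebesgue_rV R d).
Local Notation leb := (@lebesgue_measure R).

Lemma expRN_le1 (x : R) : 0 <= x -> expR (- x) <= 1.
Proof. by move=> x0; rewrite -expR0 ler_expR oppr_le0. Qed.

(** The symbol of a Bessel potential of a Gaussian. *)
Definition bessel_gauss (beta q : R) (z : E) : R := jb z `^ (- beta) * gauss q z.

Lemma bessel_gaussE beta q : bessel_gauss beta q = bracket_gauss (- beta) q 0.
Proof. by apply/funext => z; rewrite /bracket_gauss subr0. Qed.

Lemma schwartz_bessel_gauss beta q : 0 < q -> real_schwartz (bessel_gauss beta q).
Proof. by rewrite bessel_gaussE; exact: schwartz_bracket_gauss. Qed.

Lemma bessel_gauss_ge0 beta q z : 0 <= bessel_gauss beta q z.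
Proof. by rewrite mulr_ge0 ?powR_ge0 ?gauss_ge0. Qed.

Section fixed_beta.
Variables (beta : R) (beta0 : 0 < beta) (q : R) (q0 : 0 < q).

Let qe (v : R) : 0 < q + 2 * expR v.
Proof. by rewrite addr_gt0// mulr_gt0// expR_gt0. Qed.

Lemma gauss_subordinate v (z : E) :
  gauss (q + 2 * expR v) z = gauss q z * expR (- (expR v * (jb z - 1))).
Proof. by rewrite /gauss /jb -expRD; congr expR; field. Qed.

(** A negative power of [jb] is an average of Gaussians, so that a Bessel
    potential of a Gaussian inherits the positivity and the evenness of
    Gaussian transforms. *)
Lemma bessel_gauss_subordinate (z : E) :
  gamma_mass beta * bessel_gauss beta q z =
  \int[leb]_v (gamma_dens beta v * gauss (q + 2 * expR v) z).
Proof.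
rewrite /bessel_gauss mulrA -subordination ?jb_gt0//.
rewrite mulrC -RintegralZT.
  by apply: eq_Rintegral => v _; rewrite gauss_subordinate; ring.
apply: (@integrable_le _ (measurableTypeR R) R leb _ (gamma_dens beta)).
- apply: measurable_funM; first exact: measurable_gamma_dens.
  apply: measurableT_comp => //; apply: measurableT_comp => //.
  exact: measurable_funM.
- move=> v; rewrite ger0_norm ?mulr_ge0 ?expR_ge0 ?(ltW (gamma_dens_gt0 _ _))//.
  rewrite ler_piMr ?(ltW (gamma_dens_gt0 _ _))// expRN_le1//.
  by apply: mulr_ge0; [exact: expR_ge0|rewrite subr_ge0 jb_ge1].
- exact: integrable_gamma_dens.
Qed.

Lemma transform_subordinate (phi : R -> R) (x : E) :
  measurable_fun setT phi -> (forall a, `|phi a| <= 1) ->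
  gamma_mass beta * \int[mu]_z (phi (dot x z) * bessel_gauss beta q z) =
  \int[leb]_v (gamma_dens beta v * \int[mu]_z (phi (dot x z) * gauss (q + 2 * expR v) z)).
Proof.
move=> mphi phi1.
have ip k : itg mu k -> itg mu (fun z => phi (dot x z) * k z).
  apply: (@integrable_bounded_mul _ _ _ _ _ _ 1) => //.
  exact: measurableT_comp mphi (measurable_dotr x).
pose H (z : E * measurableTypeR R) : R :=
  phi (dot x z.1) * (gamma_dens beta z.2 * gauss (q + 2 * expR z.2) z.1).
rewrite -RintegralZT; last exact: ip (schwartz_integrable (schwartz_bessel_gauss _ q0)).
have isub z : itg leb (fun v => gamma_dens beta v * gauss (q + 2 * expR v) z).
  apply: (@integrable_le _ (measurableTypeR R) R leb _ (gamma_dens beta)).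
  - apply: measurable_funM; first exact: measurable_gamma_dens.
    apply: measurableT_comp => //; apply: measurableT_comp => //.
    apply: measurable_funM => //; apply: measurable_funM => //.
    by apply: measurable_funD => //; exact: measurable_funM.
  - move=> v; rewrite ger0_norm ?mulr_ge0 ?expR_ge0 ?(ltW (gamma_dens_gt0 _ _))//.
    by rewrite ler_piMr ?(ltW (gamma_dens_gt0 _ _))// gauss_le1// ltW.
  - exact: integrable_gamma_dens.
rewrite (@eq_Rintegral _ _ _ mu setT (fun z => \int[leb]_v H (z, v))); last first.
  move=> z _; rewrite mulrCA bessel_gauss_subordinate -RintegralZT//.
have := @Rintegral_swap _ _ _ _ R mu leb (@sigma_finite_lebesgue_rV R d) (sigma_finiteT leb)
  H (gauss q) (gamma_dens beta).
move=> ->.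
- apply: eq_Rintegral => v _; rewrite -RintegralZT; last exact: ip (integrable_gauss (qe v)).
  by apply: eq_Rintegral => z _; rewrite /H /= mulrCA.
- apply: measurable_funM.
    apply: measurableT_comp mphi _; apply: measurableT_comp (measurable_dotr x) _.
    exact: measurable_fst.
  apply: measurable_funM.
    exact: measurableT_comp (measurable_gamma_dens beta) measurable_snd.
  apply: measurableT_comp => //; apply: measurableT_comp => //.
  apply: measurable_funM => //; apply: measurable_funM.
    apply: measurable_funD => //; apply: measurable_funM => //.
    by apply: measurableT_comp => //; exact: measurable_snd.
  by apply: measurable_dot; exact: measurable_fst.
- exact: integrable_gauss.
- exact: integrable_gamma_dens.
- move=> z v; rewrite /H /= !normrM (gtr0_norm (gamma_dens_gt0 _ _)) (ger0_norm (gauss_ge0 _ _)).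
  apply: (@le_trans _ _ (1 * (gamma_dens beta v * gauss q z))).
    have g0 := ltW (gamma_dens_gt0 beta v).
    apply: ler_pM (normr_ge0 _) (mulr_ge0 g0 (gauss_ge0 _ _)) (phi1 _) _.
    rewrite ler_wpM2l ?(ltW (gamma_dens_gt0 _ _))// gauss_subordinate.
    rewrite ler_piMr ?gauss_ge0// expRN_le1//.
    by apply: mulr_ge0; [exact: expR_ge0|rewrite subr_ge0 jb_ge1].
  by rewrite mul1r mulrC.
Qed.

Lemma cosT_bessel_gauss_ge0 (x : E) : 0 <= cosT (bessel_gauss beta q) x.
Proof.
have := transform_subordinate x measurable_cos (@cos_max R).
rewrite -/(cosT _ _) => h; rewrite -(pmulr_rge0 _ (gamma_mass_gt0 beta0)) h.
apply: Rintegral_ge0 => v _; rewrite mulr_ge0 ?(ltW (gamma_dens_gt0 _ _))//.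
by rewrite -/(cosT _ _) cosT_gauss// mulr_ge0 ?exprn_ge0 ?gauss_ge0.
Qed.

Lemma sinT_bessel_gauss (x : E) : sinT (bessel_gauss beta q) x = 0.
Proof.
have := transform_subordinate x measurable_sin (@sin_max R).
rewrite -/(sinT _ _) (@eq_Rintegral _ _ _ leb setT (fun=> 0)); last first.
  by move=> v _; rewrite -/(sinT _ _) sinT_gauss// mulr0.
rewrite [RHS]/Rintegral integral0 => /eqP; rewrite mulf_eq0 => /orP[|/eqP//].
by rewrite gt_eqF// gamma_mass_gt0.
Qed.

Lemma int_bessel_gauss :
  gamma_mass beta * \int[mu]_z bessel_gauss beta q z =
  \int[leb]_v (gamma_dens beta v * Num.sqrt (2 * pi / (q + 2 * expR v)) ^+ d).
Proof.
have := transform_subordinate 0 measurable_cos (@cos_max R).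
rewrite -/(cosT _ _) cosT0 => ->; apply: eq_Rintegral => v _.
by rewrite -/(cosT _ _) cosT0 Rintegral_gauss.
Qed.

End fixed_beta.

(** The profile of the subordinated integral after the translation [v - ln q],
    which extracts the power of [q]. *)
Let prof (beta v : R) : R := expR (beta * v) * Num.sqrt (2 * pi / (1 + 2 * expR v)) ^+ d.

Let prof_ge0 beta v : 0 <= prof beta v.
Proof. by rewrite mulr_ge0 ?expR_ge0 ?exprn_ge0. Qed.

Let measurable_prof beta : measurable_fun setT (prof beta).
Proof.
apply: measurable_funM; first by apply: measurableT_comp => //; exact: measurable_funM.
apply: measurable_funX; rewrite (_ : (fun v => _) = (fun v => Num.sqrt (2 * pi) * (1 + 2 * expR v) `^ (- 2^-1))).
  apply: measurable_funM => //; apply: measurableT_comp (measurable_powR _) _.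
  by apply: measurable_funD => //; exact: measurable_funM.
apply/funext => v; have pi0 := pi_gt0 R; have e0 := expR_gt0 v.
rewrite sqrtrM; last by lra.
by rewrite sqrtrV ?powRN ?powR12_sqrt//; lra.
Qed.

Let prof_decay beta v : 0 < beta -> 2 * beta < d%:R ->
  prof beta v <= Num.sqrt (2 * pi) ^+ d * expR (- (Num.min beta (d%:R / 2 - beta) * `|v|)).
Proof.
move=> b0 bd; set g := Num.min _ _; have pi0 := pi_gt0 R.
have gb : g <= beta by rewrite ge_min lexx.
have gd : g <= d%:R / 2 - beta by rewrite ge_min lexx orbT.
rewrite /prof; have [v0|v0] := lerP v 0.
  rewrite (ler0_norm v0) mulrC; apply: ler_pM; rewrite ?exprn_ge0 ?expR_ge0//.
    rewrite lerXn2r ?nnegrE// ler_sqrt; last by lra.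
    by rewrite ler_pdivrMr; have := expR_gt0 v; nra.
  by rewrite ler_expR; nra.
rewrite (gtr0_norm v0) mulrC.
apply: (@le_trans _ _ ((Num.sqrt (2 * pi) * expR (- (v / 2))) ^+ d * expR (beta * v))).
  rewrite ler_wpM2r ?expR_ge0// lerXn2r ?nnegrE ?mulr_ge0 ?expR_ge0//.
  rewrite -[expR (- (v / 2))]ger0_norm ?expR_ge0// -sqrtr_sqr -sqrtrM; last by lra.
  rewrite ler_sqrt ?mulr_ge0 ?sqr_ge0//; last by lra.
  rewrite -expRM_natl (_ : 2 * - (v / 2) = - v); last by field.
  rewrite expRN ler_pM2l; last by lra.
  rewrite lef_pV2 ?posrE; have := expR_gt0 v; lra.
rewrite exprMn -mulrA ler_wpM2l ?exprn_ge0// -expRM_natl -expRD ler_expR.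
by nra.
Qed.

(** The translation of [v] by [ln q] extracts the power of [q]. The profile
    that remains is integrable at minus infinity because [beta] is positive,
    and at plus infinity because [2 beta < d]. *)
Lemma int_bessel_gauss_le beta : 0 < beta -> 2 * beta < d%:R ->
  exists2 K, 0 <= K & forall q : R, 0 < q ->
    \int[mu]_z bessel_gauss beta q z <= K * q `^ beta * (Num.sqrt q ^+ d)^-1.
Proof.
move=> b0 bd; have M0 := gamma_mass_gt0 b0; have pi0 := pi_gt0 R.
have g0 : 0 < Num.min beta (d%:R / 2 - beta) by rewrite lt_min b0 subr_gt0; lra.
have iprof c : itg leb (fun v => prof beta (v + c)).
  apply: (@integrable_exp_decay _ _ (Num.sqrt (2 * pi) ^+ d * expR (Num.min beta (d%:R / 2 - beta) * `|c|)) _ g0).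
    apply: measurableT_comp (measurable_prof beta) _.
    by apply: (@measurable_funD _ _ R _ (fun x => x) (cst c)).
  move=> v; rewrite ger0_norm//; apply: le_trans (prof_decay _ b0 bd) _.
  rewrite -mulrA ler_wpM2l ?exprn_ge0// -expRD ler_expR -mulrN -mulrN -mulrDr ler_wpM2l ?(ltW g0)//.
  by have := ler_normB (v + c) c; rewrite addrK; lra.
exists ((gamma_mass beta)^-1 * \int[leb]_v prof beta v).
  by rewrite mulr_ge0 ?invr_ge0 ?(ltW M0)//; apply: Rintegral_ge0.
move=> q q0.
have sq0 : 0 < Num.sqrt q by rewrite sqrtr_gt0.
pose S v := Num.sqrt (2 * pi / (q + 2 * expR v)) ^+ d.
have S0 v : 0 <= S v by rewrite exprn_ge0.
pose c := q `^ beta / Num.sqrt q ^+ d.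
have E v : c * prof beta (v - ln q) = expR (beta * v) * S v.
  have qe : 0 < q + 2 * expR v by rewrite addr_gt0// mulr_gt0// expR_gt0.
  rewrite /c /prof /S /powR gt_eqF// expRB lnK ?posrE// mulrBr expRB.
  rewrite (_ : 2 * pi / (1 + 2 * (expR v / q)) = q * (2 * pi / (q + 2 * expR v))); last first.
    by field; rewrite !gt_eqF//; lra.
  rewrite sqrtrM ?(ltW q0)// exprMn; field.
  by rewrite !gt_eqF ?exprn_gt0 ?expR_gt0.
have i2 : itg leb (fun v => c * prof beta (v - ln q)) by apply: integrableEZl; exact: iprof.
have gS v : gamma_dens beta v * S v <= c * prof beta (v - ln q).
  by rewrite E ler_wpM2r// ler_expR lerBlDr lerDl expR_ge0.
have h : gamma_mass beta * \int[mu]_z bessel_gauss beta q z <= c * \int[leb]_v prof beta v.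
  rewrite int_bessel_gauss// -(Rintegral_shift1 (- ln q) (prof_ge0 beta) (measurable_prof beta)).
  rewrite -RintegralZT; last exact: iprof.
  apply: le_Rintegral => //.
  apply: (@integrable_le _ (measurableTypeR R) R leb _ (fun v => c * prof beta (v - ln q))) => //.
    apply: measurable_funM; first exact: measurable_gamma_dens.
    rewrite (_ : (fun v => _) = (fun v => expR (- (beta * v)) * (c * prof beta (v - ln q)))).
      apply: measurable_funM; last exact: integrable_measurable i2.
      by apply: measurableT_comp => //; apply: measurableT_comp => //; exact: measurable_funM.
    by apply/funext => v; rewrite E mulrA -expRD addNr expR0 mul1r.
  by move=> v; rewrite ger0_norm; [exact: gS|exact: mulr_ge0 (ltW (gamma_dens_gt0 _ _)) (S0 v)].
rewrite -mulrA -/c -mulrA ler_pdivlMl//.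
by rewrite [X in _ <= X]mulrC.
Qed.

End bessel_gauss.

(** * Two inequalities for geometric sums *)

Section sums.
Context {R : realType}.

Lemma one_sub_powR_le (p u : R) : 0 <= u <= 1 ->
  1 - u `^ p <= (Num.truncn p).+1%:R * (1 - u).
Proof.
move=> /andP[u0 u1]; set k := (Num.truncn p).+1.
have pk : p <= k%:R by apply/ltW/truncnS_gt.
have : u ^+ k <= u `^ p.
  have [->|un0] := eqVneq u 0; first by rewrite expr0n/= powR_ge0.
  by rewrite -powR_mulrn// ger_powR// lt_neqAle eq_sym un0 u0.
suff : 1 - u ^+ k <= k%:R * (1 - u) by lra.
elim: k {pk} => [|k IH]; first by rewrite expr0 mul0r subrr.
have := exprn_ge0 k u0; have : u ^+ k <= 1 by exact: exprn_ile1.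
by rewrite exprS -natr1; nra.
Qed.

Lemma powR_sub_le (p S T : R) : 1 < p -> 0 <= S <= T ->
  T `^ p - S `^ p <= (Num.truncn p).+1%:R * (T - S) * T `^ (p - 1).
Proof.
move=> p1 /andP[S0 ST]; have [T0|T0] := eqVneq T 0.
  have -> : S = 0 by lra.
  by rewrite T0 !subrr mulr0 mul0r.
have T1 : 0 < T by rewrite lt_neqAle eq_sym T0/=; lra.
have u01 : 0 <= S / T <= 1 by rewrite divr_ge0 ?(ltW T1)//= ler_pdivrMr// mul1r.
have := one_sub_powR_le p u01.
have -> : S `^ p = (S / T) `^ p * T `^ p.
  by rewrite -powRM ?divrK ?unitfE// ?(ltW T1)//; case/andP: u01.
have -> : T `^ p = T * T `^ (p - 1).
  by rewrite -{2}(powRr1 (ltW T1)) -powRD ?T0 ?implybT//; congr (_ `^ _); ring.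
have T2 : 0 < T `^ (p - 1) by exact: powR_gt0.
move=> /(ler_wpM2r (ltW (mulr_gt0 T1 T2))).
set X := T `^ (p - 1); set k : R := (Num.truncn p).+1%:R.
rewrite (_ : k * (1 - S / T) * (T * X) = k * (T - S) * X); last by field.
by rewrite mulrBl mul1r.
Qed.

Lemma geometric_sum_le (rho : R) n : 1 < rho ->
  \sum_(j < n.+1) rho ^+ j <= rho / (rho - 1) * rho ^+ n.
Proof.
move=> r1; have r0 : 0 < rho - 1 by lra.
have := subrX1 rho n.+1.
rewrite mulrAC ler_pdivlMr// mulrC => <-; rewrite -exprS.
by have := exprn_ge0 n.+1 (ltW (lt_trans ltr01 r1)); lra.
Qed.

(** As the weights grow geometrically, a partial sum is at most comparable
    with its last weight; hence adding the term of index [j] increases the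
    [p]-th power of the sum by at most a multiple of [(rho ^ p) ^ j * x j]. *)
Lemma power_sum_le (p rho : R) : 1 < p -> 1 < rho ->
  exists2 C, 0 <= C & forall (x : nat -> R) n, (forall j, 0 <= x j <= 1) ->
  (\sum_(j < n) rho ^+ j * x j) `^ p <= C * \sum_(j < n) (rho `^ p) ^+ j * x j.
Proof.
move=> p1 r1; have r0 : 0 < rho by lra.
set L := rho / (rho - 1); have L0 : 0 < L by rewrite divr_gt0//; lra.
set k : R := (Num.truncn p).+1%:R.
exists (k * L `^ (p - 1)); first by rewrite mulr_ge0 ?powR_ge0.
move=> x n x01; elim: n => [|n IH].
  by rewrite !big_ord0 powR0 ?mulr0//; lra.
rewrite !big_ord_recr/= mulrDr.
set S := \sum_(j < n) _; set a := rho ^+ n * x n.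
have a0 : 0 <= a by rewrite mulr_ge0 ?exprn_ge0 ?(ltW r0)//; case/andP: (x01 n).
have S0 : 0 <= S.
  apply: sumr_ge0 => j _; rewrite mulr_ge0 ?exprn_ge0 ?(ltW r0)//.
  by case/andP: (x01 j).
have ST : 0 <= S <= S + a by rewrite S0 lerDl.
have := powR_sub_le p1 ST.
rewrite lerBlDr => /le_trans; apply; rewrite addrC; apply: lerD => //.
rewrite (addrC S) addrK (addrC a).
have TL : S + a <= L * rho ^+ n.
  apply: le_trans (geometric_sum_le n r1); rewrite big_ord_recr/=.
  apply: lerD; first apply: ler_sum => j _.
    by rewrite ler_piMr ?exprn_ge0 ?(ltW r0)//; case/andP: (x01 j).
  by rewrite ler_piMr ?exprn_ge0 ?(ltW r0)//; case/andP: (x01 n).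
have : (S + a) `^ (p - 1) <= (L * rho ^+ n) `^ (p - 1).
  by rewrite ge0_ler_powR ?nnegrE//; [lra|lra|rewrite mulr_ge0 ?exprn_ge0 ?(ltW r0) ?(ltW L0)].
have k0 : 0 <= k by rewrite /k ler0n.
move=> /(ler_wpM2l (mulr_ge0 k0 a0)) /le_trans; apply.
have -> : (rho `^ p) ^+ n = rho ^+ n * (rho ^+ n) `^ (p - 1).
  rewrite -!powR_mulrn ?powR_ge0 ?(ltW r0)// -!powRrM -powRD ?(gt_eqF r0) ?implybT//.
  by congr (_ `^ _); ring.
rewrite powRM ?exprn_ge0 ?(ltW r0) ?(ltW L0)// /a.
by rewrite le_eqVlt; apply/orP; left; apply/eqP; ring.
Qed.

(** The summands are the increments of [t / (1 + t)] along the geometric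
    progression, up to a factor that depends only on its ratio. *)
Lemma two_sided_geometric_sum (h t : R) n : 1 < h -> 0 < t ->
  \sum_(j < n) Num.min (h ^+ j * t) (h ^+ j * t)^-1 <= 2 * (1 + h) / (h - 1).
Proof.
move=> h1 t0; set L := 2 * (1 + h) / (h - 1).
have h0 : 0 < h - 1 by lra.
pose phi j := h ^+ j * t / (1 + h ^+ j * t).
have L0 : 0 <= L by rewrite /L divr_ge0//; lra.
have u0 j : 0 < h ^+ j * t by rewrite mulr_gt0// exprn_gt0//; lra.
suff : \sum_(j < n) Num.min (h ^+ j * t) (h ^+ j * t)^-1 <= L * (phi n - phi 0).
  move=> /le_trans; apply; rewrite ler_piMr//.
  have : phi n <= 1 by rewrite /phi ler_pdivrMr; have := u0 n; lra.
  have : 0 <= phi 0 by rewrite /phi divr_ge0 ?(ltW (u0 _))//; have := u0 0; lra.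
  by lra.
elim: n => [|n IH]; first by rewrite big_ord0 subrr mulr0.
rewrite big_ord_recr/=.
suff : Num.min (h ^+ n * t) (h ^+ n * t)^-1 <= L * (phi n.+1 - phi n).
  by move: IH; rewrite !mulrBr; lra.
rewrite /phi exprS -!(mulrA h); move: (u0 n); set u := h ^+ n * t => {}u0.
have u1 : 0 < 1 + u by lra.
have u2 : 0 < 1 + h * u by nra.
have -> : L * (h * (u / (1 + h * u)) - u / (1 + u)) = 2 * (1 + h) * u / ((1 + u) * (1 + h * u)).
  by rewrite /L; field; rewrite !gt_eqF.
rewrite ler_pdivlMr ?mulr_gt0//; have [u1'|u1'] := lerP u 1.
  apply: (@le_trans _ _ (u * ((1 + u) * (1 + h * u)))).
    by apply: ler_wpM2r; [nra|rewrite ge_min lexx].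
  rewrite [leRHS]mulrC; apply: ler_wpM2l; first exact: ltW.
  by apply: ler_pM; nra.
apply: (@le_trans _ _ (u^-1 * ((1 + u) * (1 + h * u)))).
  by apply: ler_wpM2r; [nra|rewrite ge_min lexx orbT].
rewrite mulrC ler_pdivrMr//.
rewrite (_ : 2 * (1 + h) * u * u = (2 * u) * ((1 + h) * u)); last by ring.
by apply: ler_pM; nra.
Qed.

End sums.

(** * Finite sums, translations and mean oscillation *)

Section finite_sums.
Context {R : realType} {d : nat}.
Local Notation E := 'rV[R]_d.
Local Notation mu := (@lebesgue_rV R d).
Variables (k : nat -> E -> R) (sk : forall j, real_schwartz (k j)).

Lemma schwartz_sum n : real_schwartz (fun z => \sum_(j < n) k j z).
Proof.
elim: n => [|n IH].
  rewrite (_ : (fun z => _) = (fun z : E => 0 * k 0%N z)); first exact: schwartzZ.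
  by apply/funext => z; rewrite big_ord0 mul0r.
rewrite (_ : (fun z => _) = (fun z : E => \sum_(j < n) k j z + k n z)); first exact: schwartzD.
by apply/funext => z; rewrite big_ord_recr.
Qed.

Lemma transform_sum (T : (E -> R) -> E -> R) x n :
  (forall f g, itg mu f -> itg mu g -> T (fun z => f z + g z) x = T f x + T g x) ->
  (forall c f, itg mu f -> T (fun z => c * f z) x = c * T f x) ->
  T (fun z => \sum_(j < n) k j z) x = \sum_(j < n) T (k j) x.
Proof.
move=> TD TZ; elim: n => [|n IH].
  rewrite (_ : (fun z => _) = (fun z : E => 0 * k 0%N z)).
    by rewrite TZ ?mul0r ?big_ord0//; exact: schwartz_integrable.
  by apply/funext => z; rewrite big_ord0 mul0r.
rewrite big_ord_recr/= -IH -TD; last 2 first.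
- exact/schwartz_integrable/schwartz_sum.
- exact: schwartz_integrable.
by congr (T _ x); apply/funext => z; rewrite big_ord_recr.
Qed.

Lemma cosT_sum n x : cosT (fun z => \sum_(j < n) k j z) x = \sum_(j < n) cosT (k j) x.
Proof. by apply: (@transform_sum cosT) => *; [exact: cosTD|exact: cosTZ]. Qed.

Lemma sinT_sum n x : sinT (fun z => \sum_(j < n) k j z) x = \sum_(j < n) sinT (k j) x.
Proof. by apply: (@transform_sum sinT) => *; [exact: sinTD|exact: sinTZ]. Qed.

End finite_sums.

Section translation.
Context {R : realType} {d : nat}.
Local Notation E := 'rV[R]_d.
Local Notation mu := (@lebesgue_rV R d).

Section integrable.
Variables (k : E -> R) (ik : itg mu k) (c x : E).

Let ic : itg mu (fun z => cos (dot x z) * k z).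
Proof. exact: integrable_cos_mul. Qed.
Let isn : itg mu (fun z => sin (dot x z) * k z).
Proof. exact: integrable_sin_mul. Qed.

Lemma cosT_shift : cosT (fun z => k (z - c)) x =
  cos (dot x c) * cosT k x - sin (dot x c) * sinT k x.
Proof.
rewrite /cosT /sinT -!RintegralZT// -RintegralBT; try exact: integrableEZl.
rewrite -(Rintegral_shift (- c) (integrableEB (integrableEZl _ ic) (integrableEZl _ isn))).
apply: eq_Rintegral => z _ /=; have -> : dot x z = dot x (z - c) + dot x c by rewrite dotBr subrK.
by rewrite cosD; ring.
Qed.

Lemma sinT_shift : sinT (fun z => k (z - c)) x =
  sin (dot x c) * cosT k x + cos (dot x c) * sinT k x.
Proof.
rewrite /cosT /sinT -!RintegralZT// -RintegralDT; try exact: integrableEZl.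
rewrite -(Rintegral_shift (- c) (integrableED (integrableEZl _ ic) (integrableEZl _ isn))).
apply: eq_Rintegral => z _ /=; have -> : dot x z = dot x (z - c) + dot x c by rewrite dotBr subrK.
by rewrite sinD; ring.
Qed.

End integrable.

Section gaussian.
Variables (b : R) (b0 : 0 < b) (c : E).

Lemma schwartz_gauss_shift : real_schwartz (fun z => gauss b (z - c)).
Proof.
rewrite (_ : (fun z => _) = bracket_gauss 0 b c); first exact: schwartz_bracket_gauss.
by apply/funext => z; rewrite /bracket_gauss powRr0 mul1r.
Qed.

Lemma cosT_gauss_shift x :
  cosT (fun z => gauss b (z - c)) x = cos (dot x c) * cosT (gauss b) x.
Proof. by rewrite cosT_shift ?sinT_gauss ?mulr0 ?subr0//; exact: integrable_gauss. Qed.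

Lemma sinT_gauss_shift x :
  sinT (fun z => gauss b (z - c)) x = sin (dot x c) * cosT (gauss b) x.
Proof. by rewrite sinT_shift ?sinT_gauss ?mulr0 ?addr0//; exact: integrable_gauss. Qed.

End gaussian.
End translation.

Section mean_oscillation.
Context {R : realType} {d : nat}.
Local Notation E := 'rV[R]_d.
Local Notation mu := (@lebesgue_rV R d).

Lemma cubeE (c : E) r : cube c r = box (fun i => c ord0 i) (fun i => c ord0 i + r).
Proof. by []. Qed.

Lemma measurable_cube (c : E) r : measurable (cube c r).
Proof. exact: measurable_box. Qed.

Lemma lebesgue_cube (c : E) r : 0 < r -> mu (cube c r) = (r ^+ d)%:E.
Proof.
move=> r0; rewrite cubeE lebesgue_rV_box; last by move=> i; rewrite lerDl ltW.
by under eq_bigr do rewrite addrAC subrr add0r; rewrite prodr_const card_ord.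
Qed.

Lemma integrable_on_cube (h : E -> R) (c : E) r : itg mu h ->
  mu.-integrable (cube c r) (EFin \o h).
Proof. by move=> ih; apply: integrableS ih => //; exact: measurable_cube. Qed.

Lemma integrable_cst_cube a (c : E) r : 0 < r ->
  mu.-integrable (cube c r) (EFin \o (fun _ : E => a)).
Proof.
move=> r0; apply/integrableP; split; first exact: measurable_cst.
rewrite integral_cst ?lebesgue_cube//; first by rewrite -EFinM ltry.
exact: measurable_cube.
Qed.

(** The average lies within [B] of [a], so replacing one by the other costs a
    factor two. *)
Lemma mean_oscillation_le (h : E -> R) (c : E) (r a B : R) : 0 < r -> itg mu h ->
  \int[mu]_(y in cube c r) `|h y - a| <= r ^+ d * B ->
  (mean_oscillation (cube c r) (fun x => (h x)%:C) <= (2 * B)%:E)%E.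
Proof.
move=> r0 ih hB; set Q := cube c r.
have mQ : measurable Q by exact: measurable_cube.
have rd : 0 < r ^+ d by exact: exprn_gt0.
have ihQ : mu.-integrable Q (EFin \o h) by exact: integrable_on_cube.
have ia b : mu.-integrable Q (EFin \o (fun _ : E => b)) by exact: integrable_cst_cube.
have isub b : mu.-integrable Q (EFin \o (fun y => h y - b)) by exact: (integrableB mQ ihQ (ia b)).
have inorm b : mu.-integrable Q (EFin \o (fun y => `|h y - b|)) by exact: (integrable_norm (isub b)).
have I b : \int[mu]_(y in Q) b = b * r ^+ d.
  by rewrite Rintegral_cst// lebesgue_cube.
set m := (r ^+ d)^-1 * \int[mu]_(y in Q) h y.
have aE : average Q (fun x => (h x)%:C) = m%:C.
  have -> : average Q (fun x => (h x)%:C) = ((r ^+ d)^-1)%:C * (\int[mu]_(y in Q) h y)%:C.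
    by rewrite /average lebesgue_cube// cintegral_real I mul0r.
  by rewrite -rmorphM.
have am : `|a - m| <= B.
  have E : r ^+ d * (m - a) = \int[mu]_(y in Q) (h y - a).
    by rewrite RintegralB// I /m mulrBr mulVKf ?gt_eqF// [a * _]mulrC.
  rewrite distrC -(ler_pM2l rd) -[X in X * `|_|]gtr0_norm// -normrM E.
  by apply: le_trans hB; apply: le_normr_Rintegral.
have : \int[mu]_(y in Q) `|h y - m| <= 2 * B * r ^+ d.
  apply: (@le_trans _ _ (\int[mu]_(y in Q) (`|h y - a| + `|a - m|))).
    apply: le_Rintegral => //; first exact: (integrableD mQ (inorm a) (ia _)).
    by move=> y _; rewrite (le_trans _ (ler_normD _ _))// addrA subrK.
  rewrite RintegralD// I; have := ler_wpM2r (ltW rd) am; lra.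
move=> hm; rewrite /mean_oscillation aE lebesgue_cube// [fine _]/=.
rewrite (eq_integral (fun y => `|h y - m|%:E)) => [|y _]; last by rewrite -cmod_real rmorphB.
have -> : (\int[mu]_(y in Q) (`|h y - m|)%:E)%E = (\int[mu]_(y in Q) `|h y - m|)%:E.
  by rewrite fineK//; exact: (integrable_fin_num mQ (inorm m)).
by rewrite -EFinM lee_fin ler_pdivrMl// mulrC.
Qed.

End mean_oscillation.

(** * Dyadic blocks *)

Section blocks.
Context {R : realType} {d : nat}.
Local Notation E := 'rV[R]_d.
Local Notation mu := (@lebesgue_rV R d).
Variables (sg : R) (sg0 : 0 < sg).

Let beta : R := sg / 2.
Let rho : R := 2 `^ sg.
Let q (j : nat) : R := (4 ^+ j)^-1.
Let w (j : nat) : R := (rho / 2 ^+ d) ^+ j.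

(** The block lives at frequencies of size at most [2 ^ j], and the weight
    gives it an integral of order one; its image under the Bessel potential of
    order [sg] is an exact Gaussian. *)
Definition block (j : nat) (z : E) : R :=
  (2 `^ sg / 2 ^+ d) ^+ j * bessel_gauss (sg / 2) (4 ^+ j)^-1 z.

Let blockE j z : block j z = w j * bessel_gauss beta (q j) z.
Proof. by []. Qed.

Let beta0 : 0 < beta. Proof. by rewrite divr_gt0. Qed.
Let rho0 : 0 < rho. Proof. by rewrite powR_gt0. Qed.
Let q0 j : 0 < q j. Proof. by rewrite invr_gt0 exprn_gt0. Qed.
Let w0 j : 0 < w j. Proof. by rewrite exprn_gt0// divr_gt0// exprn_gt0. Qed.

Let sqrt_q j : Num.sqrt (q j) = (2 ^+ j)^-1.
Proof.
rewrite /q (_ : 4 = 2 ^+ 2); last by ring.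
by rewrite -exprM mulnC exprM -exprVn sqrtr_sqr ger0_norm// invr_ge0 exprn_ge0.
Qed.

Let q_beta j : q j `^ beta = (rho ^+ j)^-1.
Proof.
rewrite /q -powR_inv1 ?exprn_ge0// -powRrM (_ : 4 = 2 `^ 2); last by rewrite powR_mulrn//; ring.
rewrite -[(2 `^ 2) ^+ j]powR_mulrn ?powR_ge0// -!powRrM.
rewrite -powR_inv1 ?exprn_ge0 ?powR_ge0// -[rho ^+ j]powR_mulrn ?powR_ge0// -!powRrM.
by congr (_ `^ _); rewrite /beta; field.
Qed.

Lemma schwartz_block j : real_schwartz (block j).
Proof. by apply: schwartzZ; exact: schwartz_bessel_gauss. Qed.

Lemma block_ge0 j z : 0 <= block j z.
Proof. by rewrite mulr_ge0 ?bessel_gauss_ge0// ltW. Qed.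

Lemma blockN j z : block j (- z) = block j z.
Proof. by rewrite /block /bessel_gauss /gauss /jb dotNl dotNr opprK. Qed.

Let ibg b r : 0 < r -> itg mu (bessel_gauss b r).
Proof. by move=> r0; apply/schwartz_integrable/schwartz_bessel_gauss. Qed.

Lemma cosT_block_ge0 j x : 0 <= cosT (block j) x.
Proof.
rewrite /block cosTZ; last by apply: ibg; exact: q0.
by rewrite mulr_ge0 ?cosT_bessel_gauss_ge0 ?q0// (ltW (w0 j)).
Qed.

Lemma sinT_block j x : sinT (block j) x = 0.
Proof.
rewrite /block sinTZ; last by apply: ibg; exact: q0.
by rewrite sinT_bessel_gauss ?mulr0 ?q0.
Qed.

(** At frequency zero all the blocks have the same size. *)
Lemma int_block_ge j : Num.sqrt (2 * pi / (1 + sg)) ^+ d <= \int[mu]_z block j z.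
Proof.
have pi0 := pi_gt0 R.
have b1 : 0 < (1 + sg) * q j by rewrite mulr_gt0 ?q0 ?addr_gt0.
have low z : w j / rho ^+ j * gauss ((1 + sg) * q j) z <= block j z.
  rewrite blockE -mulrA ler_pM2l// /bessel_gauss.
  have -> : gauss ((1 + sg) * q j) z = expR (- (beta * (q j * dot z z))) * gauss (q j) z.
    by rewrite /gauss -expRD; congr expR; rewrite /beta; field.
  rewrite mulrA ler_wpM2r ?gauss_ge0//.
  have e0 : 0 < q j * expR (- (q j * dot z z)) by rewrite mulr_gt0 ?q0 ?expR_gt0.
  have -> : (rho ^+ j)^-1 * expR (- (beta * (q j * dot z z))) =
      (q j * expR (- (q j * dot z z))) `^ beta.
    rewrite powRM ?expR_ge0 ?(ltW (q0 j))// q_beta; congr (_ * _).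
    by rewrite /powR gt_eqF ?expR_gt0// expRK mulrN.
  have -> : jb z `^ (- beta) = (jb z)^-1 `^ beta.
    by rewrite -powR_inv1 ?(ltW (jb_gt0 z))// -powRrM mulN1r.
  rewrite ge0_ler_powR ?nnegrE ?invr_ge0 ?(ltW e0) ?(ltW beta0) ?(ltW (jb_gt0 z))//.
  rewrite -[leLHS]invrK lef_pV2 ?posrE ?jb_gt0 ?invr_gt0// invfM -expRN opprK.
  have q1 : 1 <= (q j)^-1 by rewrite /q invrK exprn_ege1// ler1n.
  have := expR_ge1Dx (q j * dot z z); have := dotxx_ge0 z.
  move=> d0 e1.
  apply: le_trans (ler_wpM2l _ e1); last exact: le_trans ler01 q1.
  by rewrite mulrDr mulr1 mulKf ?(lt0r_neq0 (q0 j))// /jb lerD2r.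
have : \int[mu]_z (w j / rho ^+ j * gauss ((1 + sg) * q j) z) <= \int[mu]_z block j z.
  apply: le_Rintegral => //; last exact/schwartz_integrable/schwartz_block.
  exact/integrableEZl/integrable_gauss.
apply: le_trans; rewrite RintegralZT; last exact: integrable_gauss.
have sg1 : 0 < 1 + sg by rewrite addr_gt0.
rewrite Rintegral_gauss// (_ : 2 * pi / ((1 + sg) * q j) = 2 * pi / (1 + sg) * (q j)^-1); last first.
  by field; rewrite !gt_eqF// q0.
have A0 : 0 <= 2 * pi / (1 + sg) by rewrite divr_ge0 ?mulr_ge0 ?(ltW pi0) ?(ltW sg1).
rewrite (sqrtrM _ A0) sqrtrV ?(ltW (q0 j))// sqrt_q invrK exprMn mulrCA.
have -> : w j / rho ^+ j = ((2 ^+ j) ^+ d)^-1.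
  by rewrite /w expr_div_n -!exprM mulnC mulrAC mulfV ?mul1r// expf_neq0// gt_eqF.
by rewrite mulVf ?mulr1// !expf_neq0.
Qed.

(** The factor [gauss (4 ^ -j)] confines the block to frequencies of size [2 ^
    j]. *)
Lemma moment_block : sg < d%:R -> exists2 C, 0 <= C & forall j i,
  \int[mu]_z `|(z : E) ord0 i * block j z| <= C * 2 ^+ j.
Proof.
move=> sd; have [|K K0 HK] := int_bessel_gauss_le beta0 (d := d); first by rewrite /beta; lra.
exists (5 / 2 * Num.sqrt 2 ^+ d * K); first by rewrite !mulr_ge0 ?exprn_ge0.
move=> j i; have q2 : 0 < q j / 2 by rewrite divr_gt0.
have sq : 0 < 2 ^+ j :> R by exact: exprn_gt0.
have qsq : q j * (2 ^+ j) ^+ 2 = 1.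
  have -> : (2 ^+ j) ^+ 2 = 4 ^+ j :> R by rewrite -exprM mulnC exprM; congr (_ ^+ _); ring.
  by rewrite mulVf// expf_neq0.
have up (z : E) : `|z ord0 i * block j z| <= w j * (5 / 2 * 2 ^+ j) * bessel_gauss beta (q j / 2) z.
  rewrite normrM (ger0_norm (block_ge0 j z)) blockE /bessel_gauss.
  rewrite [leLHS](_ : _ = w j * jb z `^ (- beta) * (`|z ord0 i| * gauss (q j) z)); last by ring.
  rewrite [leRHS](_ : _ = w j * jb z `^ (- beta) * (5 / 2 * 2 ^+ j * gauss (q j / 2) z)); last by ring.
  rewrite ler_wpM2l ?mulr_ge0 ?powR_ge0 ?(ltW (w0 j))//.
  have h1 := dot_gauss_le z (q0 j); have h2 := sqr_coord_le_dot z i.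
  have h3 := gauss_gt0 (q j) z.
  have h4 : gauss (q j) z <= gauss (q j / 2) z.
    by rewrite ler_expR; have := dotxx_ge0 z; have := q0 j; nra.
  have h5 : 2 * 2 ^+ j * `|z ord0 i| <= dot z z + (2 ^+ j) ^+ 2.
    by rewrite -real_normK ?num_real// in h2; have := sqr_ge0 (`|z ord0 i| - 2 ^+ j); nra.
  have h6 : 4 / q j = 4 * (2 ^+ j) ^+ 2.
    by rewrite -[in RHS](mulKf (lt0r_neq0 (q0 j)) ((2 ^+ j) ^+ 2)) qsq mulr1.
  rewrite -(ler_pM2l sq); rewrite h6 in h1; nra.
have : \int[mu]_z `|(z : E) ord0 i * block j z| <= \int[mu]_z (w j * (5 / 2 * 2 ^+ j) * bessel_gauss beta (q j / 2) z).
  apply: le_Rintegral => //; last exact/integrableEZl/ibg.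
  exact/(integrable_norm (schwartz_integrable (schwartz_coord i (schwartz_block j)))).
move=> /le_trans; apply; rewrite RintegralZT; last exact: ibg.
have wq : 0 <= w j * (5 / 2 * 2 ^+ j) by rewrite !mulr_ge0 ?(ltW (w0 j)) ?(ltW sq).
apply: le_trans (ler_wpM2l wq (HK _ q2)) _.
have qb : (q j / 2) `^ beta <= (rho ^+ j)^-1.
  rewrite -q_beta ge0_ler_powR ?nnegrE ?(ltW (q0 j)) ?(ltW q2) ?(ltW beta0)//.
  by rewrite ler_pdivrMr//; have := q0 j; lra.
have E : (Num.sqrt (q j / 2) ^+ d)^-1 = Num.sqrt 2 ^+ d * (2 ^+ j) ^+ d.
  by rewrite sqrtrM ?(ltW (q0 j))// sqrt_q sqrtrV// -invfM exprVn invrK mulrC exprMn.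
rewrite E.
apply: (@le_trans _ _ (w j * (5 / 2 * 2 ^+ j) * (K * (rho ^+ j)^-1 * (Num.sqrt 2 ^+ d * (2 ^+ j) ^+ d)))).
  by rewrite ler_wpM2l// ler_wpM2r ?mulr_ge0 ?exprn_ge0// ler_wpM2l.
have -> : w j = rho ^+ j / (2 ^+ j) ^+ d by rewrite /w expr_div_n -!exprM mulnC.
rewrite le_eqVlt; apply/orP; left; apply/eqP; field.
by rewrite !expf_neq0// gt_eqF.
Qed.

(** The gradient of the transform is bounded by the first moment of the block. *)
Lemma osc_block : sg < d%:R -> exists2 C, 0 <= C & forall j (c y : E) r, 0 < r ->
  cube c r y -> `|cosT (block j) y - cosT (block j) c| <= C * (2 ^+ j * r).
Proof.
move=> sd; have [C C0 HC] := moment_block sd.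
exists (d%:R * C); first by rewrite mulr_ge0.
move=> j c y r r0 Qy.
have sk := schwartz_block j.
apply: (@line_bound _ _ _ (fun v x => - sinT (fun z => dot v z * block j z) x)).
  by move=> x v; exact: is_derive_cosT.
move=> z; rewrite normrN; apply: le_trans (norm_sinT _ _) _.
  exact/schwartz_integrable/schwartz_dot.
apply: le_trans (int_dot_le _ sk) _.
apply: (@le_trans _ _ (\sum_(i < d) r * (C * 2 ^+ j))); last first.
  by rewrite sumr_const card_ord -[X in X <= _]mulr_natl; lra.
apply: ler_sum => i _; apply: ler_pM => //; first by apply: Rintegral_ge0.
by rewrite !mxE; have /andP[h1 h2] := Qy i; rewrite ger0_norm; lra.
Qed.

(** On a cube much larger than the wavelength, the average of a block is
    compared with its integral against a Gaussian, whose transform cuts off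
    all but the low frequencies. *)
Lemma mean_block : sg < d%:R -> exists2 C, 0 <= C & forall j (c : E) r, 0 < r ->
  \int[mu]_(y in cube c r) cosT (block j) y <= r ^+ d * (C * (2 ^+ j * r) `^ (sg - d%:R)).
Proof.
move=> sd; have [|K K0 HK] := int_bessel_gauss_le beta0 (d := d); first by rewrite /beta; lra.
have pi0 := pi_gt0 R.
exists (expR (d%:R / 2) * Num.sqrt (2 * pi) ^+ d * K); first by rewrite !mulr_ge0 ?exprn_ge0 ?expR_ge0.
move=> j c r r0; set Q := cube c r.
have mQ : measurable Q by exact: measurable_cube.
have r2 : 0 < (r ^+ 2)^-1 by rewrite invr_gt0 exprn_gt0.
have rr : 0 < r ^+ 2 by rewrite exprn_gt0.
set W := fun x : E => gauss (r ^+ 2)^-1 (x - c).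
have iW : itg mu W by exact: integrable_shift (integrable_gauss r2).
have sk := schwartz_block j; have ik := schwartz_integrable sk.
have iu : itg mu (cosT (block j)) by exact/schwartz_integrable/cosT_schwartz.
have u0 := cosT_block_ge0 j.
have mW : measurable_fun setT W by exact: integrable_measurable iW.
have mcW : measurable_fun setT (cosT W).
  by apply: schwartz_measurable; apply: cosT_schwartz; exact: schwartz_gauss_shift.
have W1 x : `|W x| <= 1 by rewrite ger0_norm ?gauss_ge0// gauss_le1// ltW.
have iuW : itg mu (fun x => cosT (block j) x * W x).
  rewrite (_ : (fun x => _) = (fun x => W x * cosT (block j) x)); last by apply/funext => x; rewrite mulrC.
  exact: integrable_bounded_mul W1 iu.
have lowW x : Q x -> 1 <= expR (d%:R / 2) * W x.
  move=> Qx; rewrite -expRD -[leLHS]expR0 ler_expR.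
  suff : (r ^+ 2)^-1 * dot (x - c) (x - c) <= d%:R by lra.
  rewrite ler_pdivrMl// mulrC dotxx (_ : d%:R * r ^+ 2 = \sum_(i < d) r ^+ 2); last first.
    by rewrite sumr_const card_ord mulr_natl.
  by apply: ler_sum => i _; rewrite !mxE; have /andP[h1 h2] := Qx i; nra.
have step1 : \int[mu]_(y in Q) cosT (block j) y <= expR (d%:R / 2) * \int[mu]_y (cosT (block j) y * W y).
  rewrite -RintegralZT// Rintegral_mkcond; apply: le_Rintegral => //.
  - rewrite (_ : _ \o _ = (EFin \o cosT (block j)) \_ Q).
      by apply: (integrable_mkcond _ mQ).1; exact: integrable_on_cube.
    by apply/funext => x /=; rewrite restrict_EFin.
  - exact: integrableEZl.
  move=> x _; rewrite /patch; case: ifPn => [|_]; last first.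
    by rewrite !mulr_ge0 ?expR_ge0 ?gauss_ge0.
  by rewrite inE => /lowW h; have := u0 x; nra.
apply: le_trans step1 _.
have -> : \int[mu]_y (cosT (block j) y * W y) = \int[mu]_z (cosT W z * block j z).
  have := @fourier_swap _ _ (@cos R) _ _ 0 (@measurable_cos R) (@cos_max R) ik iW.
  under eq_Rintegral do under eq_Rintegral do rewrite subr0.
  by move=> ->; apply: eq_Rintegral => z _; rewrite subr0.
have step2 : \int[mu]_z (cosT W z * block j z) <=
    \int[mu]_z (Num.sqrt (2 * pi) ^+ d * r ^+ d * w j * bessel_gauss beta (r ^+ 2) z).
  apply: le_Rintegral => //.
  - exact: (integrable_bounded_mul mcW (fun x => norm_cosT x iW) ik).
  - by apply: integrableEZl; exact: ibg.
  move=> z _; rewrite cosT_gauss_shift// cosT_gauss// invrK sqrtrM ?mulr_ge0 ?(ltW pi0)//.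
  rewrite sqrtr_sqr gtr0_norm// exprMn blockE.
  set A := _ ^+ d * r ^+ d; have A0 : 0 <= A by rewrite mulr_ge0 ?exprn_ge0 ?(ltW r0).
  apply: (@le_trans _ _ (A * gauss (r ^+ 2) z * (w j * bessel_gauss beta (q j) z))).
    apply: ler_wpM2r; first by rewrite mulr_ge0 ?bessel_gauss_ge0 ?(ltW (w0 j)).
    apply: ler_piMl; first by rewrite mulr_ge0 ?gauss_ge0.
    exact: le_trans (ler_norm _) (cos_max _).
  rewrite -[leLHS]mulrA -[leRHS]mulrA ler_wpM2l// mulrCA ler_wpM2l ?(ltW (w0 j))//.
  rewrite mulrC /bessel_gauss ler_wpM2r ?gauss_ge0// ler_piMr ?powR_ge0//.
  by rewrite gauss_le1// ltW// q0.
apply: (@le_trans _ _ (expR (d%:R / 2) * (Num.sqrt (2 * pi) ^+ d * r ^+ d * w j * (K * (r ^+ 2) `^ beta * (Num.sqrt (r ^+ 2) ^+ d)^-1)))).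
  rewrite ler_wpM2l ?expR_ge0//; apply: le_trans step2 _; rewrite RintegralZT; last exact: ibg.
  apply: ler_wpM2l; last exact: HK.
  by apply: mulr_ge0 (ltW (w0 j)); apply: mulr_ge0; rewrite exprn_ge0 ?(ltW r0).
rewrite sqrtr_sqr gtr0_norm// (@powRM _ (2 ^+ j)) ?exprn_ge0 ?(ltW r0)//.
have -> : (r ^+ 2) `^ beta = r `^ sg.
  by rewrite -powR_mulrn ?(ltW r0)// -powRrM; congr (_ `^ _); rewrite /beta; field.
have -> : (2 ^+ j) `^ (sg - d%:R) = w j.
  rewrite -powR_mulrn// -powRrM mulrC powRrM powR_mulrn ?powR_ge0//.
  by rewrite powRB ?powR_mulrn// pnatr_eq0 implybT.
have -> : r `^ (sg - d%:R) = r `^ sg / r ^+ d.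
  by rewrite powRB ?powR_mulrn ?(ltW r0)// (gt_eqF r0) implybT.
rewrite le_eqVlt; apply/orP; left; apply/eqP; ring.
Qed.

End blocks.

(** * The unbounded function of small norm *)

Section block_sums.
Context {R : realType} {d : nat}.
Local Notation E := 'rV[R]_d.
Local Notation mu := (@lebesgue_rV R d).
Variables (sg : R) (sg0 : 0 < sg) (sd : sg < d%:R).
Local Notation kap := (@kap R d).

(** On a cube smaller than the wavelength [2 ^ -j] the constant [a] is the
    value at a corner, on a larger cube it is zero. Both bounds are weakened
    to powers with the same exponent [e], which makes them a two-sided
    geometric progression in [j]. *)
Lemma block_oscillation : exists C h e : R, [/\ 0 <= C, 1 < h & forall j (c : E) r, 0 < r ->
  exists a, \int[mu]_(y in cube c r) `|cosT (block sg j) y - a| <=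
    r ^+ d * (C * Num.min (h ^+ j * r `^ e) (h ^+ j * r `^ e)^-1)].
Proof.
have [C1 C10 H1] := osc_block sg0 sd; have [C2 C20 H2] := mean_block sg0 sd.
set e := Num.min 1 (d%:R - sg).
have e0 : 0 < e by rewrite lt_min ltr01 subr_gt0.
have e1 : e <= 1 by rewrite ge_min lexx.
have ed : e <= d%:R - sg by rewrite ge_min lexx orbT.
exists (C1 + C2), (2 `^ e), e; split; first exact: addr_ge0.
  have : 1 `^ e < 2 `^ e :> R by apply: gt0_ltr_powR; rewrite ?nnegrE//; lra.
  by rewrite powR1.
move=> j c r r0; have mQ : measurable (cube c r) by exact: measurable_cube.
have sk := schwartz_block (d := d) sg j.
have iu : itg mu (cosT (block sg j)) by exact/schwartz_integrable/cosT_schwartz.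
have rd : 0 < r ^+ d by exact: exprn_gt0.
set y := 2 ^+ j * r; have y0 : 0 < y by rewrite mulr_gt0// exprn_gt0.
have -> : 2 `^ e ^+ j * r `^ e = y `^ e.
  rewrite -powR_mulrn ?powR_ge0// -powRrM (mulrC e) powRrM powR_mulrn// -powRM ?(ltW r0)//.
have ye0 : 0 < y `^ e by exact: powR_gt0.
have cst a : \int[mu]_(x in cube c r) a = r ^+ d * a.
  by rewrite Rintegral_cst// lebesgue_cube// mulrC.
have [y1|y1] := lerP y 1.
  have ye1 : y `^ e <= 1.
    by rewrite -[leRHS](powRr0 y) ger_powR ?(ltW e0)// y0.
  have yle : y <= y `^ e by apply: ger1_powR => //; rewrite y0.
  exists (cosT (block sg j) c); apply: (@le_trans _ _ (\int[mu]_(x in cube c r) (C1 * y))).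
    apply: le_Rintegral => //; last by move=> x Qx; exact: H1.
      exact: (integrable_norm (integrableB mQ (integrable_on_cube _ _ iu) (integrable_cst_cube _ _ r0))).
    exact: integrable_cst_cube.
  rewrite cst ler_wpM2l ?(ltW rd)// min_l.
    by apply: ler_pM => //; [exact: ltW|rewrite lerDl].
  by rewrite (le_trans ye1)// invf_ge1.
have ye1 : 1 <= y `^ e by rewrite -[leLHS](powRr0 y) ler_powR ?(ltW e0) ?(ltW y1).
exists 0; rewrite (@eq_Rintegral _ _ _ mu (cube c r) (cosT (block sg j))) => [|x _]; last first.
  by rewrite subr0 ger0_norm// cosT_block_ge0.
apply: le_trans (H2 _ _ _ r0) _; rewrite ler_wpM2l ?(ltW rd)// min_r; last first.
  by rewrite (le_trans _ ye1)// invf_le1.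
rewrite -powRN; apply: ler_pM => //; rewrite ?powR_ge0 ?lerDr//.
by apply: ler_powR; [exact: ltW|lra].
Qed.

(** Over a given cube only the blocks whose wavelength is close to the side of
    the cube oscillate, so the oscillations add up to a bound that does not
    depend on [n]. *)
Lemma bmo_blocks : exists2 C, 0 <= C & forall n (tau : R), 0 <= tau ->
  (bmo_norm (ift (fun z : E => tau * \sum_(j < n) block sg j z)%R) <= (tau * C)%:E)%E.
Proof.
have [C [h [e [C0 h1 osc]]]] := block_oscillation.
have k0 : 0 < kap by exact: kap_gt0.
set L := 2 * (1 + h) / (h - 1).
have L0 : 0 <= L by rewrite /L divr_ge0//; lra.
exists (2 * kap * C * L); first by rewrite mulr_ge0// !mulr_ge0// ltW.
move=> n tau tau0.
have sk := schwartz_block (d := d) sg.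
have ik j : itg mu (block sg j) by exact: schwartz_integrable.
have sS m : real_schwartz (fun z : E => \sum_(j < m) block sg j z) by exact: schwartz_sum.
pose u m (x : E) := \sum_(j < m) cosT (block sg j) x.
have -> : ift (fun z => tau * \sum_(j < n) block sg j z) = (fun x => (kap * tau * u n x)%:C).
  apply/funext => x; rewrite iftE cosTZ ?sinTZ; try exact: schwartz_integrable.
  rewrite cosT_sum// sinT_sum//.
  rewrite [X in _ +i* X](_ : _ = 0); last by rewrite big1 ?mulr0 // => j _; exact: sinT_block.
  by rewrite mulrA.
have iu m : itg mu (u m).
  rewrite (_ : u m = cosT (fun z => \sum_(j < m) block sg j z)); last first.
    by apply/funext => x; rewrite cosT_sum.
  exact/schwartz_integrable/cosT_schwartz.
apply: ge_ereal_sup => _ [c [r [r0 ->]]].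
have /choice[a Ha] : forall j, exists a, \int[mu]_(y in cube c r) `|cosT (block sg j) y - a| <=
    r ^+ d * (C * Num.min (h ^+ j * r `^ e) (h ^+ j * r `^ e)^-1) by move=> j; exact: osc.
have rd : 0 < r ^+ d by exact: exprn_gt0.
have mQ : measurable (cube c r) by exact: measurable_cube.
have isub (v : E -> R) b : itg mu v -> mu.-integrable (cube c r) (EFin \o (fun y => `|v y - b|)).
  by move=> iv; exact: (integrable_norm (integrableB mQ (integrable_on_cube _ _ iv) (integrable_cst_cube _ _ r0))).
have ic j : itg mu (cosT (block sg j)) by exact/schwartz_integrable/cosT_schwartz.
have Hsum m : \int[mu]_(y in cube c r) `|u m y - \sum_(j < m) a j| <=
    r ^+ d * (C * \sum_(j < m) Num.min (h ^+ j * r `^ e) (h ^+ j * r `^ e)^-1).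
  elim: m => [|m IH].
    rewrite !big_ord0 !mulr0 (@eq_Rintegral _ _ _ mu (cube c r) (fun=> 0)) => [|x _]; last first.
      by rewrite /u big_ord0 subrr normr0.
    by rewrite Rintegral_cst// mul0r.
  rewrite !big_ord_recr/= !mulrDr; apply: le_trans (lerD IH (Ha m)).
  rewrite -RintegralD//; try exact: isub.
  apply: le_Rintegral => //; [exact: isub|exact: (integrableD mQ (isub _ _ (iu m)) (isub _ _ (ic m)))|].
  move=> y _; rewrite /u big_ord_recr/= (_ : _ + _ - _ = (u m y - \sum_(j < m) a j) + (cosT (block sg m) y - a m)); last by rewrite /u; ring.
  exact: ler_normD.
have re0 : 0 < r `^ e by exact: powR_gt0.
have kt : 0 <= kap * tau :> R by rewrite mulr_ge0 ?(ltW k0).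
have -> : tau * (2 * kap * C * L) = 2 * (kap * tau * (C * L)) by ring.
apply: (@mean_oscillation_le _ _ _ _ _ (kap * tau * \sum_(j < n) a j)) => //; first exact: integrableEZl.
rewrite (@eq_Rintegral _ _ _ mu (cube c r) (fun y => kap * tau * `|u n y - \sum_(j < n) a j|)) => [|y _]; last first.
  by rewrite -mulrBr normrM (ger0_norm kt).
rewrite RintegralZl//; last exact: isub.
rewrite [leRHS]mulrCA ler_wpM2l//; apply: le_trans (Hsum n) _.
by rewrite ler_wpM2l ?(ltW rd)// ler_wpM2l// two_sided_geometric_sum.
Qed.

Lemma jb_blocks j (z : E) :
  jb z `^ (sg / 2) * block sg j z = (2 `^ sg / 2 ^+ d) ^+ j * gauss (4 ^+ j)^-1 z.
Proof.
rewrite /block /bessel_gauss mulrCA; congr (_ * _).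
by rewrite mulrA -powRD ?subrr ?powRr0 ?mul1r// (gt_eqF (jb_gt0 z)) implybT.
Qed.

Lemma cosT_dyadic_gauss j (x : E) :
  cosT (gauss (4 ^+ j)^-1) x = (Num.sqrt (2 * pi) * 2 ^+ j) ^+ d * gauss (4 ^+ j) x.
Proof.
have pi0 := pi_gt0 R.
rewrite cosT_gauss ?invr_gt0 ?exprn_gt0// invrK; congr (_ ^+ _ * _).
rewrite sqrtrM ?mulr_ge0 ?(ltW pi0)// (_ : 4 = 2 ^+ 2); last by ring.
by rewrite -exprM mulnC exprM sqrtr_sqr ger0_norm ?exprn_ge0.
Qed.

(** The potential of order [sg] turns the blocks into multiples of [2 ^ (j sg)
    gauss (4 ^ j)]. Since [sg p <= d], the [p]-th power of their sum is
    dominated by a sum of [n] functions of equal integral. *)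
Lemma Lp_blocks (p : R) : 1 < p -> sg <= d%:R / p ->
  exists2 C, 0 <= C & forall n (tau : R), 0 <= tau ->
  (Lpnorm p%:E (ift (fun z : E => jb z `^ (sg / 2) * (tau * \sum_(j < n) block sg j z))%R)
   <= (tau * C * n%:R `^ p^-1)%:E)%E.
Proof.
move=> p1 sp; have pi0 := pi_gt0 R; have p0 : 0 < p by lra.
have k0 : 0 < kap by exact: kap_gt0.
set rho : R := 2 `^ sg; have rho0 : 0 < rho by exact: powR_gt0.
have rho1 : 1 < rho.
  have : 1 `^ sg < 2 `^ sg :> R by apply: gt0_ltr_powR; rewrite ?nnegrE//; lra.
  by rewrite powR1.
have [C C0 HC] := power_sum_le p1 rho1.
set D : R := Num.sqrt (2 * pi) ^+ d; have D0 : 0 <= D by rewrite exprn_ge0.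
exists (kap * D * (C * D) `^ p^-1); first by rewrite !mulr_ge0 ?powR_ge0 ?(ltW k0).
move=> n tau tau0.
have sg4 j : real_schwartz (@gauss R d (4 ^+ j)) by apply: schwartz_gauss; exact: exprn_gt0.
have sg4V j : real_schwartz (@gauss R d (4 ^+ j)^-1).
  by apply: schwartz_gauss; rewrite invr_gt0 exprn_gt0.
pose v (x : E) := \sum_(j < n) rho ^+ j * gauss (4 ^+ j) x.
have vE x : ift (fun z : E => jb z `^ (sg / 2) * (tau * \sum_(j < n) block sg j z)) x =
    (kap * tau * D * v x)%:C.
  pose k j (z : E) := (rho / 2 ^+ d) ^+ j * gauss (4 ^+ j)^-1 z.
  have sk j : real_schwartz (k j) by exact: schwartzZ.
  have -> : (fun z : E => jb z `^ (sg / 2) * (tau * \sum_(j < n) block sg j z)) =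
      (fun z => tau * \sum_(j < n) k j z).
    apply/funext => z; rewrite mulrCA; congr (_ * _).
    by rewrite mulr_sumr; apply: eq_bigr => j _; exact: jb_blocks.
  rewrite iftE cosTZ ?sinTZ; try exact/schwartz_integrable/schwartz_sum.
  rewrite cosT_sum// sinT_sum// [X in _ +i* X](_ : _ = 0); last first.
    rewrite big1 ?mulr0// => j _.
    by rewrite /k sinTZ ?sinT_gauss ?mulr0 ?invr_gt0 ?exprn_gt0//; exact: schwartz_integrable.
  congr (_ +i* _); rewrite -!mulrA; congr (_ * (_ * _)); rewrite mulr_sumr; apply: eq_bigr => j _.
  rewrite /k cosTZ; last exact: schwartz_integrable.
  rewrite cosT_dyadic_gauss expr_div_n (exprMn d) -/D -!exprM (mulnC d) mulrA mulrA; congr (_ * _).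
  by field; rewrite expf_neq0.
have iv0 x : 0 <= v x by apply: sumr_ge0 => j _; rewrite mulr_ge0 ?exprn_ge0 ?gauss_ge0 ?(ltW rho0).
have mv : measurable_fun setT v.
  have sv j : real_schwartz (fun x : E => rho ^+ j * gauss (4 ^+ j) x) by exact: schwartzZ.
  exact: schwartz_measurable (schwartz_sum sv n).
have kt0 : 0 <= kap * tau * D by rewrite !mulr_ge0 ?(ltW k0).
pose m j (x : E) := (2 ^+ d) ^+ j * gauss (4 ^+ j) x.
have sm j : real_schwartz (m j) by exact: schwartzZ.
pose U (x : E) := \sum_(j < n) m j x.
have sU : real_schwartz U by exact: schwartz_sum.
have iU : \int[mu]_x U x = n%:R * D.
  rewrite -cosT0 cosT_sum//.
  rewrite (eq_bigr (fun=> D)) => [|j _]; first by rewrite sumr_const card_ord mulr_natl.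
  rewrite /m cosTZ; last exact: schwartz_integrable.
  rewrite cosT0 Rintegral_gauss ?exprn_gt0// sqrtrM ?mulr_ge0 ?(ltW pi0)// sqrtrV ?exprn_ge0//.
  rewrite (_ : 4 = 2 ^+ 2); last by ring.
  rewrite -(exprM _ 2) mulnC (exprM _ j) sqrtr_sqr ger0_norm ?exprn_ge0// exprMn -/D.
  by rewrite mulrCA exprVn -!exprM mulnC mulfV ?mulr1// expf_neq0.
have vU x : v x `^ p <= C * U x.
  apply: le_trans (HC (fun j => gauss (4 ^+ j) x) n _) _ => [j|].
    by rewrite gauss_ge0 gauss_le1// exprn_ge0.
  rewrite ler_wpM2l//; apply: ler_sum => j _; rewrite ler_wpM2r ?gauss_ge0//.
  rewrite lerXn2r ?nnegrE ?powR_ge0 ?exprn_ge0// -powRrM -powR_mulrn//.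
  by rewrite ler_powR ?ler1n//; rewrite ler_pdivlMr in sp.
apply: Lpnorm_le => //; first by rewrite !mulr_ge0 ?powR_ge0 ?(ltW k0).
apply: (@le_trans _ _ (\int[mu]_x ((kap * tau * D) `^ p * C * U x)%:E)%E).
  apply: ge0_le_integral => //.
  - by move=> x _; rewrite lee_fin powR_ge0.
  - apply/measurable_EFinP; rewrite (_ : (fun x => cmod _ `^ p) = (fun x => (kap * tau * D * v x) `^ p)).
      apply: measurableT_comp (measurable_powR _) _.
      exact: (measurable_funM (measurable_cst (kap * tau * D)) mv).
    by apply/funext => x; rewrite vE cmod_real ger0_norm// mulr_ge0.
  - by apply/measurable_EFinP; apply: measurable_funM => //; exact: schwartz_measurable.
  move=> x _; rewrite lee_fin vE cmod_real (ger0_norm (mulr_ge0 kt0 (iv0 x))).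
  rewrite (powRM _ kt0 (iv0 x)).
  by rewrite -[leRHS]mulrA ler_wpM2l ?powR_ge0.
rewrite integral_fineE; last exact/integrableEZl/schwartz_integrable.
rewrite RintegralZT; last exact: schwartz_integrable.
rewrite iU lee_fin le_eqVlt; apply/orP; left; apply/eqP.
rewrite (_ : tau * _ * _ = kap * tau * D * (C * D * n%:R) `^ p^-1); last first.
  by rewrite (@powRM _ (C * D)) ?mulr_ge0//; ring.
rewrite (powRM _ kt0 (powR_ge0 _ _)) -powRrM mulVf ?gt_eqF// powRr1 ?mulr_ge0//; ring.
Qed.

(** The value of the sum of [n] blocks at the origin grows like [n], its [L^p]
    norm like [n ^ (1 / p)], and its BMO norm stays bounded. Dividing by [n ^
    (1 / p)] leaves the unbounded value [n ^ (1 - 1 / p)]. *)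
Lemma bad_symbol (p Lam : R) : 1 < p -> sg <= d%:R / p ->
  exists G : E -> R, [/\ real_schwartz G, forall z, 0 <= G z, forall z, G (- z) = G z &
    [/\ forall x, sinT G x = 0, Lam < kap * cosT G 0, (bmo_norm (ift G) <= (4^-1)%:E)%E &
      (Lpnorm p%:E (ift (fun z : E => jb z `^ (sg / 2) * G z)%R) <= (4^-1)%:E)%E]].
Proof.
move=> p1 sp; have pi0 := pi_gt0 R; have p0 : 0 < p by lra.
have k0 : 0 < kap by exact: kap_gt0.
have [C1 C10 H1] := bmo_blocks; have [C2 C20 H2] := Lp_blocks p1 sp.
set c := Num.sqrt (2 * pi / (1 + sg)) ^+ d.
have c0 : 0 < c.
  apply: exprn_gt0; rewrite sqrtr_gt0; apply: divr_gt0; last exact: addr_gt0.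
  exact: mulr_gt0.
pose t := (4 * (C1 + C2 + 1))^-1.
have t0 : 0 < t by rewrite invr_gt0; lra.
have tE : t * (C1 + C2 + 1) = 4^-1 by rewrite /t; field; lra.
pose a := 1 - p^-1.
have a0 : 0 < a by rewrite subr_gt0 invf_lt1.
have ktc : 0 < kap * t * c by rewrite !mulr_gt0.
pose Y := `|Lam| / (kap * t * c) + 1.
have Y0 : 0 < Y by rewrite ltr_wpDl// divr_ge0 ?(ltW ktc).
pose n := (Num.truncn (Y `^ a^-1)).+1.
have nY : Y <= n%:R `^ a.
  have -> : Y = (Y `^ a^-1) `^ a by rewrite -powRrM mulVf ?powRr1 ?(ltW Y0)// gt_eqF.
  have Yn : Y `^ a^-1 <= n%:R by exact/ltW/truncnS_gt.
  by apply: ge0_ler_powR; rewrite ?nnegrE ?powR_ge0 ?ler0n ?(ltW a0).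
have n1 : 1 <= n%:R `^ p^-1 :> R.
  have : 1 `^ p^-1 <= n%:R `^ p^-1 :> R by rewrite ge0_ler_powR ?nnegrE ?invr_ge0 ?(ltW p0) ?ler1n.
  by rewrite powR1.
have n0 : 0 < n%:R `^ p^-1 :> R by lra.
pose tau := t / n%:R `^ p^-1.
have tau0 : 0 < tau by rewrite divr_gt0.
have taut : tau <= t by rewrite ler_pdivrMr// ler_peMr// ltW.
have sk := schwartz_block (d := d) sg.
have sS : real_schwartz (fun z : E => \sum_(j < n) block sg j z) by exact: schwartz_sum.
exists (fun z => tau * \sum_(j < n) block sg j z); split.
- exact: schwartzZ.
- by move=> z; rewrite mulr_ge0 ?(ltW tau0)//; apply: sumr_ge0 => j _; exact: block_ge0.
- by move=> z; congr (_ * _); apply: eq_bigr => j _; exact: blockN.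
split.
- move=> x; rewrite sinTZ ?sinT_sum//; last exact: schwartz_integrable.
  by rewrite big1 ?mulr0// => j _; exact: sinT_block.
- rewrite cosTZ ?cosT_sum//; last exact: schwartz_integrable.
  have : n%:R * c <= \sum_(j < n) cosT (block sg j) (0 : E).
    rewrite mulr_natl -[n in _ *+ n]card_ord -sumr_const; apply: ler_sum => j _.
    by rewrite cosT0 int_block_ge.
  move=> /(ler_wpM2l (ltW tau0)) /(ler_wpM2l (ltW k0)); apply: lt_le_trans.
  have -> : kap * (tau * (n%:R * c)) = kap * t * c * n%:R `^ a.
    rewrite /a powRB ?powRr1 ?pnatr_eq0 ?implybT// /tau; field.
    by rewrite gt_eqF.
  apply: lt_le_trans (ler_wpM2l (ltW ktc) nY).
  rewrite /Y mulrDr mulr1 mulrCA mulfV ?gt_eqF// mulr1.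
  by have := ler_norm Lam; lra.
- apply: le_trans (H1 n tau (ltW tau0)) _; rewrite lee_fin -tE.
  by apply: ler_pM; rewrite ?(ltW tau0)//; lra.
- apply: le_trans (H2 n tau (ltW tau0)) _; rewrite lee_fin -tE.
  have -> : tau * C2 * n%:R `^ p^-1 = t * C2 by rewrite /tau; field; rewrite gt_eqF.
  by rewrite ler_pM2l//; lra.
Qed.

End block_sums.

(** * Convolution of rapidly decreasing functions *)

Section rapid_decay.
Context {R : realType} {d : nat}.
Local Notation E := 'rV[R]_d.
Local Notation mu := (@lebesgue_rV R d).

Lemma rapid_jb_powR a (k : E -> R) : rapidly_decreasing k ->
  rapidly_decreasing (fun x => jb x `^ a * k x).
Proof.
move=> rk m; have [N hN] := @jb_powR_le R d a; have [C hC] := rk (m + N)%N.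
exists C => x; apply: le_trans (hC x).
rewrite normrM ger0_norm ?powR_ge0// mulrA exprD.
by rewrite ler_wpM2r// ler_wpM2l ?hN// exprn_ge0// ltW// jb_gt0.
Qed.

Lemma measurable_jb_powR a : measurable_fun setT (fun x : E => jb x `^ a).
Proof. by apply: measurableT_comp (measurable_powR _) _; exact: measurable_jb. Qed.

End rapid_decay.

Section convolution.
Context {R : realType} {d : nat}.
Local Notation E := 'rV[R]_d.
Local Notation mu := (@lebesgue_rV R d).

Definition conv (Phi Gam : E -> R) (xi : E) : R :=
  \int[mu]_z (Phi z * Gam (xi - z)).

Variables (Phi Gam : E -> R).
Hypotheses (mPhi : measurable_fun setT Phi) (rPhi : rapidly_decreasing Phi).
Hypotheses (mGam : measurable_fun setT Gam) (rGam : rapidly_decreasing Gam).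

Let iPhi : itg mu Phi. Proof. exact: rapid_integrable. Qed.
Let iGam : itg mu Gam. Proof. exact: rapid_integrable. Qed.

Let mH : measurable_fun setT (fun p : E * E => Phi p.2 * Gam (p.1 - p.2)).
Proof.
apply: measurable_funM; first exact: measurableT_comp mPhi measurable_snd.
exact: measurable_comp_sub.
Qed.

(* Peetre's inequality turns decay in [xi - z] into decay in [xi]. *)
Let dom : exists a b : E -> R, [/\ itg mu a, itg mu b &
  forall xi z, `|Phi z * Gam (xi - z)| <= a xi * b z].
Proof.
have [C C0 hC] := rapid_decay d rGam; have [D D0 hD] := rapid_decay (d + d) rPhi.
exists (fun xi => C * 2 ^+ d * (jb xi ^+ d)^-1), (fun z => D * (jb z ^+ d)^-1); split.
- exact: integrableEZl (@integrable_jbXn R d).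
- exact: integrableEZl (@integrable_jbXn R d).
move=> xi z; have jz := jb_gt0 z; have jx := jb_gt0 xi; have jxz := jb_gt0 (xi - z).
rewrite normrM mulrC.
apply: (@le_trans _ _ (C * (jb (xi - z) ^+ d)^-1 * (D * (jb z ^+ (d + d))^-1))).
  by apply: ler_pM.
have : jb xi ^+ d <= (2 * jb (xi - z) * jb z) ^+ d.
  rewrite lerXn2r ?nnegrE ?mulr_ge0 ?(ltW jz) ?(ltW jx) ?(ltW jxz)//.
  by have := jb_peetre (xi - z) z; rewrite subrK.
rewrite !exprMn exprD => h.
rewrite -subr_ge0.
have e0 : 0 < jb z ^+ d by exact: exprn_gt0.
have e1 : 0 < jb xi ^+ d by exact: exprn_gt0.
have e2 : 0 < jb (xi - z) ^+ d by exact: exprn_gt0.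
rewrite [X in 0 <= X](_ : _ = C * D * (2 ^+ d * jb (xi - z) ^+ d * jb z ^+ d - jb xi ^+ d)
  / (jb xi ^+ d * jb z ^+ d * jb z ^+ d * jb (xi - z) ^+ d)); last first.
  by field; rewrite !gt_eqF.
by rewrite divr_ge0 ?mulr_ge0 ?subr_ge0 ?(ltW e0) ?(ltW e1) ?(ltW e2).
Qed.

Lemma integrable_conv_section xi : itg mu (fun z => Phi z * Gam (xi - z)).
Proof.
have [a [b [ia ib ab]]] := dom.
exact: (integrable_section1 mH ib ab).
Qed.

Lemma integrable_conv : itg mu (conv Phi Gam).
Proof.
have [a [b [ia ib ab]]] := dom.
exact: (integrable_integral2 (@sigma_finite_lebesgue_rV R d) (@sigma_finite_lebesgue_rV R d) mH ia ib ab).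
Qed.

Let transform_conv (phi : R -> R) (x : E) :
  measurable_fun setT phi -> (forall a, `|phi a| <= 1) ->
  \int[mu]_xi (phi (dot x xi) * conv Phi Gam xi) =
  \int[mu]_z (Phi z * \int[mu]_xi (phi (dot x xi) * Gam (xi - z))).
Proof.
move=> mphi phi1; have [a [b [ia ib ab]]] := dom.
have mp : measurable_fun setT (fun xi : E => phi (dot x xi)).
  by apply: measurableT_comp mphi _; exact: measurable_dotr.
pose H (p : E * E) := phi (dot x p.1) * (Phi p.2 * Gam (p.1 - p.2)).
transitivity (\int[mu]_xi \int[mu]_z H (xi, z)).
  by apply: eq_Rintegral => xi _; rewrite -RintegralZT//; exact: integrable_conv_section.
rewrite (@rV_swap _ _ _ H a b)//.
- apply: eq_Rintegral => z _; rewrite -RintegralZT.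
    by apply: eq_Rintegral => xi _; rewrite /H /=; ring.
  by apply: (integrable_bounded_mul mp) => // *; exact: integrable_shift.
- by apply: measurable_funM => //; exact: measurableT_comp mp measurable_fst.
- by move=> xi z; apply: le_trans (ab xi z); rewrite /H /= normrM ler_piMl.
Qed.

Let ic x : itg mu (fun z => cos (dot x z) * Phi z).
Proof. exact: integrable_cos_mul. Qed.
Let isn x : itg mu (fun z => sin (dot x z) * Phi z).
Proof. exact: integrable_sin_mul. Qed.

Lemma cosT_conv x :
  cosT (conv Phi Gam) x = cosT Phi x * cosT Gam x - sinT Phi x * sinT Gam x.
Proof.
rewrite {1}/cosT (transform_conv x (@measurable_cos R) (@cos_max R)).
transitivity (\int[mu]_z (cosT Gam x * (cos (dot x z) * Phi z) - sinT Gam x * (sin (dot x z) * Phi z))).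
  apply: eq_Rintegral => z _; rewrite -[X in _ * X]/(cosT (fun xi => Gam (xi - z)) x).
  by rewrite cosT_shift//; ring.
rewrite RintegralBT ?RintegralZT//; try exact: integrableEZl.
by rewrite mulrC [X in _ - X]mulrC.
Qed.

Lemma sinT_conv x :
  sinT (conv Phi Gam) x = sinT Phi x * cosT Gam x + cosT Phi x * sinT Gam x.
Proof.
rewrite {1}/sinT (transform_conv x (@measurable_sin R) (@sin_max R)).
transitivity (\int[mu]_z (cosT Gam x * (sin (dot x z) * Phi z) + sinT Gam x * (cos (dot x z) * Phi z))).
  apply: eq_Rintegral => z _; rewrite -[X in _ * X]/(sinT (fun xi => Gam (xi - z)) x).
  by rewrite sinT_shift//; ring.
rewrite RintegralDT ?RintegralZT//; try exact: integrableEZl.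
by rewrite mulrC [X in _ + X]mulrC.
Qed.

Lemma int_conv : \int[mu]_xi conv Phi Gam xi = (\int[mu]_z Phi z) * \int[mu]_z Gam z.
Proof. by rewrite -!cosT0 cosT_conv !sinT0 mul0r subr0. Qed.

End convolution.

(** * The commutator on the Fourier side *)

Section commutator.
Context {R : realType} {d : nat}.
Local Notation E := 'rV[R]_d.
Local Notation mu := (@lebesgue_rV R d).
Local Notation kap := (@kap R d).

Lemma powR_diff_le (r a b : R) : 0 < b <= a ->
  a `^ r - b `^ r <= (Num.truncn r).+1%:R * (a `^ r * ((a - b) / a)).
Proof.
move=> /andP[b0 ba]; have a0 : 0 < a by lra.
have u01 : 0 <= b / a <= 1 by rewrite divr_ge0 ?(ltW b0) ?(ltW a0)//= ler_pdivrMr ?mul1r.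
have := ler_wpM2r (powR_ge0 a r) (one_sub_powR_le r u01).
rewrite mulrBl mul1r -powRM ?(ltW a0) ?divr_ge0 ?(ltW b0) ?(ltW a0)// divfK ?gt_eqF// => /le_trans; apply.
rewrite le_eqVlt; apply/orP; left; apply/eqP; field; exact: lt0r_neq0.
Qed.

(** The cross term [2 dot z w] is split by the weighted inequality between
    geometric and arithmetic means, with weights [jb z ^ (- 1 / 2)] and [jb z
    ^ (1 / 2)]; this gains half a power of [jb z] over Peetre's inequality. *)
Lemma jb_diff_le (z w : E) : `|jb (z + w) - jb z| <= 2 * jb z `^ 2^-1 * jb w.
Proof.
set q := jb z `^ 2^-1; have jz := jb_gt0 z.
have q0 : 0 < q by exact: powR_gt0.
have qq : q * q = jb z by rewrite -expr2 /q powR12_sqrt ?(ltW jz)// sqr_sqrtr ?(ltW jz).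
have q1 : 1 <= q.
  by rewrite -(@ler_pXn2r _ 2) ?nnegrE ?(ltW q0)// expr1n expr2 qq jb_ge1.
set t := Num.sqrt q; have t0 : 0 < t by rewrite sqrtr_gt0.
have tt : t * t = q by rewrite -expr2 sqr_sqrtr ?ltW.
have := norm_dot_le (t^-1 *: z) (t *: w).
have -> : dot (t^-1 *: z) (t *: w) = dot z w by rewrite dotZl dotZr mulKf ?gt_eqF.
have -> : dot (t^-1 *: z) (t^-1 *: z) = q^-1 * dot z z by rewrite dotZl dotZr mulrA -invfM tt.
have -> : dot (t *: w) (t *: w) = q * dot w w by rewrite dotZl dotZr mulrA tt.
move=> h.
have -> : jb (z + w) - jb z = 2 * dot z w + dot w w.
  by rewrite /jb !dotDl !dotDr (dotC w z); ring.
apply: le_trans (ler_normD _ _) _; rewrite normrM [`|2|]ger0_norm// [`|dot w w|]ger0_norm ?dotxx_ge0//.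
have hz : q^-1 * dot z z <= q by rewrite ler_pdivrMl// qq /jb; lra.
have w0 := dotxx_ge0 w.
rewrite /jb in qq *; nra.
Qed.

(** The gain of half a power passes from [jb] to its [r]-th power as in the
    mean value theorem, the two brackets being compared by Peetre's
    inequality. *)
Lemma jb_powR_diff (r : R) : 0 <= r -> exists2 C, 0 <= C & forall z w : E,
  `|jb (z + w) `^ r - jb z `^ r| <= C * (jb z `^ (r - 2^-1) * jb w `^ (r + 1)).
Proof.
move=> r0; set K : R := (Num.truncn r).+1%:R.
exists (K * (2 `^ r * 2)); first by rewrite !mulr_ge0 ?powR_ge0 ?ler0n.
move=> z w; have jz := jb_gt0 z; have jw := jb_gt0 w; have jzw := jb_gt0 (z + w).
have dl := jb_diff_le z w.
have key (M m : R) : 0 < m <= M -> M <= 2 * jb z * jb w -> jb z <= M -> M - m <= `|jb (z + w) - jb z| ->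
    M `^ r - m `^ r <= K * (2 `^ r * 2) * (jb z `^ (r - 2^-1) * jb w `^ (r + 1)).
  move=> /andP[m0 mM] M2 zM Mm; have M0 : 0 < M by lra.
  have h0 : 0 < m <= M by rewrite m0.
  apply: le_trans (powR_diff_le r h0) _; rewrite -mulrA ler_wpM2l//.
  have -> : 2 `^ r * 2 * (jb z `^ (r - 2^-1) * jb w `^ (r + 1)) =
      (2 * jb z * jb w) `^ r * (2 * jb z `^ 2^-1 * jb w / jb z).
    have zhalf : jb z `^ (r - 2^-1) = jb z `^ r * (jb z `^ 2^-1 / jb z).
      rewrite (_ : r - 2^-1 = r + (2^-1 - 1)); last by field.
      by rewrite powRD ?powRB ?powRr1 ?(ltW jz) ?(gt_eqF jz) ?implybT.
    rewrite zhalf powRD ?(gt_eqF jw) ?implybT// powRr1 ?(ltW jw)//.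
    by rewrite !powRM ?mulr_ge0 ?(ltW jz) ?(ltW jw)//; field; exact: lt0r_neq0.
  apply: ler_pM; rewrite ?powR_ge0//; first by rewrite divr_ge0 ?subr_ge0 ?(ltW M0).
    by apply: ge0_ler_powR; rewrite ?nnegrE ?mulr_ge0 ?(ltW M0) ?(ltW jz) ?(ltW jw).
  apply: ler_pM; rewrite ?subr_ge0 ?invr_ge0 ?(ltW M0)//; first exact: le_trans Mm dl.
  by rewrite lef_pV2.
have w1 := jb_ge1 w.
have [h|h] := lerP (jb z) (jb (z + w)).
  rewrite ger0_norm; last by rewrite subr_ge0 ge0_ler_powR ?nnegrE ?(ltW jz) ?(ltW jzw).
  by apply: key => //; [rewrite jz|exact: jb_peetre|exact: ler_norm].
rewrite distrC ger0_norm; last by rewrite subr_ge0 ge0_ler_powR ?nnegrE ?(ltW jz) ?(ltW jzw) ?(ltW h).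
by apply: key => //; [rewrite jzw ltW|nra|rewrite distrC; exact: ler_norm].
Qed.

(** By Peetre's inequality the weight at distance [O(1)] from [c] is
    comparable with its value at [c]. *)
Lemma small_mass (th b e : R) : (0 < d)%N -> 0 < th -> 0 < b -> 0 < e ->
  exists c : E, \int[mu]_z bracket_gauss (- th) b c z <= e.
Proof.
move=> d0 th0 b0 e0.
set K := \int[mu]_z (bracket_gauss th b 0 z : R).
have K0 : 0 <= K by apply: Rintegral_ge0 => z _; exact: bracket_gauss_ge0.
pose Y := 2 `^ th * K / e; have Y0 : 0 <= Y by rewrite divr_ge0 ?mulr_ge0 ?powR_ge0 ?(ltW e0).
pose N := Y `^ th^-1; have N0 : 0 <= N by exact: powR_ge0.
pose c : E := N *: delta_mx ord0 (Ordinal d0).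
have cN : N <= jb c.
  have := sqr_coord_le_dot c (Ordinal d0); rewrite !mxE !eqxx mulr1 /jb => h.
  by have := sqr_ge0 (N - 1); nra.
have jc := jb_gt0 c.
exists c; have i1 := schwartz_integrable (schwartz_bracket_gauss th (0 : E) b0).
have i2 := integrable_shift (- c) i1.
apply: (@le_trans _ _ (\int[mu]_z ((2 `^ th * jb c `^ (- th)) * bracket_gauss th b 0 (z - c)))).
  apply: le_Rintegral; first exact: measurableT.
  - exact/schwartz_integrable/schwartz_bracket_gauss.
  - exact: integrableEZl.
  move=> z _; rewrite /bracket_gauss subr0 mulrA ler_wpM2r ?gauss_ge0//.
  have jz := jb_gt0 z; have jzc := jb_gt0 (z - c).
  have h : jb c `^ th <= (2 * jb z * jb (z - c)) `^ th.
    apply: ge0_ler_powR; rewrite ?nnegrE ?mulr_ge0 ?(ltW th0) ?(ltW jc) ?(ltW jz) ?(ltW jzc)//.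
    have := jb_peetre z (c - z); rewrite addrC subrK.
    by rewrite (_ : jb (c - z) = jb (z - c))// -opprB /jb dotNl dotNr opprK.
  rewrite !powRM ?mulr_ge0 ?(ltW jz) ?(ltW jzc)// in h.
  have pz := powR_gt0 th jz; have pc := powR_gt0 th jc.
  rewrite !powRN (_ : _ * _ * _ = (2 `^ th * jb z `^ th * jb (z - c) `^ th) / jb c `^ th * (jb z `^ th)^-1).
    by rewrite ler_peMl ?invr_ge0 ?(ltW pz)// ler_pdivlMr// mul1r.
  by field; rewrite !gt_eqF.
rewrite RintegralZT// (Rintegral_shift (- c) i1) -/K.
have YK : 2 `^ th * K = Y * e by rewrite /Y divfK// gt_eqF.
rewrite mulrAC YK powRN ler_pdivrMr ?powR_gt0// mulrC ler_wpM2l ?(ltW e0)//.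
have -> : Y = N `^ th by rewrite /N -powRrM mulVf ?powRr1// gt_eqF.
by apply: ge0_ler_powR; rewrite ?nnegrE ?(ltW th0) ?(ltW jc).
Qed.

Section product.
Variables (F G : E -> R).
Hypotheses (sF : real_schwartz F) (sG : real_schwartz G).
Hypotheses (evenG : forall z, G (- z) = G z) (sin0 : forall x, sinT G x = 0).

Let iF : itg mu F. Proof. exact: schwartz_integrable. Qed.
Let iG : itg mu G. Proof. exact: schwartz_integrable. Qed.

Let twopi : kap * (2 * pi) ^+ d = 1.
Proof. by rewrite /kap mulVf// expf_neq0// gt_eqF// mulr_gt0// pi_gt0. Qed.

Let sinT_G : sinT G = fun=> 0. Proof. exact/funext. Qed.

Let transform0 (phi : R -> R) x : \int[mu]_z (phi (dot x z) * 0) = 0.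
Proof.
rewrite (@eq_Rintegral _ _ _ mu setT (fun=> 0)); last by move=> z _; rewrite mulr0.
by rewrite /Rintegral integral0.
Qed.

Lemma ift_even x : ift G x = (kap * cosT G x)%:C.
Proof. by rewrite iftE sin0 mulr0. Qed.

(** The transform of a product is a convolution; the inversion formula is
    applied to the factor [G] only. *)
Lemma fourier_mul : fourier (fun x => ift F x * ift G x) = (fun xi => (kap * conv F G xi)%:C).
Proof.
apply/funext => xi.
have sC := cosT_schwartz sG.
pose w x := kap * kap * cosT G x.
have iC : itg mu (cosT G) by exact: schwartz_integrable.
have iw : itg mu w by exact: integrableEZl.
have cw z : cosT w z = kap * G z.
  rewrite /w cosTZ//; have := fourier_inversion_cos sG z.
  rewrite sinT_G [X in _ + X]transform0 addr0 => ->.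
  by rewrite -mulrA (mulrA kap (_ ^+ _)) twopi mul1r.
have sw z : sinT w z = 0.
  rewrite /w sinTZ//; have := fourier_inversion_sin sG z.
  by rewrite sinT_G [X in X - _]transform0 sub0r => /eqP; rewrite oppr_eq0 => /eqP ->; rewrite mulr0.
have -> : (fun x => ift F x * ift G x) = (fun x => (cosT F x * w x) +i* (sinT F x * w x)).
  apply/funext => x; rewrite ift_even iftE /w; simpc.
  by congr (_ +i* _); ring.
have ip (T : E -> R) : real_schwartz T -> itg mu (fun x => T x * w x).
  move=> sT; have [B B0 hB] := schwartz_bounded sT.
  exact: integrable_bounded_mul (schwartz_measurable sT) hB iw.
have ipc := ip _ (cosT_schwartz sF); have ips := ip _ (sinT_schwartz sF).
rewrite fourierE//; congr (_ +i* _).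
- transitivity (\int[mu]_x (cos (dot xi x) * (cosT F x * w x) + sin (dot xi x) * (sinT F x * w x))).
    by rewrite RintegralDT//; [exact: integrable_cos_mul|exact: integrable_sin_mul].
  transitivity (\int[mu]_x ((\int[mu]_z (cos (dot x (z - xi)) * F z)) * w x)).
    by apply: eq_Rintegral => x _; rewrite -cosT_modulate//; ring.
  rewrite (fourier_swap _ (@measurable_cos R) (@cos_max R) iF iw).
  transitivity (\int[mu]_z (kap * (F z * G (xi - z)))).
    apply: eq_Rintegral => z _; rewrite -[X in X * _]/(cosT w (z - xi)) cw -(evenG (z - xi)) opprB; ring.
  rewrite RintegralZT//; apply: integrable_conv_section.
  + exact: schwartz_measurable.
  + exact: schwartz_rapid.
  + exact: schwartz_measurable.
  + exact: schwartz_rapid.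
- transitivity (\int[mu]_x (cos (dot xi x) * (sinT F x * w x) - sin (dot xi x) * (cosT F x * w x))).
    by rewrite RintegralBT//; [exact: integrable_cos_mul|exact: integrable_sin_mul].
  transitivity (\int[mu]_x ((\int[mu]_z (sin (dot x (z - xi)) * F z)) * w x)).
    by apply: eq_Rintegral => x _; rewrite -sinT_modulate//; ring.
  rewrite (fourier_swap _ (@measurable_sin R) (@sin_max R) iF iw).
  rewrite (@eq_Rintegral _ _ _ mu setT (fun=> 0)); first by rewrite /Rintegral integral0.
  by move=> z _; rewrite -[X in X * _]/(sinT w (z - xi)) sw mul0r.
Qed.

End product.

(** At the frequency [xi] the symbol [D] is the integral over [z] of [F z * G
    (xi - z)] times the difference of the brackets of [xi] and [z]; the gain
    of half a power in that difference is what makes it small when [F] lives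
    at high frequencies. *)
Lemma commutator_symbol (s : R) : 0 <= s -> exists2 C, 0 <= C & forall F G : E -> R,
  real_schwartz F -> real_schwartz G -> (forall z, 0 <= F z) -> (forall z, 0 <= G z) ->
  (forall z, G (- z) = G z) -> (forall x, sinT G x = 0) ->
  exists2 D : E -> R, itg mu D & \int[mu]_z `|D z| <=
    C * ((\int[mu]_z (jb z `^ (s / 2 - 2^-1) * F z)) * \int[mu]_z (jb z `^ (s / 2 + 1) * G z)) /\
    forall x, bessel s (fun y => ift F y * ift G y) x - ift G x * bessel s (ift F) x = ift D x.
Proof.
move=> s0; set r := s / 2; have r0 : 0 <= r by rewrite divr_ge0.
have k0 : 0 < kap by exact: kap_gt0.
have [C C0 hC] := jb_powR_diff r0.
exists (kap * C); first by rewrite mulr_ge0 ?(ltW k0).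
move=> F G sF sG F0 G0 evG sin0.
have mF := schwartz_measurable sF; have mG := schwartz_measurable sG.
have rF := schwartz_rapid sF; have rG := schwartz_rapid sG.
have mw a (k : E -> R) : measurable_fun setT k -> measurable_fun setT (fun z => jb z `^ a * k z).
  by move=> mk; apply: measurable_funM => //; exact: measurable_jb_powR.
pose Psi z := jb z `^ r * F z.
pose Phi z := jb z `^ (r - 2^-1) * F z; pose Gam z := jb z `^ (r + 1) * G z.
have mPsi : measurable_fun setT Psi by exact: mw.
have mPhi : measurable_fun setT Phi by exact: mw.
have mGam : measurable_fun setT Gam by exact: mw.
have rPsi : rapidly_decreasing Psi by exact: rapid_jb_powR.
have rPhi : rapidly_decreasing Phi by exact: rapid_jb_powR.
have rGam : rapidly_decreasing Gam by exact: rapid_jb_powR.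
have iPsi := rapid_integrable mPsi rPsi.
have icFG := integrable_conv mF rF mG rG; have icPG := integrable_conv mPsi rPsi mG rG.
have icPhG := integrable_conv mPhi rPhi mGam rGam.
pose D xi := kap * (jb xi `^ r * conv F G xi - conv Psi G xi).
have bD xi : `|D xi| <= kap * C * conv Phi Gam xi.
  rewrite /D normrM (gtr0_norm k0) -mulrA ler_wpM2l ?(ltW k0)//.
  have iFG := integrable_conv_section mF rF mG rG xi.
  have iPG := integrable_conv_section mPsi rPsi mG rG xi.
  have iPhG := integrable_conv_section mPhi rPhi mGam rGam xi.
  rewrite /conv -!RintegralZT// -RintegralBT//; last exact: integrableEZl.
  apply: Rintegral_norm_le; [exact: (integrableEB (integrableEZl _ iFG) iPG)|exact: integrableEZl|].
  move=> z; rewrite /Psi /Phi /Gam -mulrA -mulrBl normrM.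
  have FG0 : 0 <= F z * G (xi - z) by rewrite mulr_ge0.
  rewrite (ger0_norm FG0); have := hC z (xi - z); rewrite (addrC z) subrK.
  move=> /(ler_wpM2r FG0) /le_trans; apply; rewrite le_eqVlt; apply/orP; left; apply/eqP; ring.
have mD : measurable_fun setT D.
  apply: measurable_funM => //; apply: measurable_funB; last exact: integrable_measurable icPG.
  by apply: measurable_funM; [exact: measurable_jb_powR|exact: integrable_measurable icFG].
have iD : itg mu D by apply: integrable_le bD _ => //; exact: integrableEZl.
exists D => //; split; last first.
  move=> x.
  rewrite bessel_ift// (ift_even sin0) /bessel fourier_mul// -/Psi.
  pose U xi := D xi + kap * conv Psi G xi.
  have iU : itg mu U by exact: integrableED iD (integrableEZl _ icPG).
  have -> : inverse_fourier (fun xi => ((1 + dot xi xi) `^ (s / 2))%:C * (kap * conv F G xi)%:C) x = ift U x.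
    rewrite /ift; congr (inverse_fourier _ x); apply/funext => xi.
    by rewrite -rmorphM; congr (_%:C); rewrite /U /D /jb /r; ring.
  have ik := integrableEZl kap icPG.
  rewrite !iftE /U cosTD// sinTD// cosTZ// sinTZ// cosT_conv// sinT_conv// !sin0; simpc.
  by congr (_ +i* _); ring.
rewrite -/r -(int_conv mPhi rPhi mGam rGam) -RintegralZT//.
apply: le_Rintegral; first exact: measurableT.
- exact: integrable_norm iD.
- exact: integrableEZl.
- by move=> xi _; exact: bD.
Qed.

End commutator.

(** * Measurability and modulated Gaussians *)

Section measurable_transform.
Context {R : realType} {d : nat}.
Local Notation E := 'rV[R]_d.
Local Notation mu := (@lebesgue_rV R d).

(* Multiplying by a Gaussian in [x] makes the kernel jointly integrable. *)
Let measurable_transform (phi : R -> R) (k : E -> R) :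
  measurable_fun setT phi -> (forall a, `|phi a| <= 1) -> itg mu k ->
  measurable_fun setT (fun x => \int[mu]_z (phi (dot x z) * k z)).
Proof.
move=> mphi phi1 ik; have mk := integrable_measurable ik.
pose H (u : E * E) := gauss 1 u.1 * (phi (dot u.1 u.2) * k u.2).
have mH : measurable_fun setT H.
  apply: measurable_funM; first exact: measurableT_comp (measurable_gauss 1) measurable_fst.
  apply: measurable_funM; last exact: measurableT_comp mk measurable_snd.
  by apply: measurableT_comp mphi _; apply: measurable_dot; [exact: measurable_fst|exact: measurable_snd].
have hH x z : `|H (x, z)| <= gauss 1 x * `|k z|.
  by rewrite /H normrM (ger0_norm (gauss_ge0 _ _)) ler_wpM2l ?gauss_ge0// normrM ler_piMl.
have := integrable_integral2 (@sigma_finite_lebesgue_rV R d) (@sigma_finite_lebesgue_rV R d) mH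
  (integrable_gauss ltr01) (integrable_norm ik) hH.
move=> /integrable_measurable mI.
have -> : (fun x => \int[mu]_z (phi (dot x z) * k z)) =
    (fun x => expR (dot x x / 2) * \int[mu]_z H (x, z)).
  apply/funext => x; rewrite /H /= RintegralZT; last first.
    apply: (integrable_bounded_mul _ _ ik) => [|z]; last exact: phi1.
    by apply: measurableT_comp mphi _; exact: measurable_dotr.
  by rewrite mulrA /gauss -expRD mul1r subrr expR0 mul1r.
apply: measurable_funM => //; apply: measurableT_comp => //; apply: measurable_funM => //.
by apply: measurable_dot.
Qed.

Lemma measurable_cosT (k : E -> R) : itg mu k -> measurable_fun setT (cosT k).
Proof. by move=> ik; apply: measurable_transform => //; [exact: measurable_cos|exact: cos_max]. Qed.

Lemma measurable_sinT (k : E -> R) : itg mu k -> measurable_fun setT (sinT k).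
Proof. by move=> ik; apply: measurable_transform => //; [exact: measurable_sin|exact: sin_max]. Qed.

Definition cmeasurable (f : E -> R[i]) : Prop :=
  measurable_fun setT (re f) /\ measurable_fun setT (im f).

Lemma cmeasurable_ift k : itg mu k -> cmeasurable (ift k).
Proof.
move=> ik; split; rewrite ?re_ift ?im_ift; apply: measurable_funM => //.
  exact: measurable_cosT.
exact: measurable_sinT.
Qed.

Lemma cmeasurableD f g : cmeasurable f -> cmeasurable g -> cmeasurable (fun x => f x + g x).
Proof.
move=> [f1 f2] [g1 g2]; split.
  rewrite (_ : re _ = (fun x => re f x + re g x)); first exact: measurable_funD.
  by apply/funext => x; rewrite /re; case: (f x); case: (g x).
rewrite (_ : im _ = (fun x => im f x + im g x)); first exact: measurable_funD.
by apply/funext => x; rewrite /im; case: (f x); case: (g x).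
Qed.

Lemma cmeasurableB f g : cmeasurable f -> cmeasurable g -> cmeasurable (fun x => f x - g x).
Proof.
move=> [f1 f2] [g1 g2]; split.
  rewrite (_ : re _ = (fun x => re f x - re g x)); first exact: measurable_funB.
  by apply/funext => x; rewrite /re; case: (f x); case: (g x).
rewrite (_ : im _ = (fun x => im f x - im g x)); first exact: measurable_funB.
by apply/funext => x; rewrite /im; case: (f x); case: (g x).
Qed.

Lemma cmeasurableM f g : cmeasurable f -> cmeasurable g -> cmeasurable (fun x => f x * g x).
Proof.
move=> [f1 f2] [g1 g2]; split.
  rewrite (_ : re _ = (fun x => re f x * re g x - im f x * im g x)).
    by apply: measurable_funB; exact: measurable_funM.
  by apply/funext => x; rewrite /re /im; case: (f x); case: (g x).
rewrite (_ : im _ = (fun x => re f x * im g x + im f x * re g x)).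
  by apply: measurable_funD; exact: measurable_funM.
by apply/funext => x; rewrite /re /im; case: (f x); case: (g x).
Qed.

Lemma measurable_cmod f : cmeasurable f -> measurable_fun setT (fun x => cmod (f x)).
Proof.
move=> [f1 f2]; rewrite (_ : (fun x => _) = (fun x => (re f x ^+ 2 + im f x ^+ 2) `^ 2^-1)).
  apply: measurableT_comp (measurable_powR _) _.
  by apply: measurable_funD; exact: measurable_funX.
apply/funext => x; rewrite powR12_sqrt ?addr_ge0 ?sqr_ge0//.
by rewrite /re /im /cmod; case: (f x).
Qed.

Lemma cmodN (z : R[i]) : cmod (- z) = cmod z.
Proof. by case: z => a b; rewrite /cmod /= !sqrrN. Qed.

End measurable_transform.

Section modulated_gaussian.
Context {R : realType} {d : nat}.
Local Notation E := 'rV[R]_d.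
Local Notation mu := (@lebesgue_rV R d).
Local Notation kap := (@kap R d).
Variables (a b : R) (a0 : 0 <= a) (b0 : 0 < b) (c : E).

Let k0 : 0 < kap. Proof. exact: kap_gt0. Qed.
Let amp : R := kap * a * Num.sqrt (2 * pi / b) ^+ d.
Let amp0 : 0 <= amp.
Proof. by rewrite /amp mulr_ge0 ?exprn_ge0// mulr_ge0// ltW. Qed.

(** Moving the centre of the symbol to [c] modulates the function and leaves
    its modulus unchanged. *)
Lemma cmod_ift_gauss x : cmod (ift (fun z => a * gauss b (z - c)) x) =
  kap * a * Num.sqrt (2 * pi / b) ^+ d * gauss b^-1 x.
Proof.
have ig := schwartz_integrable (schwartz_gauss_shift b0 c).
rewrite iftE cosTZ// sinTZ// cosT_gauss_shift// sinT_gauss_shift// cosT_gauss//.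
rewrite -/amp; have t0 : 0 <= amp * gauss b^-1 x by rewrite mulr_ge0// gauss_ge0.
rewrite /cmod /= -[RHS](ger0_norm t0) -sqrtr_sqr; congr Num.sqrt.
have h := cos2Dsin2 (dot x c).
transitivity ((amp * gauss b^-1 x) ^+ 2 * (cos (dot x c) ^+ 2 + sin (dot x c) ^+ 2)).
  by rewrite /amp; ring.
by rewrite h mulr1.
Qed.

Lemma Lpnorm_ift_gauss p : 0 < p ->
  (Lpnorm p%:E (ift (fun z => a * gauss b (z - c))%R) <=
   (kap * a * Num.sqrt (2 * pi / b) ^+ d * (Num.sqrt (2 * pi * b / p) ^+ d) `^ p^-1)%:E)%E.
Proof.
move=> p0; have pi0 := pi_gt0 R.
apply: Lpnorm_le => //; first by rewrite -/amp mulr_ge0 ?powR_ge0.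
have pb : 0 < p / b by rewrite divr_gt0.
rewrite (eq_integral (fun x => (amp `^ p * gauss (p / b) x)%:E)) => [|x _]; last first.
  rewrite cmod_ift_gauss -/amp powRM ?gauss_ge0//; congr (_ * _)%:E.
  rewrite /gauss /powR gt_eqF ?expR_gt0// expRK; congr expR; field.
  exact: lt0r_neq0.
rewrite integral_fineE; last exact/integrableEZl/integrable_gauss.
rewrite RintegralZT; last exact: integrable_gauss.
rewrite Rintegral_gauss// lee_fin -/amp powRM ?powR_ge0//.
rewrite -powRrM mulVf ?gt_eqF// powRr1 ?exprn_ge0// ler_wpM2l ?powR_ge0//.
rewrite (_ : 2 * pi / (p / b) = 2 * pi * b / p)//; field.
by rewrite !gt_eqF.
Qed.

End modulated_gaussian.

(** * The counterexample *)

Lemma sqrt_ratio {R : realType} (p q rho : R) : 0 < p -> 0 < q -> 0 < rho ->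
  2 * rho = Num.sqrt (2 * p / q) * Num.sqrt (2 * q * rho ^+ 2 / p).
Proof.
move=> p0 q0 rho0; rewrite -sqrtrM; last by rewrite divr_ge0 ?mulr_ge0 ?(ltW p0) ?(ltW q0).
rewrite (_ : 2 * p / q * _ = (2 * rho) ^+ 2); first by rewrite sqrtr_sqr gtr0_norm// mulr_gt0.
by field; rewrite !gt_eqF.
Qed.

Section main.
Context {R : realType} {d : nat}.
Local Notation E := 'rV[R]_d.
Local Notation mu := (@lebesgue_rV R d).
Local Notation kap := (@kap R d).

Lemma gt_near0 (h : E -> R) (L : R) : continuous h -> L < h 0 ->
  exists2 rho : R, 0 < rho & forall x : E, (forall i, `|x ord0 i| <= rho) -> L < h x.
Proof.
move=> ch h0; have /nbhs_ballP[e /= e0 he] : \forall x \near (0 : E), L < h x.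
  by have /cvgr_gt := ch 0; apply.
exists (e / 2) => [|x hx]; first exact: divr_gt0.
apply: he; split=> [|i j]; first exact: e0.
rewrite /ball/= mxE (ord1 i) sub0r normrN.
by apply: le_lt_trans (hx j) _; lra.
Qed.

(** The modulus of the commutator is at least that of [g] times the modulated
    Gaussian, up to the two error terms. *)
Lemma cmod_commutator_ge (g u v w f : R[i]) :
  cmod (g * u) - cmod v - cmod (f * w) <= cmod (v + g * u - f * w).
Proof.
have h1 := cmod_sub (g * u) (f * w - v); have h2 := cmod_sub (f * w - v) (- v).
rewrite cmodN opprK subrK in h2.
have -> : v + g * u - f * w = g * u - (f * w - v) by rewrite opprB addrA (addrC v).
lra.
Qed.

(** Every quantity that has to be small is dominated by the mass of one
    weighted Gaussian, in which [th] is the smallest gain available. *)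
Lemma mass_bound (a th b e : R) (c : E) (k : E -> R) : 0 <= a -> 0 < b ->
  a * \int[mu]_z bracket_gauss (- th) b c z <= e ->
  measurable_fun setT k -> (forall z, `|k z| <= a * bracket_gauss (- th) b c z) ->
  \int[mu]_z `|k z| <= e.
Proof.
move=> a0 b0 he mk hk.
have ib := schwartz_integrable (schwartz_bracket_gauss (- th) c b0).
have ik : itg mu k by apply: integrable_le hk _ => //; exact: integrableEZl.
apply: le_trans he; rewrite -RintegralZT//.
apply: le_Rintegral; first exact: measurableT.
- exact: integrable_norm ik.
- exact: integrableEZl.
- by move=> z _; exact: hk.
Qed.

Lemma gauss_on_cube (rho : R) (x : E) : 0 < rho -> (forall i, `|x ord0 i| <= rho) ->
  expR (- (d%:R / 2)) <= gauss (rho ^+ 2)^-1 x.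
Proof.
move=> rho0 xi; have r2 : 0 < rho ^+ 2 by exact: exprn_gt0.
rewrite /gauss ler_expR lerN2 ler_wpM2r ?invr_ge0//.
rewrite ler_pdivrMl// dotxx (_ : rho ^+ 2 * d%:R = \sum_(i < d) rho ^+ 2); last first.
  by rewrite sumr_const card_ord mulr_natr.
apply: ler_sum => i _; rewrite -(real_normK (num_real (x ord0 i))).
by rewrite lerXn2r ?nnegrE ?(ltW rho0).
Qed.

Lemma cube_norm_le (rho : R) (x : E) : cube (\row_(i < d) (- rho)) (2 * rho) x ->
  forall i, `|x ord0 i| <= rho.
Proof.
by move=> Qx i; have := Qx i; rewrite mxE ler_norml => /andP[h1 h2]; apply/andP; split; lra.
Qed.

End main.

Theorem proposition7p5 (R : realType) (d : nat) (p s M : R) :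
  (1 <= d)%N -> 1 < p -> 1 < s -> s <= 1 + d%:R / p -> 0 < M ->
  exists f g : 'rV[R]_d -> R[i],
    [/\ schwartz f,
        schwartz g,
        (Lpnorm p%:E (bessel s f) + bmo_norm g + grad_norm +oo f
           + Lpnorm p%:E (bessel (s - 1) g) <= 1)%E &
        (M%:E < Lpnorm p%:E (fun x =>
           (bessel s (fun y => f y * g y) x - f x * bessel s g x)%R))%E].
Proof.
move=> d1 p1 s1 sdp M0; have pi0 := pi_gt0 R; have p0 : 0 < p by lra.
pose kap := @kap R d; have k0 : 0 < kap by exact: kap_gt0.
pose mu := @lebesgue_rV R d.
pose sg := s - 1; have sg0 : 0 < sg by rewrite /sg; lra.
have sp : sg <= d%:R / p by rewrite /sg; lra.
have dR : 0 < d%:R :> R by rewrite ltr0n.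
have sd : sg < d%:R by apply: le_lt_trans sp _; rewrite ltr_pdivrMr// ltr_pMr.
(* the [1/p]-th power of the ratio of the measure of the box to [X] below, in
   which the width [rho] of the box cancels *)
pose K1 : R := (Num.sqrt (2 * p / pi) ^+ d) `^ p^-1.
have K10 : 0 < K1 by rewrite powR_gt0// exprn_gt0// sqrtr_gt0 divr_gt0// mulr_gt0.
pose Lam := 8 * (M + 1) * expR (d%:R / 2) / K1.
have Lam0 : 0 < Lam by rewrite divr_gt0// mulr_gt0 ?expR_gt0//; lra.
have [G [sG G0 evG [sin0 GLam bmoG LpG]]] := bad_symbol sg0 sd Lam p1 sp.
have mG := schwartz_measurable sG; have rG := schwartz_rapid sG.
have [rho rho0 near0] : exists2 rho : R, 0 < rho &
    forall x : 'rV[R]_d, (forall i, `|x ord0 i| <= rho) -> Lam < kap * cosT G x.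
  apply: (@gt_near0 R d (fun x => kap * cosT G x)) => //.
  by apply: continuous_mulf; [exact: cst_continuous|exact: cosT_continuous].
pose b := rho ^+ 2; have b0 : 0 < b by exact: exprn_gt0.
pose X : R := Num.sqrt (2 * pi * b / p) ^+ d.
have X0 : 0 < X by rewrite exprn_gt0// sqrtr_gt0 divr_gt0// !mulr_gt0.
(* the amplitude for which [J^s f] has norm one quarter in [L^p] *)
pose A : R := 4^-1 * X `^ (- p^-1); have A0 : 0 < A by rewrite mulr_gt0 ?powR_gt0.
pose Y : R := Num.sqrt (2 * pi / b) ^+ d.
have Y0 : 0 < Y by rewrite exprn_gt0// sqrtr_gt0 divr_gt0// mulr_gt0.
pose a := A / (kap * Y); have a0 : 0 < a := divr_gt0 A0 (mulr_gt0 k0 Y0).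
have aA : kap * a * Y = A.
  by rewrite mulrAC mulrC /a divfK// gt_eqF// mulr_gt0.
have s0 : 0 <= s by lra.
have [C C0 comm] := @commutator_symbol R d s s0.
pose Gam := \int[mu]_z (jb (z : 'rV[R]_d) `^ (s / 2 + 1) * G z).
have Gam0 : 0 <= Gam by apply: Rintegral_ge0 => z _; rewrite mulr_ge0 ?powR_ge0.
pose K (z : 'rV[R]_d) := jb z `^ (s / 2) * G z.
have iK : itg mu K.
  apply: rapid_integrable; last exact: rapid_jb_powR.
  by apply: measurable_funM => //; exact: measurable_jb_powR.
pose B := 2 * kap * \int[mu]_z `|K z|.
have B0 : 0 <= B by rewrite !mulr_ge0 ?(ltW k0)//; apply: Rintegral_ge0.
(* half of the size of the main term on the box of half-width [rho] *)
pose half := A * expR (- (d%:R / 2)) * Lam / 2.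
have half0 : 0 < half := divr_gt0 (mulr_gt0 (mulr_gt0 A0 (expR_gt0 _)) Lam0) (ltr0Sn _ 1).
have kk0 : 0 < 2 * kap := mulr_gt0 (ltr0Sn _ 1) k0.
have err0 : 0 <= 2 * kap * (C * Gam) + 2 * kap * B.
  exact: addr_ge0 (mulr_ge0 (ltW kk0) (mulr_ge0 C0 Gam0)) (mulr_ge0 (ltW kk0) B0).
have dk0 : 0 < 4 * (d%:R * (2 * kap)) := mulr_gt0 (ltr0Sn _ 3) (mulr_gt0 dR kk0).
(* the first bound serves the gradient of [f], the second the two error terms *)
pose e := Num.min ((4 * (d%:R * (2 * kap)))^-1) (half / (2 * kap * (C * Gam) + 2 * kap * B + 1)).
have den0 : 0 < 2 * kap * (C * Gam) + 2 * kap * B + 1.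
  exact: ltr_wpDl err0 ltr01.
have e0 : 0 < e by rewrite lt_min invr_gt0 dk0 divr_gt0.
have e1 : d%:R * (2 * kap * e) <= 4^-1.
  have : e <= (4 * (d%:R * (2 * kap)))^-1 by rewrite ge_min lexx.
  rewrite -[leRHS]mul1r ler_pdivlMr//; lra.
have e2 : e * (2 * kap * (C * Gam) + 2 * kap * B + 1) <= half.
  by rewrite -ler_pdivlMr// ge_min lexx orbT.
(* a gain of one half in the commutator, and of [sg / 2] in the gradient of
   [f] *)
pose th := Num.min 2^-1 (sg / 2).
have th0 : 0 < th by rewrite lt_min invr_gt0 ltr0n; exact: divr_gt0 sg0 (ltr0Sn _ 1).
have th1 : th <= 2^-1 by rewrite ge_min lexx.
have th2 : th <= sg / 2 by rewrite ge_min lexx orbT.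
have [c hc] := @small_mass R d th b (e / a) d1 th0 b0 (divr_gt0 e0 a0).
have he : a * \int[mu]_z bracket_gauss (- th) b c z <= e by rewrite mulrC -ler_pdivlMr.
have mass := mass_bound (ltW a0) b0 he.
pose F (z : 'rV[R]_d) := a * bracket_gauss (- (s / 2)) b c z.
have sF : real_schwartz F by apply: schwartzZ; exact: schwartz_bracket_gauss.
have mF := schwartz_measurable sF; have iF := schwartz_integrable sF.
have F0 z : 0 <= F z by rewrite mulr_ge0 ?bracket_gauss_ge0 ?(ltW a0).
have Fle (t : R) z : t <= s / 2 - th -> jb z `^ t * F z <= a * bracket_gauss (- th) b c z.
  move=> ht; rewrite /F mulrCA ler_wpM2l ?(ltW a0)// /bracket_gauss mulrA.
  rewrite ler_wpM2r ?gauss_ge0// -powRD; last by rewrite (gt_eqF (jb_gt0 z)) implybT.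
  by rewrite ler_powR ?jb_ge1//; clear -ht; lra.
have th3 : 0 <= s / 2 - th by clear -th2 sg0; rewrite /sg in th2 sg0; lra.
have th4 : 2^-1 <= s / 2 - th by clear -th2; rewrite /sg in th2; lra.
have massF : \int[mu]_z `|F z| <= e.
  apply: mass => // z; rewrite ger0_norm// -[leLHS]mul1r -(powRr0 (jb z)).
  by apply: Fle.
have massZ (i : 'I_d) : \int[mu]_z `|(z : 'rV[R]_d) ord0 i * F z| <= e.
  apply: mass => [|z]; first by apply: measurable_funM => //; exact: measurable_coord.
  rewrite normrM (ger0_norm (F0 z)).
  apply: (@le_trans _ _ (jb z `^ 2^-1 * F z)); last by apply: Fle.
  rewrite ler_wpM2r// powR12_sqrt ?(ltW (jb_gt0 z))// -sqrtr_sqr ler_sqrt ?(ltW (jb_gt0 z))//.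
  by have := sqr_coord_le_dot z i; rewrite /jb; clear; lra.
have massH : \int[mu]_z (jb z `^ (s / 2 - 2^-1) * F z) <= e.
  have hm z : 0 <= jb z `^ (s / 2 - 2^-1) * F z := mulr_ge0 (powR_ge0 _ _) (F0 z).
  rewrite (@eq_Rintegral _ _ _ mu setT (fun z => `|jb z `^ (s / 2 - 2^-1) * F z|)); last first.
    by move=> u _; rewrite ger0_norm.
  apply: mass => [|z]; first by apply: measurable_funM => //; exact: measurable_jb_powR.
  by rewrite ger0_norm//; apply: Fle; clear -th1; lra.
have PsiE : bessel s (ift F) = ift (fun z => a * gauss b (z - c)).
  rewrite bessel_ift//; congr (ift _); apply/funext => z.
  rewrite /F mulrCA; congr (_ * _); rewrite /bracket_gauss mulrA -powRD ?subrr ?powRr0 ?mul1r//.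
  by rewrite (gt_eqF (jb_gt0 z)) implybT.
have [D iD [hD TD]] := comm F G sF sG F0 G0 evG sin0.
exists (ift F), (ift G); split; [exact: schwartz_ift|exact: schwartz_ift| |].
- have n1 : (Lpnorm p%:E (bessel s (ift F)) <= (4^-1)%:E)%E.
    rewrite PsiE; apply: le_trans (Lpnorm_ift_gauss (ltW a0) b0 c p0) _.
    rewrite -/kap -/Y aA -/X lee_fin /A powRN divfK ?gt_eqF ?powR_gt0//.
  have n2 : (grad_norm +oo (ift F) <= (4^-1)%:E)%E.
    apply: (@le_trans _ _ (\sum_(i < d) (2 * kap * e)%:E)%E); last first.
      by rewrite sumEFin lee_fin sumr_const card_ord -[X in X <= _]mulr_natl.
    apply: lee_sum => i _; apply: Lpnorm_pinfty_le => x; rewrite cpartial_ift//.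
    apply: le_trans (cmod_le _ _) _.
    have iZ : itg mu (fun z : 'rV[R]_d => z ord0 i * F z).
      by apply/schwartz_integrable/schwartz_coord.
    rewrite normrN !normrM (gtr0_norm k0).
    have hs := le_trans (norm_sinT x iZ) (massZ i); have hcs := le_trans (norm_cosT x iZ) (massZ i).
    have := ler_wpM2l (ltW k0) hs; have := ler_wpM2l (ltW k0) hcs; clear; lra.
  have n3 : (Lpnorm p%:E (bessel (s - 1) (ift G)) <= (4^-1)%:E)%E by rewrite bessel_ift.
  apply: le_trans (leeD (leeD (leeD n1 bmoG) n2) n3) _.
  by rewrite -!EFinD lee_fin; clear; lra.
- have TE x : bessel s (fun y => ift F y * ift G y) x - ift F x * bessel s (ift G) x =
      ift D x + ift G x * bessel s (ift F) x - ift F x * ift K x.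
    by rewrite -TD subrK bessel_ift.
  pose Q := cube (\row_(i < d) (- rho)) (2 * rho).
  have rho2 : 0 < 2 * rho by exact: mulr_gt0.
  have mQ : measurable Q by exact: measurable_cube.
  have muQ : mu Q = ((2 * rho) ^+ d)%:E by exact: lebesgue_cube.
  have low x : Q x -> half <= cmod (bessel s (fun y => ift F y * ift G y) x - ift F x * bessel s (ift G) x).
    move=> /cube_norm_le xi.
    rewrite TE; apply: le_trans (cmod_commutator_ge _ _ _ _ _).
    have hgu : 2 * half <= cmod (ift G x * bessel s (ift F) x).
      rewrite cmodM (ift_even sin0) cmod_real PsiE cmod_ift_gauss ?(ltW a0)// -/kap -/Y aA.
      rewrite (_ : 2 * half = Lam * (A * expR (- (d%:R / 2)))); last by rewrite /half; field.
      apply: ler_pM (ltW Lam0) (mulr_ge0 (ltW A0) (expR_ge0 _)) _ _.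
        exact: le_trans (ltW (near0 x xi)) (ler_norm _).
      by rewrite ler_wpM2l ?(ltW A0)// gauss_on_cube.
    have hv : cmod (ift D x) <= 2 * kap * (C * Gam) * e.
      apply: le_trans (cmod_ift_le x iD) _.
      rewrite -/kap -[leRHS]mulrA; apply: ler_wpM2l (ltW kk0) _ _ _; apply: le_trans hD _.
      rewrite -/Gam -[leRHS]mulrA; apply: ler_wpM2l C0 _ _ _; rewrite [leRHS]mulrC.
      exact: ler_wpM2r Gam0 _ _ massH.
    have hfw : cmod (ift F x * ift K x) <= 2 * kap * B * e.
      rewrite cmodM (_ : 2 * kap * B * e = 2 * kap * e * B); last by ring.
      apply: ler_pM (cmod_ge0 _) (cmod_ge0 _) _ (cmod_ift_le x iK).
      apply: le_trans (cmod_ift_le x iF) _; rewrite -/kap; exact: ler_wpM2l (ltW kk0) _ _ massF.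
    clear -hgu hv hfw e2 e0; lra.
  have half_ge0 := ltW half0.
  have rd0 : 0 <= (2 * rho) ^+ d by rewrite exprn_ge0 ?(ltW rho2).
  apply: lt_le_trans (Lpnorm_ge p0 half_ge0 rd0 mQ muQ low _); last first.
    apply: measurable_cmod.
    have -> : (fun x => bessel s (fun y => ift F y * ift G y) x - ift F x * bessel s (ift G) x) =
        (fun x => ift D x + ift G x * bessel s (ift F) x - ift F x * ift K x) by exact/funext.
    apply: cmeasurableB; last by apply: cmeasurableM; exact: cmeasurable_ift.
    apply: cmeasurableD; first exact: cmeasurable_ift.
    apply: cmeasurableM; first exact/cmeasurable_ift/schwartz_integrable.
    rewrite PsiE; apply: cmeasurable_ift.
    exact: integrableEZl (integrable_shift _ (integrable_gauss b0)).
  rewrite lte_fin.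
  have -> : (2 * rho) ^+ d = Num.sqrt (2 * p / pi) ^+ d * X.
    by rewrite /X -exprMn; congr (_ ^+ _); exact: sqrt_ratio.
  rewrite powRM ?exprn_ge0 ?(ltW X0)// -/K1.
  have -> : half * (K1 * X `^ p^-1) = M + 1; last by rewrite ltrDl ltr01.
  rewrite /half /A /Lam expRN powRN.
  have h1 : K1 != 0 by exact: lt0r_neq0.
  have h2 : X `^ p^-1 != 0 := lt0r_neq0 (powR_gt0 p^-1 X0).
  have h3 : expR (d%:R / 2) != 0 :> R by rewrite gt_eqF// expR_gt0.
  move: h1 h2 h3; generalize (X `^ p^-1) (expR (d%:R / 2) : R) K1 => v u k h1 h2 h3.
  by field; rewrite ?h1 ?h2 ?h3.
Qed.
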